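(* For $n\in\mathbb{N}$, let $(\mu_n,\nu_n)\in\mathcal{P}(\mathcal{X})\times\mathcal{P}(\mathcal{Y})$ satisfy $\mathcal{C}(\mu_n,\nu_n)<\infty$, let $\pi_n\in\Pi(\mu_n,\nu_n)$ be the optimal coupling and let $(f_n,g_n)$ be corresponding potentials. Suppose that $$\sup_{n\in\mathbb{N}}\int f_n^+\,d\mu_n<\infty,\qquad \sup_{n\in\mathbb{N}}\int g_n^+\,d\nu_n<\infty,$$ and that $\mu_n\to\mu$ and $\nu_n\to\nu$ weakly, where $(\mu,\nu)\in\mathcal{P}(\mathcal{X})\times\mathcal{P}(\mathcal{Y})$. Then: (i) $\mathcal{C}(\mu,\nu)<\infty$, and the optimal couplings converge weakly: $\pi_n\to\pi_*$, where $\pi_*\in\Pi(\mu,\nu)$ is the optimal coupling for $(\mu,\nu)$. (ii) Suppose also that the normalizations $\alpha_n:=\int\arctan(f_n)\,d\mu_n$ converge to a limit $\alpha$ (this always holds along a subsequence). Let $(\varepsilon_k)_{k\in\mathbb{N}}\subset(0,1)$ satisfy $\varepsilon_k\downarrow 0$. There are measurable functions $$F_n^k,\,F^k,\,f:\mathcal{X}\to\mathbb{R},\qquad G_n^k,\,G^k,\,g:\mathcal{Y}\to\mathbb{R},\qquad k,n\in\mathbb{N},$$ and a subsequence $(n_l)_{l\in\mathbb{N}}\subset\mathbb{N}$ such that (a) $(f,g)\in L^1(\mu)\times L^1(\nu)$ are the potentials for $(\mu,\nu)$ with $\int\arctan(f)\,d\mu=\alpha$; (b) $(f_n)_{\#}\mu_n\to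 f_{\#}\mu$ weakly and $(g_n)_{\#}\nu_n\to g_{\#}\nu$ weakly; (c) $\lim_{k\to\infty}\sup_{n\in\mathbb{N}}\mu_n(|f_n-F_n^k|\ge\varepsilon_k)=0$ and $\lim_{k\to\infty}\sup_{n\in\mathbb{N}}\nu_n(|g_n-G_n^k|\ge\varepsilon_k)=0$; (d) for each $k\in\mathbb{N}$, $\lim_{l\to\infty}F_{n_l}^k=F^k$ uniformly on $\mathcal{X}$ and $\lim_{l\to\infty}G_{n_l}^k=G^k$ uniformly on $\mathcal{Y}$; (e) $\lim_{k\to\infty}F^k=f$ in $\mu$-probability and $\lim_{k\to\infty}G^k=g$ in $\nu$-probability. (iii) Suppose that $(f_n^+,g_n^+)_{n\in\mathbb{N}}$ are uniformly integrable with respect to $(\mu_n,\nu_n)_{n\in\mathbb{N}}$, that is, $$\lim_{C\to\infty}\sup_{n\in\mathbb{N}}\int f_n\mathbf{1}_{\{f_n>C\}}\,d\mu_n=0,\qquad \lim_{C\to\infty}\sup_{n\in\mathbb{N}}\int g_n\mathbf{1}_{\{g_n>C\}}\,d\nu_n=0.$$ Then the optimal values converge: $\mathcal{C}(\mu_n,\nu_n)\to\mathcal{C}(\mu,\nu)$. If moreover $\alpha_n:=\int\arctan(f_n)\,d\mu_n$ converges to a limit $\alpha$ and $(f,g)$ are the potentials for $(\mu,\nu)$ with $\int\arctan(f)\,d\mu=\alpha$, then $$\lim_{n\to\infty}\int f_n\,d\mu_n=\int f\,d\mu,\qquad \lim_{n\to\infty}\int g_n\,d\nu_n=\int g\,d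\nu.$$
   Context: $\mathcal{X},\mathcal{Y}$ are Polish spaces with their Borel $\sigma$-fields; $\mathcal{P}(\mathcal{X}),\mathcal{P}(\mathcal{Y})$ are the sets of Borel probability measures; $c:\mathcal{X}\times\mathcal{Y}\to[0,\infty)$ is continuous. $\Pi(\mu,\nu)$ is the set of couplings, i.e. probability measures on $\mathcal{X}\times\mathcal{Y}$ with marginals $(\mu,\nu)$. The entropic optimal transport problem is $$\mathcal{C}(\mu,\nu):=\inf_{\pi\in\Pi(\mu,\nu)}\int c\,d\pi+H(\pi|\mu\otimes\nu),$$ where $H(\pi|\rho)=\int\log\frac{d\pi}{d\rho}\,d\pi$ if $\pi\ll\rho$ and $H(\pi|\rho)=\infty$ otherwise. If $\mathcal{C}(\mu,\nu)<\infty$, there is a unique minimizer $\pi_*\in\Pi(\mu,\nu)$, called the optimal coupling, and there are measurable functions $f:\mathcal{X}\to\mathbb{R}$, $g:\mathcal{Y}\to\mathbb{R}$, called potentials for $(\mu,\nu)$, such that $$\frac{d\pi_*}{d(\mu\otimes\nu)}=e^{f\oplus g-c}\quad\mu\otimes\nu\text{-a.s.},\qquad (f\oplus g)(x,y):=f(x)+g(y).$$ Potentials are a.s. unique up to an additive constant ($(f+a,g-a)$, $a\in\mathbb{R}$); since $\arctan$ is strictly increasing, fixing $\int\arctan(f)\,d\mu$ determines the constant. Weak convergence of measures is convergence against bounded continuous functions; $f_\#\mu$ is the pushforward of $\mu$ under $f$; $f^+=\max(f,0)$. *)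

(* Defs.v *)
From HB Require Import structures.
From mathcomp Require Import all_boot all_order all_algebra.
From mathcomp Require Import all_classical all_reals all_analysis.
Import Order.TTheory GRing.Theory Num.Theory.
Import numFieldNormedType.Exports.

Set Implicit Arguments.
Unset Strict Implicit.
Unset Printing Implicit Defensive.

Local Open Scope classical_set_scope.
Local Open Scope ring_scope.
Local Open Scope charge_scope.

HB.mixin Record isSeparable T & Topological T := {
  separable : exists2 D : set T, countable D & dense D
}.

(* A Polish space comes with one of the complete metrics inducing its topology.
   Nonemptiness (Complete is pointed) is no restriction for spaces carrying a
   probability measure. *)
#[short(type="polishType")]
HB.structure Definition Polish (R : numDomainType) :=
  {T of Metric R T & Complete T & isSeparable T}.

(* No compatibility between topology and sigma-algebra is imposed here; the
   instances are Borel spaces, their binary products, and the real line. *)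
#[short(type="topMeasurableType")]
HB.structure Definition TopMeasurable d :=
  {T of Topological T & Measurable d T}.

Definition borel (T : ptopologicalType) : Type := T.

HB.instance Definition _ (T : ptopologicalType) :=
  PointedTopological.on (borel T).
HB.instance Definition _ (T : ptopologicalType) :=
  Measurable.copy (borel T) (g_sigma_algebraType (@open T)).

(* Product topology with product sigma-algebra. On [borel X * borel Y] the
   latter is the Borel sigma-algebra when X and Y are second countable, in
   particular when they are Polish. *)
HB.instance Definition _ d1 d2
    (T1 : topMeasurableType d1) (T2 : topMeasurableType d2) :=
  Topological.on (T1 * T2)%type.

HB.instance Definition _ (R : realType) :=
  Topological.copy (Real.sort R) R^o.

Section convergence.
Context (R : realType).

Definition weak_cvg d (T : topMeasurableType d)
    (P_ : nat -> probability T R) (P : probability T R) : Prop :=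
  forall h : T -> R, continuous h -> bounded_fun h ->
    \int[P_ n]_x h x @[n --> \oo] --> \int[P]_x h x.

Definition cvg_in_probability d (T : measurableType d) (P : probability T R)
    (h_ : nat -> T -> R) (h : T -> R) : Prop :=
  forall e : R, 0 < e ->
    P [set x | e <= `|h_ k x - h x|] @[k --> \oo] --> 0%E.

End convergence.

Section entropic_optimal_transport.
Context (R : realType).
Local Open Scope ereal_scope.

(* H(P|Q) *)
Definition relative_entropy d (T : measurableType d) (P Q : probability T R)
    : \bar R :=
  if `[< P `<< Q >]
  then \int[P]_x lne ('d (charge_of_finite_measure P) '/d Q x)
  else +oo.

Context (X Y : polishType R).
Implicit Types (c : X * Y -> R) (mu : probability (borel X) R)
  (nu : probability (borel Y) R) (pi : probability (borel X * borel Y)%type R).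

Definition coupling mu nu : set (probability (borel X * borel Y)%type R) :=
  [set pi | (forall A, measurable A -> pushforward pi fst A = mu A) /\
            (forall B, measurable B -> pushforward pi snd B = nu B)].

Definition eot_cost c mu nu pi : \bar R :=
  \int[pi]_z (c z)%:E + relative_entropy pi (mu \x nu).

Definition eot_value c mu nu : \bar R :=
  ereal_inf [set eot_cost c mu nu pi | pi in coupling mu nu].

Definition optimal_coupling c mu nu pi : Prop :=
  [/\ eot_value c mu nu < +oo,
      coupling mu nu pi &
      eot_cost c mu nu pi = eot_value c mu nu].

Definition potentials c mu nu
    (f : {mfun borel X >-> R}) (g : {mfun borel Y >-> R}) : Prop :=
  let rho : probability (borel X * borel Y)%type R := mu \x nu in
  exists pi, [/\ optimal_coupling c mu nu pi,
    pi `<< rho &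
    {ae rho, forall z, 'd (charge_of_finite_measure pi) '/d rho z =
                       (expR (f z.1 + g z.2 - c z))%:E}].

End entropic_optimal_transport.

(* Main.v *)
(* With [phi_n = f_n + g_n - c], the optimal coupling is [exp phi_n] times the
   product of its marginals.  Testing the marginal constraints on [A * K], [K]
   compact carrying most of [nu_n], shows that [f_n] is close in
   [mu_n]-probability to [- ln \int_K exp (g_n y - c (x, y)) nu_n(dy)], and these
   functions of [x] are equicontinuous because [c] is continuous in [x] uniformly
   over [y] in [K].  A diagonal Arzela-Ascoli extraction, over better and better
   approximations, yields limits [f] and [g].  The bounds on [f_n^+] and [g_n^+]
   bound [f_n] and [g_n] in L^1, because the values are nonnegative; hence the
   densities [exp phi_n] are uniformly integrable and [exp (f + g - c)] is the
   density of a coupling of [mu] and [nu] to which the optimal couplings converge.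
   Any coupling with such a density and integrable potentials is the unique
   optimal one, by [ln t >= 1 - 1 / t].  As potentials are unique up to a constant,
   fixed by the mean of the arctangent, all subsequential limits agree. *)

Require Import Defs.
From HB Require Import structures.
From mathcomp Require Import all_boot all_order all_algebra.
From mathcomp Require Import all_classical all_reals all_analysis.
From mathcomp Require Import measurable_realfun lra ring.
Import Order.TTheory GRing.Theory Num.Theory.
Import numFieldNormedType.Exports.
Set Implicit Arguments.
Unset Strict Implicit.
Unset Printing Implicit Defensive.
Local Open Scope classical_set_scope.
Local Open Scope ring_scope.

(** * Borel sets of Polish spaces *)

(** Optimality does not pass to the limit through the cost, which is only lower semicontinuous. What
    passes is the pair of marginals and the exponential form of the density; optimality of the limit
    is read off from these two. The closeness of [f_ n] to the restricted soft transform [s] comes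
    from the two sides of the marginal constraint: [pi_ n] gives the rectangle over [A] and [K] at
    most the mass [mu_ n A], and at least this mass minus that of the complement of [K] under
    [nu_ n]. As the mass of the rectangle is the integral of [exp (f_ n - s)] over [A], choosing for
    [A] the set where [f_ n - s] is far from 0 bounds the measure of this set. The additive
    constants of the potentials cannot escape to infinity, since [f_ n] and [g_ n] are bounded in
    L^1 separately. The arctangent is bounded and continuous, so its mean converges along with the
    potentials and singles out one limit. *)

Lemma countable_bigcup_measurable d (T : measurableType d) (I : Type)
    (D : set I) (F : I -> set T) : countable D ->
  (forall i, D i -> measurable (F i)) -> measurable (\bigcup_(i in D) F i).
Proof.
move=> /countable_injP[k k_inj] mF.
have -> : \bigcup_(i in D) F i =
    \bigcup_n \bigcup_(i in D `&` k @^-1` [set n]) F i.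
  rewrite eqEsubset; split=> [x [i Di Fx]|x [n _ [i [Di _] Fx]]].
    by exists (k i) => //; exists i.
  by exists i.
apply: bigcupT_measurable => n.
(* As [k] is injective on [D], the block of index [n] contains at most one of the sets. *)
have [[i [Di kin]]|no] := pselect (exists i, D i /\ k i = n); last first.
  rewrite (_ : \bigcup_(_ in _) _ = set0)//.
  by rewrite -subset0 => x [i [Di kin] _]; apply: no; exists i.
rewrite (_ : \bigcup_(_ in _) _ = F i); first exact: mF.
rewrite eqEsubset; split=> [x [j [Dj kjn]]|x Fx]; last by exists i.
by rewrite (k_inj j i) ?inE//= kin.
Qed.

Lemma polish_second_countable (R : realType) (X : polishType R) :
  @second_countable X.
Proof.
have [D cD dD] := @separable R X.
pose b (p : X * nat) : set X := (ball p.1 p.2.+1%:R^-1)°.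
exists (b @` (D `*` [set: nat])).
  apply: (@sub_countable _ _ _ (D `*` [set: nat])); first exact: card_image_le.
  exact: countableX.
split=> [_ [p _ <-]|x V /nbhs_ballP[e /= e0 eV]]; first exact: open_interior.
(* With [1 / (N + 1) < e / 2], a point of [D] within half of that radius of [x] is the centre of a
   basic ball that is a neighbourhood of [x] and stays within distance [e] of it. *)
have [N] := @ltr_add_invr R 0 (e / 2) (divr_gt0 e0 (ltr0Sn R 1)).
rewrite add0r => Ne.
have N0 : 0 < N.+1%:R^-1 :> R by rewrite invr_gt0.
have N20 : 0 < N.+1%:R^-1 / 2 :> R by rewrite divr_gt0.
have [] := dD (ball x (N.+1%:R^-1 / 2))°.
- by exists x; exact: nbhsx_ballx.
- exact: open_interior.
move=> y [xy Dy].
exists (b (y, N)); first split; first by exists (y, N).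
  apply/nbhs_ballP; exists (N.+1%:R^-1 / 2) => //= z xz.
  rewrite [_^-1]splitr; apply: (@ball_triangle _ _ x) => //.
  exact: ball_sym (interior_subset xy).
rewrite /b /= => z /interior_subset yz; apply: eV.
rewrite [e]splitr; apply: (@ball_triangle _ _ y).
  apply: le_ball (interior_subset xy).
  move: Ne N0; set r := _^-1 => Ne N0; lra.
exact: le_ball (ltW Ne) _ yz.
Qed.

Lemma continuous_measurable_borel (R : realType) (T : ptopologicalType)
    (h : borel T -> R) : continuous h -> measurable_fun setT h.
Proof.
move=> /continuousP ch; apply: (measurability _ (RGenOpens.measurableE R)).
move=> _ [U [x [y ->]] <-]; rewrite setTI; apply: sub_sigma_algebra.
apply: ch; exact: interval_open.
Qed.

Lemma open_measurable_borel (T : ptopologicalType) (U : set T) :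
  open U -> measurable (U : set (borel T)).
Proof. by move=> oU; apply: sub_sigma_algebra. Qed.

Lemma closed_measurable_borel (T : ptopologicalType) (F : set T) :
  closed F -> measurable (F : set (borel T)).
Proof.
move=> cF; rewrite -[F]setCK; apply: measurableC.
by apply: open_measurable_borel; exact: closed_openC.
Qed.

(** Second countability writes an open set of the product as a countable union of open rectangles,
    which belong to the product sigma-algebra. This is the point where separability makes that
    sigma-algebra contain the Borel sets. *)
Lemma open_measurable_prod (R : realType) (X Y : polishType R)
    (U : set (X * Y)) : open U -> measurable (U : set (borel X * borel Y)).
Proof.
move=> oU.
have [A cA [oA bA]] := @polish_second_countable R X.
have [B cB [oB bB]] := @polish_second_countable R Y.
pose I := [set p : set X * set Y | [/\ A p.1, B p.2 & p.1 `*` p.2 `<=` U]].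
have -> : U = \bigcup_(p in I) (p.1 `*` p.2).
  rewrite eqEsubset; split=> [z Uz|z [p [_ _]] pU /pU //].
  have : nbhs z U by apply: open_nbhs_nbhs; split.
  move=> [[P Q] /= [Pz Qz] PQU].
  have [P' [AP' P'z] P'P] := bA _ _ Pz.
  have [Q' [BQ' Q'z] Q'Q] := bB _ _ Qz.
  exists (P', Q') => //; split=> //= w [Pw Qw].
  by apply: PQU; split; [exact: P'P|exact: Q'Q].
apply: countable_bigcup_measurable.
  apply: (@sub_countable _ _ _ (A `*` B)); last exact: countableX.
  by apply: subset_card_le => p [].
move=> p [Ap Bp _]; apply: measurableX; apply: open_measurable_borel.
  exact: oA.
exact: oB.
Qed.

Lemma continuous_measurable_prod (R : realType) (X Y : polishType R)
    (h : borel X * borel Y -> R) : continuous h -> measurable_fun setT h.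
Proof.
move=> /continuousP ch; apply: (measurability _ (RGenOpens.measurableE R)).
move=> _ [U [x [y ->]] <-]; rewrite setTI; apply: open_measurable_prod.
apply: ch; exact: interval_open.
Qed.

(** * Integrals of bounded functions *)

Lemma Rintegral_cst_probability d (T : measurableType d) (R : realType)
    (P : probability T R) (M : R) : \int[P]_x M = M.
Proof.
rewrite Rintegral_cst// -[RHS]mulr1; congr (_ * _).
by rewrite -[RHS]/(fine (1%E : \bar R)); congr fine; exact: probability_setT.
Qed.

Lemma bounded_integrable d (T : measurableType d) (R : realType)
    (P : probability T R) (h : T -> R) (M : R) :
  measurable_fun setT h -> (forall x, `|h x| <= M) ->
  P.-integrable setT (EFin \o h).
Proof.
move=> mh bh; apply: measurable_bounded_integrable => //.
  by rewrite (le_lt_trans (probability_le1 _ _))// ltry.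
exists M; split; first exact: num_real.
by move=> N MN x _; exact: le_trans (bh x) (ltW MN).
Qed.

Lemma bounded_Rintegral_le d (T : measurableType d) (R : realType)
    (P : probability T R) (h : T -> R) (M : R) :
  measurable_fun setT h -> (forall x, `|h x| <= M) ->
  `|\int[P]_x h x| <= M.
Proof.
move=> mh bh; have ih := bounded_integrable P mh bh.
apply: (le_trans (le_normr_Rintegral measurableT ih)).
rewrite -[leRHS](Rintegral_cst_probability P).
apply: le_Rintegral => //.
- by apply: (@bounded_integrable _ _ _ _ _ M) => [|x]; [exact: measurableT_comp|rewrite /= normr_id].
- by apply: (@bounded_integrable _ _ _ _ _ `|M|).
Qed.

(** The integrands differ by at most [e] off [A] and by at most [M + M] on [A]. The later
    approximation arguments supply an exceptional set [A] of small probability. *)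
Lemma Rintegral_dist_le d (T : measurableType d) (R : realType)
    (P : probability T R) (h1 h2 : T -> R) (M e : R) (A : set T) :
  measurable_fun setT h1 -> measurable_fun setT h2 ->
  (forall x, `|h1 x| <= M) -> (forall x, `|h2 x| <= M) ->
  measurable A -> 0 <= e -> (forall x, ~ A x -> `|h1 x - h2 x| <= e) ->
  `|\int[P]_x h1 x - \int[P]_x h2 x| <= e + (M + M) * fine (P A).
Proof.
move=> mh1 mh2 b1 b2 mA e0 hA.
have M0 : 0 <= M by exact: le_trans (normr_ge0 _) (b1 point).
have i1 := bounded_integrable P mh1 b1; have i2 := bounded_integrable P mh2 b2.
have bd x : `|h1 x - h2 x| <= M + M.
  exact: le_trans (ler_normB _ _) (lerD (b1 x) (b2 x)).
have md : measurable_fun setT (fun x => h1 x - h2 x) by exact: measurable_funB.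
rewrite -RintegralB//.
apply: (le_trans (le_normr_Rintegral measurableT (bounded_integrable P md bd))).
have mA1 : measurable_fun setT (fun x => (M + M) * \1_A x).
  by apply: measurable_funM => //; exact: measurable_indic.
have iA1 : P.-integrable setT (EFin \o (fun x => \1_A x : R)).
  apply: (@bounded_integrable _ _ _ _ _ 1); first exact: measurable_indic.
  by move=> x; rewrite indicE; case: (x \in A); rewrite ?normr1 ?normr0.
have iA2 : P.-integrable setT (EFin \o (fun x => (M + M) * \1_A x)).
  apply: (@bounded_integrable _ _ _ _ _ (M + M)) => // x.
  rewrite normrM (ger0_norm (addr_ge0 M0 M0)) ler_piMr ?addr_ge0//.
  by rewrite indicE; case: (x \in A); rewrite ?normr1 ?normr0.
have ie : P.-integrable setT (EFin \o cst e).
  exact: (@bounded_integrable _ _ _ _ _ `|e|).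
have -> : e + (M + M) * fine (P A) = \int[P]_x (cst e x + (M + M) * \1_A x).
  rewrite RintegralD// Rintegral_cst_probability.
  rewrite RintegralZl//; congr (_ + _ * _).
  by rewrite /Rintegral integral_indic// setIT.
apply: le_Rintegral => //.
- apply: (@bounded_integrable _ _ _ _ _ (M + M)); first exact: measurableT_comp.
  by move=> x; rewrite normr_id.
- apply: (@bounded_integrable _ _ _ _ _ (`|e| + (M + M))).
    exact: measurable_funD.
  move=> x; apply: (le_trans (ler_normD _ _)); rewrite lerD2l.
  rewrite normrM (ger0_norm (addr_ge0 M0 M0)) ler_piMr ?addr_ge0//.
  by rewrite indicE; case: (x \in A); rewrite ?normr1 ?normr0.
- move=> x _ /=; rewrite indicE; case: (boolP (x \in A)) => [|/negP] xA.
    by rewrite mulr1 (le_trans (bd x))// lerDr.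
  by rewrite mulr0 addr0; apply: hA => Ax; apply: xA; rewrite inE.
Qed.

Lemma bounded_cvg_Rintegral d (T : measurableType d) (R : realType)
    (P : probability T R) (h_ : nat -> T -> R) (h : T -> R) (M : R) :
  (forall n, measurable_fun setT (h_ n)) -> measurable_fun setT h ->
  (forall n x, `|h_ n x| <= M) ->
  {ae P, forall x, h_ n x @[n --> \oo] --> h x} ->
  \int[P]_x h_ n x @[n --> \oo] --> \int[P]_x h x.
Proof.
move=> mh_ mh bh cvh.
have iM : P.-integrable setT (EFin \o cst M).
  exact: (@bounded_integrable _ _ _ _ _ `|M|).
have mh_E n : measurable_fun setT (EFin \o h_ n) by exact/measurable_EFinP.
have mhE : measurable_fun setT (EFin \o h) by exact/measurable_EFinP.
have [||ih _ cvi] := @dominated_convergence _ _ _ P setT measurableT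
  (fun n => EFin \o h_ n) (EFin \o h) (EFin \o cst M) mh_E mhE _ iM _.
- by apply: filterS cvh => x hx _; apply: cvg_EFin => //; exact: nearW.
- by apply: aeW => x n _; rewrite lee_fin; exact: bh.
- by apply: fine_cvg; rewrite fineK//; exact: integrable_fin_num.
Qed.

Lemma bounded_fun_le (R : realType) (T : Type) (h : T -> R) (M : R) :
  (forall x, `|h x| <= M) -> bounded_fun h.
Proof.
move=> bh; exists M; split; first exact: num_real.
by move=> N MN x _; exact: le_trans (bh x) (ltW MN).
Qed.

Lemma bounded_funE (R : realType) (T : Type) (h : T -> R) :
  bounded_fun h -> exists M, forall x, `|h x| <= M.
Proof. by move=> [M [_ hM]]; exists (M + 1) => x; apply: hM => //; rewrite ltrDl. Qed.

Lemma probability_setD_ge d (T : measurableType d) (R : realType)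
    (P : probability T R) (A B : set T) (a b : R) :
  measurable A -> measurable B ->
  (P (~` A) <= a%:E)%E -> (P B <= b%:E)%E -> ((1 - a - b)%:E <= P (A `\` B))%E.
Proof.
move=> mA mB PA PB; have mD := measurableD mA mB.
have PnD : (P (~` (A `\` B)) <= (a + b)%:E)%E.
  have PAB : (P (~` A `|` B) <= P (~` A) + P B)%E.
    by apply: measureU2 => //; exact: measurableC.
  rewrite setDE setCI setCK EFinD.
  by apply: (le_trans PAB); exact: leeD.
move: PnD; rewrite probability_setC//.
rewrite -(@fineK _ (P (A `\` B))) ?fin_num_measure// -EFinB !lee_fin; lra.
Qed.

Lemma integrable_realD d (T : measurableType d) (R : realType)
    (P : probability T R) (f g : T -> R) :
  P.-integrable setT (EFin \o f) -> P.-integrable setT (EFin \o g) ->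
  P.-integrable setT (EFin \o (fun x => f x + g x)).
Proof.
move=> intf intg.
by rewrite (_ : EFin \o _ = (EFin \o f) \+ (EFin \o g))%E//; exact: integrableD.
Qed.

Lemma integrable_realB d (T : measurableType d) (R : realType)
    (P : probability T R) (f g : T -> R) :
  P.-integrable setT (EFin \o f) -> P.-integrable setT (EFin \o g) ->
  P.-integrable setT (EFin \o (fun x => f x - g x)).
Proof.
move=> intf intg.
by rewrite (_ : EFin \o _ = (EFin \o f) \- (EFin \o g))%E//; exact: integrableB.
Qed.

(** * Uniqueness and tightness of Borel probability measures *)

Lemma mdist_dist_le (R : realType) (X : metricType R) (u x y : X) :
  `|mdist u x - mdist u y| <= mdist x y.
Proof.
have := metric_triangle u x y; have := metric_triangle u y x.
rewrite (metric_sym y x) ler_norml => ? ?; apply/andP; split; lra.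
Qed.

Lemma continuous_mdist (R : realType) (X : metricType R) (u : X) :
  continuous (mdist u : X -> R).
Proof.
move=> x; apply/cvgrPdist_lt => e e0.
have : nbhs x (ball x e) by exact: nbhsx_ballx.
apply: filterS => y; rewrite ballEmdist/=; exact: le_lt_trans (mdist_dist_le _ _ _).
Qed.

(** A continuous stand-in for the indicator of the complement of the ball of radius [r]: it is 0 up
    to distance [r / 2] from [u] and 1 from distance [r] on. *)
Definition cutoff (R : realType) (X : metricType R) (r : R) (u x : X) : R :=
  Num.min 1 (Num.max 0 (2 * mdist u x / r - 1)).

Section cutoff.
Context (R : realType) (X : metricType R) (r : R) (r0 : 0 < r).
Implicit Types u x : X.

Lemma cutoff_ge0 u x : 0 <= cutoff r u x.
Proof. by rewrite /cutoff le_min ler01 le_max lexx. Qed.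

Lemma cutoff_le1 u x : cutoff r u x <= 1.
Proof. by rewrite /cutoff ge_min lexx. Qed.

Lemma cutoff_eq1 u x : r <= mdist u x -> cutoff r u x = 1.
Proof.
move=> ru; apply/min_idPl; rewrite le_max; apply/orP; right.
rewrite lerBrDr ler_pdivlMr//; lra.
Qed.

Lemma cutoff_eq0 u x : mdist u x <= r / 2 -> cutoff r u x = 0.
Proof.
move=> ur; rewrite /cutoff (max_idPl _); first by apply/min_idPr.
rewrite subr_le0 ler_pdivrMr//; lra.
Qed.

Lemma continuous_cutoff u : continuous (cutoff r u : X -> R).
Proof.
move=> x; apply: (@continuous_min R X (cst 1) (fun x => Num.max 0 (2 * mdist u x / r - 1)) x).
  exact: cvg_cst.
apply: (@continuous_max R X (cst 0) (fun x => 2 * mdist u x / r - 1) x).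
  exact: cvg_cst.
apply: cvgB; last exact: cvg_cst.
apply: cvgM; last exact: cvg_cst.
apply: cvgM; [exact: cvg_cst|exact: continuous_mdist].
Qed.

End cutoff.

Definition dist_set (R : realType) (X : metricType R) (A : set X) (x : X) : R :=
  inf [set mdist x y | y in A].

Section dist_set.
Context (R : realType) (X : metricType R) (A : set X) (A0 : A !=set0).
Implicit Types x y : X.

Let lbA x : lbound [set mdist x y | y in A] 0.
Proof. by move=> _ [y _ <-]; exact: mdist_ge0. Qed.

Let infA x : has_inf [set mdist x y | y in A].
Proof. by split; [case: A0 => y Ay; exists (mdist x y); exists y|exists 0]. Qed.

Lemma dist_set_ge0 x : 0 <= dist_set A x.
Proof. by apply: lb_le_inf => //; case: (infA x). Qed.

Lemma dist_set_le x y : A y -> dist_set A x <= mdist x y.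
Proof. by move=> Ay; apply: ge_inf; [exists 0|exists y]. Qed.

Lemma dist_set_triangle x y : dist_set A x <= mdist x y + dist_set A y.
Proof.
rewrite -lerBlDl; apply: lb_le_inf; first by case: (infA y).
move=> _ [z Az <-]; rewrite lerBlDl.
exact: le_trans (dist_set_le x Az) (metric_triangle _ _ _).
Qed.

Lemma continuous_dist_set : continuous (dist_set A : X -> R).
Proof.
move=> x; apply/cvgrPdist_lt => e e0.
have : nbhs x (ball x e) by exact: nbhsx_ballx.
apply: filterS => y; rewrite ballEmdist/=; apply: le_lt_trans.
have := dist_set_triangle x y; have := dist_set_triangle y x.
rewrite (metric_sym y x) ler_norml => ? ?; apply/andP; split; lra.
Qed.

Lemma dist_set_gt0 x : closed A -> ~ A x -> 0 < dist_set A x.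
Proof.
move=> cA Ax; have : nbhs x (~` A).
  by apply: open_nbhs_nbhs; split => //; exact: closed_openC.
move=> /nbhs_ballP[e /= e0 xe]; apply: (lt_le_trans e0).
apply: lb_le_inf; first by case: (infA x).
move=> _ [y Ay <-]; rewrite leNgt; apply/negP => xy.
by apply: (xe y) => //; rewrite ballEmdist.
Qed.

Lemma dist_set_eq0 x : A x -> dist_set A x = 0.
Proof.
by move=> /(dist_set_le x); rewrite mdistxx => ?; apply/le_anti/andP; split => //; exact: dist_set_ge0.
Qed.

End dist_set.

(** The continuous functions [min 1 (n * dist)], with the distance to the complement, increase to
    the indicator of an open set. Their integrals thus determine the measure on open sets, a family
    stable under intersection that generates the Borel sets. *)
Lemma probability_borel_unique (R : realType) (X : polishType R)
    (P Q : probability (borel X) R) :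
  (forall h : X -> R, continuous h -> (forall x, 0 <= h x <= 1) ->
     \int[P]_x h x = \int[Q]_x h x) ->
  forall A, measurable A -> P A = Q A.
Proof.
move=> PQ.
have PQo (U : set X) : open U -> P U = Q U.
  move=> oU.
  (* The whole space is treated apart: the distance to an empty complement would be an infimum over
     the empty set. *)
  have [U0|/set0P U0] := eqVneq (~` U) set0.
    by have -> : U = setT by [rewrite -[U]setCK U0 setC0]; rewrite !probability_setT.
  pose h n (x : borel X) : R := Num.min 1 (n%:R * dist_set (~` U) x).
  have ch n : continuous (h n : X -> R).
    move=> x; apply: (@continuous_min R X (cst 1) (fun x => n%:R * dist_set (~` U) x) x).
      exact: cvg_cst.
    by apply: cvgM; [exact: cvg_cst|exact: continuous_dist_set].
  have h01 n x : 0 <= h n x <= 1.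
    by rewrite ge_min lexx andbT le_min ler01 mulr_ge0// dist_set_ge0.
  have bh n x : `|h n x| <= 1 by rewrite ger0_norm; case/andP: (h01 n x).
  have mh n : measurable_fun setT (h n) by exact: continuous_measurable_borel.
  have mU : measurable (U : set (borel X)) by exact: open_measurable_borel.
  have m1 : measurable_fun setT (\1_U : borel X -> R) by exact: measurable_indic.
  have cvh x : h n x @[n --> \oo] --> (\1_U x : R).
    rewrite indicE; case: (boolP (x \in U)) => [|/negP]; rewrite inE => Ux.
      have d0 : 0 < dist_set (~` U) x.
        by apply: dist_set_gt0 => //; exact: open_closedC.
      apply: cvg_near_cst; near=> n; apply/min_idPl.
      rewrite -ler_pdivrMr//; near: n; exact: nbhs_infty_ger.
    apply: cvg_near_cst; near=> n.
    by rewrite /h dist_set_eq0// mulr0; apply/min_idPr.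
  have cvg_int (P' : probability (borel X) R) :
      \int[P']_x h n x @[n --> \oo] --> fine (P' U).
    have := bounded_cvg_Rintegral mh m1 bh (aeW P' cvh).
    by rewrite {2}/Rintegral integral_indic// setIT.
  have : fine (P U) = fine (Q U).
    apply: (cvg_unique _ (cvg_int P)) => //.
    have -> : (fun n => \int[P]_x h n x) = (fun n => \int[Q]_x h n x).
      by apply/funext => n; exact: PQ.
    exact: cvg_int.
  by move=> PQU; rewrite -[LHS]fineK ?fin_num_measure// PQU fineK// fin_num_measure.
apply: (measure_unique open (fun=> setT)) => //.
- by move=> U V; exact: openI.
- by move=> k; exact: openT.
- by rewrite bigcup_const//; exists 0%N.
- by move=> k; rewrite (le_lt_trans (probability_le1 _ _))// ltry.
Unshelve. all: by end_near. Qed.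

Lemma polish_dense_seq (R : realType) (X : polishType R) :
  exists u : nat -> X, forall x e, 0 < e -> exists i, mdist (u i) x < e.
Proof.
have [D /countable_injP[k k_inj] dD] := @separable R X.
(* [u] inverts the injection [k]. Indices outside its range get the default point, which is harmless
   as only density is asked of [u]. *)
pose u n : X := xget point [set y | D y /\ k y = n].
exists u => x e e0.
have [] := dD (ball x e)°.
- by exists x; exact: nbhsx_ballx.
- exact: open_interior.
move=> y [/interior_subset xy Dy]; exists (k y).
have [Duy kuy] : [set z | D z /\ k z = k y] (u (k y)) by apply: xgetPex; exists y.
have -> : u (k y) = y by apply: k_inj => //; rewrite inE.
by rewrite metric_sym; rewrite ballEmdist in xy.
Qed.

Lemma open_mball (R : realType) (X : metricType R) (u : X) (r : R) :
  open (ball u r).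
Proof.
rewrite openE => x; rewrite ballEmdist/= => ux.
apply/nbhs_ballP; exists (r - mdist u x) => /=; first by rewrite subr_gt0.
move=> y; rewrite !ballEmdist/= => xy.
have := metric_triangle u x y; lra.
Qed.

(* Products of cutoffs, one for each of the first [j] balls, are continuous and
   decrease to 0, so weak convergence alone gives the uniform bound. *)
Lemma fin_ball_tight (R : realType) (X : polishType R)
    (u : nat -> X) (u_dense : forall x e, 0 < e -> exists i, mdist (u i) x < e)
    (mu_ : nat -> probability (borel X) R) (mu : probability (borel X) R)
    (mu_cvg : weak_cvg mu_ mu) (r e : R) : 0 < r -> 0 < e ->
  exists j, let U := \bigcup_(i < j) ball (u i) r in
    (forall n, mu_ n (~` U : set (borel X)) <= e%:E)%E /\
    (mu (~` U : set (borel X)) <= e%:E)%E.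
Proof.
move=> r0 e0.
pose p j (x : borel X) : R := \prod_(i < j) cutoff r (u i) x.
have p0 j x : 0 <= p j x by apply: prodr_ge0 => i _; exact: cutoff_ge0.
have p1 j x : p j x <= 1.
  elim: j x => [|j IH] x; first by rewrite /p big_ord0.
  by rewrite /p big_ord_recr/= mulr_ile1 ?cutoff_ge0 ?cutoff_le1//; [exact: p0|exact: IH].
have pn j x : `|p j x| <= 1 by rewrite ger0_norm.
have cp j : continuous (p j : X -> R).
  elim: j => [|j IH] x.
    under [p 0%N]eq_fun do rewrite /p big_ord0; exact: cvg_cst.
  rewrite (_ : p j.+1 = fun x => p j x * cutoff r (u j) x).
    by apply: cvgM; [exact: IH|exact: continuous_cutoff].
  by apply/funext => y; rewrite /p big_ord_recr.
have mp j : measurable_fun setT (p j) by exact: continuous_measurable_borel.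
have cvp x : p j x @[j --> \oo] --> (0 : R).
  (* A dense point within [r / 2] of [x] makes one factor vanish, so the products at [x] are
     eventually 0. *)
  have [i ui] := u_dense x (r / 2) (divr_gt0 r0 (ltr0Sn R 1)).
  apply: cvg_near_cst; exists i.+1 => // j /= ij.
  by rewrite /p (bigD1 (Ordinal ij))//= cutoff_eq0 ?mul0r// ltW.
have cvgp (P : probability (borel X) R) : \forall j \near \oo, \int[P]_x p j x < e.
  have := bounded_cvg_Rintegral mp (measurable_cst (0 : R)) pn (aeW P cvp).
  rewrite Rintegral_cst_probability => /cvgrPdist_lt/(_ e e0).
  apply: filterS => j; rewrite sub0r normrN ger0_norm//.
  by apply: Rintegral_ge0.
have pU (P : probability (borel X) R) j : \int[P]_x p j x < e ->
    (P (~` (\bigcup_(i < j) ball (u i) r) : set (borel X)) <= e%:E)%E.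
  move=> pe; set U := ~` _.
  have mU : measurable (U : set (borel X)).
    apply: measurableC; apply: open_measurable_borel; apply: bigcup_open => i _.
    exact: open_mball.
  rewrite -(@fineK _ (P U)) ?fin_num_measure// lee_fin.
  apply: le_trans (ltW pe).
  have -> : fine (P U) = \int[P]_x \1_U x by rewrite /Rintegral integral_indic// setIT.
  apply: le_Rintegral => //.
  - apply: (@bounded_integrable _ _ _ _ _ 1); first exact: measurable_indic.
    by move=> x; rewrite indicE; case: (x \in U); rewrite ?normr1 ?normr0.
  - exact: (bounded_integrable P (mp j) (pn j)).
  - move=> x _; rewrite indicE; case: (boolP (x \in U)) => //; rewrite inE => Ux.
    rewrite /p big1// => i _; apply: cutoff_eq1 => //.
    rewrite leNgt; apply/negP => uix; apply: Ux; exists i => //=.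
    by rewrite ballEmdist.
have pdecr j k x : (j <= k)%N -> p k x <= p j x.
  elim: k => [|k IH]; first by rewrite leqn0 => /eqP ->.
  rewrite leq_eqVlt => /predU1P[->//|]; rewrite ltnS => /IH; apply: le_trans.
  by rewrite /p big_ord_recr/= ler_piMr ?cutoff_le1//; exact: p0.
(* [j0] serves [mu] and, by weak convergence tested on [p j0], all [mu_ n] from some [N] on; [j1]
   serves the finitely many measures before [N]. Monotonicity in [j] allows the maximum of both. *)
have [j0 _ /(_ j0 (leqnn j0))/= muj0] := cvgp mu.
have bp := bounded_fun_le (pn j0).
have e1 : 0 < e - \int[mu]_x p j0 x by rewrite subr_gt0.
have /cvgrPdist_lt/(_ _ e1)[N _ muN] := mu_cvg (p j0) (cp j0) bp.
have [j1 _ mu_j1] : \forall j \near \oo, forall n, (n < N)%N ->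
    \int[mu_ n]_x p j x < e.
  elim: N {muN} => [|N IH]; first exact: nearW.
  have := cvgp (mu_ N); apply: filterS2 IH => j IH Nj n.
  by rewrite ltnS leq_eqVlt => /predU1P[->//|]; exact: IH.
exists (maxn j0 j1); split=> [n|].
  apply: pU; have [nN|Nn] := ltnP n N; first by apply: mu_j1 => //=; exact: leq_maxr.
  apply: (@le_lt_trans _ _ (\int[mu_ n]_x p j0 x)).
    apply: le_Rintegral => //; [exact: bounded_integrable (mp _) (pn _)..|].
    by move=> x _; apply: pdecr; exact: leq_maxl.
  have := muN n Nn; rewrite ltr_norml => /andP[+ _].
  rewrite /=; lra.
apply: pU; apply: le_lt_trans muj0.
apply: le_Rintegral => //; [exact: bounded_integrable (mp _) (pn _)..|].
by move=> x _; apply: pdecr; exact: leq_maxl.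
Qed.

(** An ultrafilter containing a finite union of balls contains one of the balls. Hence an
    ultrafilter on [K] is Cauchy, completeness provides its limit, and closedness keeps the limit in
    [K]. *)
Lemma totally_bounded_closed_compact (R : realType) (X : polishType R)
    (u : nat -> X) (K : set X) : closed K ->
  (forall e, 0 < e -> exists j, K `<=` \bigcup_(i < j) ball (u i) e) ->
  compact K.
Proof.
move=> cK tbK; rewrite compact_ultra => F FU FK.
have cF : cauchy F.
  apply: cauchy_exP => e e0; have [j Kj] := tbK e e0.
  apply: contrapT => nex.
  suff : F (~` (\bigcup_(i < j) ball (u i) e)).
    move=> FC; have : F set0 by apply: filterS (filterI FK FC) => x [/Kj].
    exact: filter_not_empty.
  elim: j {Kj} => [|j IH].
    by rewrite bigcup_mkord big_ord0 setC0; exact: filterT.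
  rewrite bigcup_mkord big_ord_recr/= setCU -(bigcup_mkord j (fun i => ball (u i) e)); apply: filterI => //.
  by have [Fj|//] := @in_ultra_setVsetC _ F (ball (u j) e) FU; exfalso; apply: nex; exists (u j).
have /cauchy_cvg Fp := cF.
exists (lim F); split => //.
apply: contrapT => nK.
have /Fp FC : nbhs (lim F) (~` K).
  by apply: open_nbhs_nbhs; split => //; exact: closed_openC.
have : F set0 by apply: filterS (filterI FK FC) => x [].
exact: filter_not_empty.
Qed.

(** Ulam's construction: [K] is the intersection over [m] of closures of finite unions of balls of
    radius [1 / (m + 1)], where the union of index [m] may miss the mass [e / 2 ^ (m + 1)]; these
    allowances add up to [e]. The single set [K] serves the whole sequence and its limit. *)
Lemma weak_cvg_tight (R : realType) (X : polishType R)
    (mu_ : nat -> probability (borel X) R) (mu : probability (borel X) R)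
    (mu_cvg : weak_cvg mu_ mu) (e : R) : 0 < e ->
  exists K : set X, [/\ compact K,
    (forall n, mu_ n (~` K : set (borel X)) <= e%:E)%E &
    (mu (~` K : set (borel X)) <= e%:E)%E].
Proof.
move=> e0.
have [u u_dense] := @polish_dense_seq R X.
pose r m : R := m.+1%:R^-1.
have r0 m : 0 < r m by rewrite invr_gt0.
have em0 m : 0 < e / (2 ^ m.+1)%:R :> R by rewrite divr_gt0// ltr0n expn_gt0.
have [j jP] := choice (fun m => fin_ball_tight u_dense mu_cvg (r0 m) (em0 m)).
pose U m : set X := \bigcup_(i < j m) ball (u i) (r m).
have oU m : open (U m) by apply: bigcup_open => i _; exact: open_mball.
pose K := \bigcap_m closure (U m).
have cK : closed K by apply: closed_bigI => m _; exact: closed_closure.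
have KP (P : probability (borel X) R) :
    (forall m, (P (~` U m : set (borel X)) <= (e / (2 ^ m.+1)%:R)%:E)%E) ->
    (P (~` K : set (borel X)) <= e%:E)%E.
  move=> PU; rewrite setC_bigcap.
  apply: (le_trans _ (epsilon_trick0 xpredT (ltW e0))).
  apply: (@le_trans _ _ (\sum_(m <oo) P (~` closure (U m) : set (borel X)))%E).
    apply: measure_sigma_subadditive => //.
    - move=> m; apply: open_measurable_borel; apply: closed_openC; exact: closed_closure.
    - apply: open_measurable_borel; apply: bigcup_open => m _; apply: closed_openC; exact: closed_closure.
  apply: lee_nneseries => [//|m _].
  apply: le_trans (PU m).
  apply: le_measure; rewrite ?inE.
  - apply: open_measurable_borel; apply: closed_openC; exact: closed_closure.
  - by apply: measurableC; exact: open_measurable_borel.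
  - by apply: subsetC; exact: subset_closure.
exists K; split; last 2 first.
- by move=> n; apply: KP => m; have [] := jP m.
- by apply: KP => m; have [] := jP m.
apply: (totally_bounded_closed_compact (u := u)) => // d d0.
have [m] := @ltr_add_invr R 0 (d / 2) (divr_gt0 d0 (ltr0Sn R 1)).
rewrite add0r -/(r m) => md; exists (j m) => x /(_ m I).
have xr : nbhs x (ball x (r m)) by exact: nbhsx_ballx.
move=> /(_ _ xr)[y [[i /= ij uy] xy]]; exists i => //.
rewrite [d]splitr; apply: (@ball_triangle _ _ y).
  exact: le_ball (ltW md) _ uy.
exact: ball_sym (le_ball (ltW md) xy).
Qed.

(** * Extraction of subsequences *)

Lemma increasing_seq_ge (f : nat -> nat) n : increasing_seq f -> (n <= f n)%N.
Proof.
move=> /increasing_seqP f_incr; elim: n => // n IH.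
by apply: (leq_ltn_trans IH); exact: f_incr.
Qed.

Lemma increasing_seq_lt (f : nat -> nat) m n : increasing_seq f ->
  (m < n)%N -> (f m < f n)%N.
Proof. by move=> f_incr mn; rewrite ltnNge; have := f_incr n m; rewrite !leEnat => ->; rewrite -ltnNge. Qed.

Lemma increasing_seq_comp (f g : nat -> nat) :
  increasing_seq f -> increasing_seq g -> increasing_seq (f \o g).
Proof. by move=> fi gi m n; rewrite /= fi -leEnat gi. Qed.

Lemma increasing_seq_cvg (f : nat -> nat) : increasing_seq f -> f n @[n --> \oo] --> \oo.
Proof.
move=> fi A [N _ NA]; exists N => // n /= Nn; apply: NA => /=.
exact: leq_trans Nn (increasing_seq_ge n fi).
Qed.

Lemma diagonal_extraction_nat (R : realType) (a : nat -> nat -> R) :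
  (forall i, exists M, forall n, `|a i n| <= M) ->
  exists phi, increasing_seq phi /\ forall i, cvgn (a i \o phi).
Proof.
move=> bnd.
have ex i (phi : nat -> nat) : exists psi, increasing_seq psi /\
    cvgn (a i \o phi \o psi).
  have [M aM] := bnd i.
  have [|psi psi_incr cv] := @bolzano_weierstrass R (a i \o phi).
    by apply: (@bounded_fun_le _ _ _ M) => n /=; exact: aM.
  by exists psi.
have [psi psiP] := choice (fun p : nat * (nat -> nat) => ex p.1 p.2).
pose phi := fix phi i := if i is j.+1 then phi j \o psi (j, phi j) else id.
have psi_incr j f : increasing_seq (psi (j, f)) by have [] := psiP (j, f).
have phi_incr i : increasing_seq (phi i).
  by elim: i => [//|i IH]; apply: increasing_seq_comp.
(* Each later subsequence factors through [phi i], so from some index on the diagonal is a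
   subsequence of every [phi i]. *)
have phiD i k : exists tau, increasing_seq tau /\ phi (k + i)%N = phi i \o tau.
  elim: k => [|k [tau [tau_incr IH]]]; first by exists id.
  exists (tau \o psi ((k + i)%N, phi (k + i)%N)); split.
    exact: increasing_seq_comp tau_incr (psi_incr _ _).
  by rewrite addSn /= {1}IH.
(* Row [i] converges along [phi i.+1], not yet along [phi i]; the shift lets the diagonal follow row
   [i] from [l = i] on. *)
exists (fun l => phi l.+1 l); split.
  apply/increasing_seqP => l; rewrite ltEnat/=.
  apply: (@increasing_seq_lt (phi l.+1) l (psi (l.+1, phi l.+1) l.+1)) => //.
  exact: increasing_seq_ge (psi_incr _ _).
move=> i.
have [_] := psiP (i, phi i); rewrite -/((a i \o phi i) \o psi (i, phi i)) => cvi.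
apply/cvg_ex; exists (limn (a i \o phi i.+1)).
apply/cvgrPdist_lt => e e0.
have /cvgrPdist_lt/(_ e e0)[N _ NP] : a i \o phi i.+1 @ \oo --> limn (a i \o phi i.+1) by [].
exists (maxn N i) => // l /=; rewrite geq_max => /andP[Nl il].
have [tau [tau_incr tauE]] := phiD i.+1 (l - i)%N.
have phiE : phi l.+1 l = phi i.+1 (tau l).
  by move: tauE; rewrite addnS subnK// => ->.
rewrite -[X in _ - X]/(a i (phi l.+1 l)) phiE.
apply: (NP (tau l)) => /=; exact: leq_trans Nl (increasing_seq_ge l tau_incr).
Qed.

Lemma diagonal_extraction (R : realType) (I : countType) (a : I -> nat -> R) :
  (forall i, exists M, forall n, `|a i n| <= M) ->
  exists phi, increasing_seq phi /\ forall i, cvgn (a i \o phi).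
Proof.
move=> bnd.
have [j|phi [phi_incr phiP]] := @diagonal_extraction_nat R
    (fun j => if unpickle j is Some i then a i else fun=> 0).
  by case: unpickle => [i|]; [exact: bnd|exists 0 => n; rewrite normr0].
by exists phi; split => // i; have := phiP (pickle i); rewrite pickleK.
Qed.

Definition equicontinuous_seq (R : realType) (X : topologicalType)
    (F : nat -> X -> R) : Prop :=
  forall x e, 0 < e -> \forall y \near x, forall n, `|F n y - F n x| <= e.

Section equicontinuous_seq.
Context (R : realType) (X : topologicalType) (F : nat -> X -> R).
Hypothesis F_eq : equicontinuous_seq F.

Lemma equicontinuous_seq_continuous n : continuous (F n).
Proof.
move=> x; apply/cvgrPdist_le => e e0.
by apply: filterS (F_eq x e0) => y /(_ n); rewrite distrC.
Qed.

Lemma equicontinuous_cvg_dense (D : set X) :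
  (forall (x : X) V, nbhs x V -> exists2 y, D y & V y) ->
  (forall y, D y -> cvgn (F^~ y)) -> forall x, cvgn (F^~ x).
Proof.
move=> dD cD x; apply: cauchy_cvg; apply: cauchy_exP => e e0.
have e3 : 0 < e / 3 by rewrite divr_gt0.
have [y Dy Fyx] := dD _ _ (F_eq x e3).
have /cvgrPdist_lt/(_ _ e3) H := cD y Dy.
exists (limn (F^~ y)); apply: filterS H => n /= Hn.
rewrite /ball/=; have := Fyx n; move: Hn.
rewrite !ltr_norml ler_norml => /andP[? ?] /andP[? ?]; apply/andP; split; lra.
Qed.

Lemma equicontinuous_lim (G : X -> R) : (forall x, F n x @[n --> \oo] --> G x) ->
  forall x e, 0 < e -> \forall y \near x, `|G y - G x| <= e.
Proof.
move=> FG x e e0; apply: filterS (F_eq x e0) => y yx.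
have : `|F n y - F n x| @[n --> \oo] --> `|G y - G x|.
  by apply: cvg_norm; apply: cvgB.
by move=> /cvgr_to_le; apply; apply: nearW.
Qed.

Lemma equicontinuous_lim_continuous (G : X -> R) :
  (forall x, F n x @[n --> \oo] --> G x) -> continuous G.
Proof.
move=> FG x; apply/cvgrPdist_le => e e0.
by apply: filterS (equicontinuous_lim FG x e0) => y; rewrite distrC.
Qed.

Lemma equicontinuous_cvg_compact (G : X -> R) (K : set X) : compact K ->
  (forall x, F n x @[n --> \oo] --> G x) ->
  forall e, 0 < e -> \forall n \near \oo, forall x, K x -> `|F n x - G x| <= e.
Proof.
move=> /compact_near_coveringP cK FG e e0.
have e3 : 0 < e / 3 by rewrite divr_gt0.
apply: (cK _ _ (fun n x => `|F n x - G x| <= e)) => x Kx.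
have nx := F_eq x e3; have gx := equicontinuous_lim FG x e3.
have /cvgrPdist_le/(_ _ e3) nn := FG x.
exists ([set y | (forall n, `|F n y - F n x| <= e / 3) /\ `|G y - G x| <= e / 3],
        [set n | `|G x - F n x| <= e / 3]) => /=.
  by split => //; apply: filterI.
move=> [y n] /= [[/(_ n) + +] +].
rewrite !ler_norml => /andP[? ?] /andP[? ?] /andP[? ?]; apply/andP; split; lra.
Qed.

End equicontinuous_seq.

(** The tube lemma. Its neighbourhood depends on [c] and [K] alone, which later gives all soft
    transforms over [K] one common modulus of continuity. *)
Lemma continuous_tube (R : realType) (X Y : topologicalType) (c : X * Y -> R)
    (K : set Y) (x : X) (e : R) : continuous c -> compact K -> 0 < e ->
  \forall x' \near x, forall y, K y -> `|c (x', y) - c (x, y)| <= e.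
Proof.
move=> cc /compact_near_coveringP cK e0.
apply: (cK _ _ (fun x' y => `|c (x', y) - c (x, y)| <= e)) => y Ky.
have e2 : 0 < e / 2 by rewrite divr_gt0.
have /cvgrPdist_le/(_ _ e2)[[P Q] /= [Px Qy] PQ] := cc (x, y).
exists (Q, P) => //= -[y' x'] /= [Qy' Px'].
have := PQ (x, y'); have := PQ (x', y') => /=.
move=> /(_ (conj Px' Qy')) + /(_ (conj (nbhs_singleton Px) Qy')).
rewrite !ler_norml => /andP[? ?] /andP[? ?]; apply/andP; split; lra.
Qed.

(** * Weak convergence of products *)

Lemma bounded_fubini d1 d2 (T1 : measurableType d1) (T2 : measurableType d2)
    (R : realType) (P : probability T1 R) (Q : probability T2 R)
    (h : T1 * T2 -> R) (M : R) :
  measurable_fun setT h -> (forall z, `|h z| <= M) ->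
  \int[(P \x Q)%E]_z h z = \int[P]_x \int[Q]_y h (x, y).
Proof.
move=> mh bh.
have ih : (P \x Q)%E.-integrable setT (EFin \o h).
  exact: (@bounded_integrable _ _ _ (P \x Q)%E _ M).
rewrite /Rintegral -[in LHS](integral12_prod_meas1 ih); congr fine.
apply: eq_integral => x _; rewrite /= fineK//.
apply: integrable_fin_num => //.
apply: (@bounded_integrable _ _ _ _ _ M) => //.
by apply: measurableT_comp => //; exact: measurable_pair1.
Qed.

Lemma continuous_pair1 (R : realType) (X Y : topologicalType) (h : X * Y -> R) (x : X) :
  continuous h -> continuous (fun y => h (x, y)).
Proof.
move=> ch y; apply: (@cvg_comp _ _ _ (fun y => (x, y)) h _ (nbhs (x, y))); last exact: ch.
by apply: cvg_pair => //; exact: cvg_cst.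
Qed.

(** The partial integrals over [nu_ n] are equicontinuous in [x], by the tube lemma on a compact set
    carrying most of every [nu_ n]. They therefore converge uniformly on compact sets, and tightness
    of [mu_] allows the outer measure to vary at the same time. *)
Lemma product_weak_cvg (R : realType) (X Y : polishType R)
    (mu_ : nat -> probability (borel X) R) (mu : probability (borel X) R)
    (nu_ : nat -> probability (borel Y) R) (nu : probability (borel Y) R) :
  weak_cvg mu_ mu -> weak_cvg nu_ nu ->
  weak_cvg (fun n => (mu_ n \x nu_ n)%E) (mu \x nu)%E.
Proof.
move=> mu_cvg nu_cvg h ch bh; have [M hM] := bounded_funE bh.
have mh := continuous_measurable_prod ch.
have M0 : 0 <= M := le_trans (normr_ge0 _) (hM point).
pose Hn n x := \int[nu_ n]_y h (x, y).
pose H x := \int[nu]_y h (x, y).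
have mhx x : measurable_fun setT (fun y => h (x, y)).
  by apply: measurableT_comp => //; exact: measurable_pair1.
have Hn_eq : equicontinuous_seq (Hn : nat -> X -> R).
  move=> x e e0.
  (* The mass outside [K] is weighted by [M + M]; the added 1 keeps the denominator positive when
     [M = 0]. *)
  have d0 : 0 < e / 2 / (M + M + 1) by rewrite !divr_gt0// ltr_wpDl// addr_ge0.
  have [K [cK nuK _]] := weak_cvg_tight nu_cvg d0.
  have e2 : 0 < e / 2 by rewrite divr_gt0.
  apply: filterS (@continuous_tube R X Y h K x _ ch cK e2) => x' tube n.
  have mK : measurable (~` K : set (borel Y)).
    apply: measurableC; apply: closed_measurable_borel.
    exact: compact_closed (@metric_hausdorff _ _) cK.
  apply: le_trans (Rintegral_dist_le (nu_ n) (mhx x') (mhx x) _ _ mK (ltW e2) _) _.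
  - by move=> y; exact: hM.
  - by move=> y; exact: hM.
  - by move=> y /contrapT Ky; exact: tube.
  have := nuK n; rewrite -(@fineK _ (nu_ n (~` K))) ?fin_num_measure// lee_fin.
  rewrite ler_pdivlMr ?ltr_wpDl ?addr_ge0// => nuKn.
  have : 0 <= fine (nu_ n (~` K)) by rewrite fine_ge0.
  lra.
have Hcvg x : Hn n x @[n --> \oo] --> H x.
  apply: nu_cvg; first exact: continuous_pair1.
  by apply: (@bounded_fun_le _ _ _ M) => y; exact: hM.
have cH := equicontinuous_lim_continuous Hn_eq Hcvg.
have bHn n x : `|Hn n x| <= M by exact: bounded_Rintegral_le.
have bH x : `|H x| <= M by exact: bounded_Rintegral_le.
have mHn n : measurable_fun setT (Hn n : borel X -> R).
  apply: continuous_measurable_borel; exact: equicontinuous_seq_continuous.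
have mH : measurable_fun setT (H : borel X -> R) by exact: continuous_measurable_borel.
rewrite (bounded_fubini _ _ mh hM) -/H.
under eq_fun do rewrite (bounded_fubini _ _ mh hM).
apply/cvgrPdist_lt => e e0.
have d0 : 0 < e / 3 / (M + M + 1) by rewrite !divr_gt0// ltr_wpDl// addr_ge0.
have e3 : 0 < e / 3 by rewrite divr_gt0.
have [K [cK muK _]] := weak_cvg_tight mu_cvg d0.
have mK : measurable (~` K : set (borel X)).
  apply: measurableC; apply: closed_measurable_borel.
  exact: compact_closed (@metric_hausdorff _ _) cK.
have /cvgrPdist_lt/(_ _ e3) := mu_cvg H cH (bounded_fun_le bH).
apply: filterS2 (equicontinuous_cvg_compact Hn_eq cK Hcvg e3) => n HnH HH.
have : `|\int[mu_ n]_x Hn n x - \int[mu_ n]_x H x| <=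
    e / 3 + (M + M) * fine (mu_ n (~` K : set (borel X))).
  apply: Rintegral_dist_le => //; first exact: ltW.
  by move=> x /contrapT Kx; exact: HnH.
have := muK n; rewrite -(@fineK _ (mu_ n (~` K))) ?fin_num_measure// lee_fin.
rewrite ler_pdivlMr ?ltr_wpDl ?addr_ge0// => muKn.
have : 0 <= fine (mu_ n (~` K)) by rewrite fine_ge0.
move: HH; rewrite -/(Hn n) ltr_norml ler_norml ltr_norml.
move=> /andP[? ?] ? /andP[? ?]; apply/andP; split; lra.
Qed.

(** * Convergence of functions along varying measures *)

(** Only [s] is confined to the segment. In use, [s] is a value of [f_ n], bounded by tightness, and
    [t] a value of its continuous approximant, about which nothing else is known. *)
Lemma uniformly_continuous_segment (R : realType) (k : R -> R) (a e : R) :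
  continuous k -> 0 < e -> exists2 d, 0 < d &
    forall s t, `|s| <= a -> `|s - t| <= d -> `|k s - k t| <= e.
Proof.
move=> ck e0; have e2 : 0 < e / 2 by rewrite divr_gt0.
have /compact_near_coveringP cK := @segment_compact R (- a) a.
have H : \forall d \near (0 : R)^'+, `[- a, a]%classic `<=`
    (fun s => forall t, `|s - t| <= d -> `|k s - k t| <= e).
  apply: (cK _ _ (fun d s => forall t, `|s - t| <= d -> `|k s - k t| <= e)) => s _.
  have /cvgrPdist_le/(_ _ e2) := ck s; move=> /nbhs_ballP[r /= r0 sr].
  have r2 : 0 < r / 2 by rewrite divr_gt0.
  exists (ball s (r / 2), [set d | d < r / 2]) => /=.
    by split; [exact: nbhsx_ballx|exact: nbhs_right_lt].
  move=> [s' d] /= [ss' dr] t s't.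
  have := sr s'; have := sr t; rewrite /ball/= in ss' *.
  move: ss' s't; rewrite ltr_norml ler_norml => /andP[? ?] /andP[? ?].
  move=> /(_ _)/= tr s'r.
  have {}tr : `|k s - k t| <= e / 2 by apply: tr; rewrite ltr_norml; apply/andP; split; lra.
  have {}s'r : `|k s - k s'| <= e / 2 by apply: s'r; rewrite ltr_norml; apply/andP; split; lra.
  move: tr s'r; rewrite !ler_norml => /andP[? ?] /andP[? ?]; apply/andP; split; lra.
have [d [d0 Pd]] := filter_ex (filterI (nbhs_right_gt (0 : R)) H).
by exists d => // s t sa st; apply: Pd => //=; rewrite in_itv/= -ler_norml.
Qed.

(** Topology and sigma-algebra of a [topMeasurableType] are unrelated in general. This is the
    compatibility used in the results on varying measures; it holds for Borel spaces and for their
    products. *)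
Definition continuous_measurable (R : realType) d (T : topMeasurableType d) : Prop :=
  forall h : T -> R, continuous h -> measurable_fun setT h.

Lemma prod_continuous_measurable (R : realType) (X Y : polishType R) :
  @continuous_measurable R _ (borel X * borel Y)%type.
Proof. by move=> h; exact: continuous_measurable_prod. Qed.

Lemma borel_continuous_measurable (R : realType) (X : polishType R) :
  @continuous_measurable R _ (borel X).
Proof. by move=> h; exact: continuous_measurable_borel. Qed.

Lemma measurable_sum_cost (R : realType) (X Y : polishType R) (c : X * Y -> R)
    (f : borel X -> R) (g : borel Y -> R) : continuous c ->
  measurable_fun setT f -> measurable_fun setT g ->
  measurable_fun setT (fun z : borel X * borel Y => f z.1 + g z.2 - c z).
Proof.
move=> c_cont mf mg; apply: measurable_funB; last exact: (@continuous_measurable_prod R X Y c).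
by apply: measurable_funD; [exact: (measurableT_comp mf measurable_fst)|
  exact: (measurableT_comp mg measurable_snd)].
Qed.

(* The [P_ n] may be mutually singular, so convergence of [f_ n] to [f] is
   expressed through continuous functions, which make sense for all of them. *)
Definition approx_cvg (R : realType) d (T : topMeasurableType d)
    (P_ : nat -> probability T R) (P : probability T R)
    (f_ : nat -> T -> R) (f : T -> R) : Prop :=
  exists F : nat -> T -> R, [/\ forall k, continuous (F k),
    {ae P, forall x, F k x @[k --> \oo] --> f x} &
    forall e : R, 0 < e -> \forall k \near \oo, \forall n \near \oo,
      (P_ n [set x | (e <= `|f_ n x - F k x|)%R] <= e%:E)%E].

(** Tightness of the laws of the [f_ n], each under its own measure [P_ n]. *)
Definition tight_seq (R : realType) d (T : measurableType d)
    (P_ : nat -> probability T R) (f_ : nat -> T -> R) : Prop :=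
  forall e : R, 0 < e -> exists a : R,
    forall n, (P_ n [set x | (a <= `|f_ n x|)%R] <= e%:E)%E.

Lemma measurable_ge_set (R : realType) d (T : measurableType d) (f : T -> R) (a : R) :
  measurable_fun setT f -> measurable [set x | a <= f x].
Proof.
move=> mf; rewrite -[X in measurable X]setTI.
have -> : [set x | a <= f x] = f @^-1` `[a, +oo[%classic.
  by apply/seteqP; split=> x /=; rewrite in_itv/= andbT.
by apply: mf.
Qed.

Lemma measurable_ge_norm (R : realType) d (T : measurableType d) (f : T -> R) (a : R) :
  measurable_fun setT f -> measurable [set x | a <= `|f x|].
Proof. by move=> mf; apply: measurable_ge_set; exact: measurableT_comp. Qed.

(** Where [f_ n] is bounded by [a] and close to the continuous [F j], uniform continuity of [k]
    replaces one by the other. Weak convergence then applies to [h * k (F j)], and dominated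
    convergence under [P] removes [j]. *)
Lemma approx_cvg_Rintegral (R : realType) d' (T : topMeasurableType d')
    (cm : @continuous_measurable R d' T)
    (P_ : nat -> probability T R) (P : probability T R)
    (f_ : nat -> T -> R) (f : T -> R) (h : T -> R) (k : R -> R) :
  weak_cvg P_ P -> (forall n, measurable_fun setT (f_ n)) ->
  measurable_fun setT f -> approx_cvg P_ P f_ f -> tight_seq P_ f_ ->
  continuous h -> bounded_fun h -> continuous k -> bounded_fun k ->
  \int[P_ n]_x (h x * k (f_ n x)) @[n --> \oo] --> \int[P]_x (h x * k (f x)).
Proof.
move=> P_cvg mf_ mf [F [cF Ff Fap]] f_tight ch bh ck bk.
have [M hM] := bounded_funE bh; have [N kN] := bounded_funE bk.
have M0 : 0 <= M := le_trans (normr_ge0 _) (hM point).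
have N0 : 0 <= N := le_trans (normr_ge0 _) (kN point).
have mk : measurable_fun setT k by exact: continuous_measurable_fun.
have mh := cm _ ch.
have mF j : measurable_fun setT (F j) by exact: cm.
have bhk g x : `|h x * k (g x)| <= M * N by rewrite normrM ler_pM.
have mhk g : measurable_fun setT g -> measurable_fun setT (fun x => h x * k (g x)).
  by move=> mg; apply: measurable_funM => //; exact: measurableT_comp.
apply/cvgrPdist_lt => e e0.
have e1 : 0 < e / 4 / (M + 1) by rewrite !divr_gt0// ltr_wpDl.
(* Two exceptional sets of this mass, each weighted by [2 * (M * N)], contribute less than [e / 4]
   in total. *)
have d1 : 0 < e / 4 / (4 * (M * N) + 1).
  by rewrite !divr_gt0// ltr_wpDl// mulr_ge0// mulr_ge0.
have [a aP] := f_tight _ d1.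
have [d d0 dP] := uniformly_continuous_segment a ck e1.
have dd : 0 < Num.min d (e / 4 / (4 * (M * N) + 1)) by rewrite lt_min d0.
have e4 : 0 < e / 4 by rewrite divr_gt0.
have cvk : \int[P]_x (h x * k (F j x)) @[j --> \oo] --> \int[P]_x (h x * k (f x)).
  apply: (@bounded_cvg_Rintegral _ _ _ _ _ _ (M * N)) => //.
  - by move=> j; exact: mhk.
  - exact: mhk.
  - by apply: filterS Ff => x Fx; apply: cvgM; [exact: cvg_cst|apply: continuous_cvg => //; exact: ck].
have /cvgrPdist_lt/(_ _ e4) near1 := cvk.
have [j [Hj1 Hj2]] := filter_ex (filterI near1 (Fap _ dd)).
have chk : continuous (fun x => h x * k (F j x)).
  by move=> x; apply: cvgM; [exact: ch|apply: (continuous_comp (cF j x)); exact: ck].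
have /cvgrPdist_lt/(_ _ e4) := P_cvg _ chk (bounded_fun_le (bhk (F j))).
apply: filterS2 Hj2 => n Hn Hcv.
pose A := [set x | a <= `|f_ n x|] `|` [set x | Num.min d (e / 4 / (4 * (M * N) + 1)) <= `|f_ n x - F j x|].
have mA1 : measurable [set x | a <= `|f_ n x|] by exact: measurable_ge_norm.
have mA2 : measurable [set x | Num.min d (e / 4 / (4 * (M * N) + 1)) <= `|f_ n x - F j x|].
  by apply: measurable_ge_norm; exact: measurable_funB.
have mA : measurable A by exact: measurableU.
have PA : fine (P_ n A) <= 2 * (e / 4 / (4 * (M * N) + 1)).
  rewrite -lee_fin fineK ?fin_num_measure//.
  rewrite (_ : 2 * _ = e / 4 / (4 * (M * N) + 1) + e / 4 / (4 * (M * N) + 1)) ?EFinD; last by rewrite [LHS]mulr_natl mulr2n.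
  apply: (le_trans (measureU2 (P_ n) mA1 mA2)).
  apply: leeD; first exact: aP.
  by apply: (le_trans Hn); rewrite lee_fin ge_min lexx orbT.
have : `|\int[P_ n]_x (h x * k (f_ n x)) - \int[P_ n]_x (h x * k (F j x))| <=
    e / 4 + (M * N + M * N) * fine (P_ n A).
  apply: Rintegral_dist_le => //; first exact: mhk.
  - exact: mhk.
  - exact: ltW.
  - move=> x /not_orP[/= /negP]; rewrite -ltNge => /ltW xa.
    move=> /negP; rewrite -ltNge lt_min => /andP[/ltW xd _].
    rewrite -mulrBr normrM; apply: (@le_trans _ _ (M * (e / 4 / (M + 1)))).
      by rewrite ler_pM// dP.
    rewrite mulrCA ler_piMr ?(ltW e4)// ler_pdivrMr ?ltr_wpDl// mul1r.
    by rewrite lerDl.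
have : (M * N + M * N) * fine (P_ n A) <= e / 4.
  apply: (@le_trans _ _ ((M * N + M * N) * (2 * (e / 4 / (4 * (M * N) + 1))))).
    by rewrite ler_wpM2l// addr_ge0// mulr_ge0.
  have -> : (M * N + M * N) * (2 * (e / 4 / (4 * (M * N) + 1))) = e / 4 * (4 * (M * N) / (4 * (M * N) + 1)) by ring.
  rewrite ler_piMr ?(ltW e4)// ler_pdivrMr ?ltr_wpDl ?mulr_ge0// mul1r.
  by rewrite lerDl.
move: Hj1 Hcv; rewrite !ltr_norml ler_norml => /andP[? ?] /andP[? ?] ? /andP[? ?].
apply/andP; split; lra.
Qed.

(** Terms of a convergent series are eventually below 1, where the minimum is the increment itself;
    so the sequence is Cauchy. Capping at 1 keeps the increments bounded, hence admissible for weak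
    convergence. *)
Lemma cvgn_summable_min1 (R : realType) (F : nat -> R) :
  (\sum_(k <oo) (Num.min 1 `|F k.+1 - F k|)%:E < +oo)%E -> cvgn F.
Proof.
move=> sF.
pose u k := Num.min 1 `|F k.+1 - F k|.
have u0 k : 0 <= u k by rewrite le_min ler01 normr_ge0.
have /cvg_cauchy/cauchy_seriesP cu := nnseries_is_cvg u0 sF.
apply: cauchy_cvg; apply: cauchy_exP => e e0.
(* The bound [e] is for the Cauchy criterion, the bound 1 for removing the cap. *)
have e1 : 0 < Num.min e 1 by rewrite lt_min e0 ltr01.
have [[A B] /= [[N1 _ AN] [N2 _ BN]] AB] := cu _ e1.
pose N := maxn N1 N2.
have tail m : (N <= m)%N -> \sum_(N <= k < m) u k < Num.min e 1.
  move=> Nm; have := AB (N, m); rewrite ger0_norm ?sumr_ge0//; apply.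
  split=> /=; [apply: AN => /=; exact: leq_maxl|apply: BN => /=].
  exact: leq_trans (leq_maxr _ _) Nm.
have bound m : (N <= m)%N -> `|F m - F N| <= \sum_(N <= k < m) u k.
  elim: m => [|m IH]; first by rewrite leqn0 => /eqP ->; rewrite subrr normr0 big_geq.
  rewrite leq_eqVlt => /predU1P[<-|]; first by rewrite subrr normr0 big_geq.
  rewrite ltnS => Nm; have := tail m.+1 (leqW Nm).
  rewrite big_nat_recr//= lt_min => /andP[_ u1].
  have um : u m = `|F m.+1 - F m|.
    rewrite /u; apply/min_idPr; rewrite leNgt; apply/negP => lt1.
    have : u m = 1 by apply/min_idPl; exact: ltW.
    have : 0 <= \sum_(N <= k < m) u k by rewrite sumr_ge0.
    by move=> + u11; rewrite u11 in u1; lra.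
  rewrite um (_ : F m.+1 - F N = (F m - F N) + (F m.+1 - F m)); last by ring.
  by apply: (le_trans (ler_normD _ _)); rewrite lerD2r; exact: IH.
exists (F N); exists N => // m /= Nm; rewrite /ball/= distrC.
apply: (le_lt_trans (bound m Nm)); apply: (lt_le_trans (tail m Nm)).
by rewrite ge_min lexx.
Qed.

(** The shifted exponent makes these numbers add up to 1 over all [k]. *)
Definition dyad (R : realType) (k : nat) : R := ((2 ^ k.+1)%:R)^-1.

Lemma dyad_gt0 (R : realType) k : 0 < dyad R k.
Proof. by rewrite /dyad invr_gt0 ltr0n expn_gt0. Qed.

Lemma dyadS (R : realType) k : dyad R k.+1 = dyad R k / 2.
Proof. by rewrite /dyad [in LHS]expnS natrM invfM mulrC. Qed.

Lemma dyad_near0 (R : realType) (e : R) : 0 < e -> \forall k \near \oo, dyad R k < e.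
Proof.
move=> e0; have : \forall k \near \oo, e^-1 < k%:R by exact: nbhs_infty_gtr.
apply: filterS => k ke; rewrite /dyad -[e]invrK ltf_pV2 ?posrE ?invr_gt0//.
  apply: (lt_le_trans ke); rewrite ler_nat ltnW//.
  exact: ltn_trans (ltnSn k) (ltn_expl _ _).
Qed.

(** Replacing the functions by 0 on a measurable null set that contains all points of divergence
    makes them converge everywhere, so that the limit is measurable. *)
Lemma ae_cvg_measurable (R : realType) d (T : measurableType d)
    (P : probability T R) (F : nat -> T -> R) :
  (forall k, measurable_fun setT (F k)) ->
  {ae P, forall x, cvgn (F^~ x)} ->
  exists f : {mfun T >-> R}, {ae P, forall x, F k x @[k --> \oo] --> f x}.
Proof.
move=> mF [N [mN PN NF]].
pose G k x := F k x * \1_(~` N) x.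
have cG x : cvgn (G^~ x).
  rewrite /G indicE; have [xN|/negP xN] := boolP (x \in ~` N).
    under eq_fun do rewrite mulr1.
    apply: contrapT => nx; have := NF x nx; by move: xN; rewrite inE.
  under eq_fun do rewrite mulr0.
  exact: is_cvg_cst.
have mG k : measurable_fun setT (G k).
  by apply: measurable_funM => //; apply: measurable_indic; exact: measurableC.
pose g x := limn (G^~ x).
have mg : measurable_fun setT g by apply: (measurable_fun_cvg mG) => x _; exact: cG.
pose f : {mfun T >-> R} := HB.pack g (isMeasurableFun.Build _ _ _ _ g mg).
exists f; exists N; split => // x /= nFx; apply: contrapT => Nx; apply: nFx.
have -> : (fun k => F k x) = G^~ x.
  by apply/funext => k; rewrite /G indicE mem_set ?mulr1.
exact: cG.
Qed.

(** [F k] and [F k.+1] are both close to [f_ n], hence to each other, in [mu_ n]-probability. This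
    comparison involves continuous functions only, so it passes to [mu], where the capped increments
    become summable; the limit [f] is created under [mu] although the [f_ n] are unrelated to
    [mu]. *)
Lemma approx_cvg_exists (R : realType) d (T : topMeasurableType d)
    (cm : @continuous_measurable R d T)
    (mu_ : nat -> probability T R) (mu : probability T R)
    (mu_cvg : weak_cvg mu_ mu) (f_ : nat -> T -> R) (F : nat -> T -> R) :
  (forall n, measurable_fun setT (f_ n)) -> (forall k, continuous (F k)) ->
  (forall k, \forall n \near \oo,
    (mu_ n [set x | (2 * dyad R k <= `|f_ n x - F k x|)%R] <= (2 * dyad R k)%:E)%E) ->
  exists f : {mfun T >-> R},
    {ae mu, forall x, F k x @[k --> \oo] --> f x} /\ approx_cvg mu_ mu f_ f.
Proof.
move=> mf cF Fap.
have mF k : measurable_fun setT (F k) by exact: cm.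
pose D k x := Num.min 1 `|F k.+1 x - F k x|.
have D0 k x : 0 <= D k x by rewrite le_min ler01 normr_ge0.
have D1 k x : `|D k x| <= 1 by rewrite ger0_norm// ge_min lexx.
have cD k : continuous (D k).
  move=> x; apply: (@continuous_min R T (cst 1) (fun x => `|F k.+1 x - F k x|) x).
    exact: cvg_cst.
  by apply: cvg_norm; apply: cvgB; exact: cF.
have mD k : measurable_fun setT (D k) by exact: cm.
(* The two errors add up to [2 * dyad R k + 2 * dyad R k.+1 = 3 * dyad R k], which also bounds the
   mass of the exceptional set; that set is weighted by [1 + 1], and [3 + 2 * 3 = 9]. *)
have ID k : \int[mu]_x D k x <= 9 * dyad R k.
  have := mu_cvg (D k) (cD k) (bounded_fun_le (D1 k)).
  move=> /cvgr_to_le; apply.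
  apply: filterS2 (Fap k) (Fap k.+1) => n.
  set A := [set x | _]; set B := [set x | _] => nA nB.
  have mA : measurable A by apply: measurable_ge_norm; exact: measurable_funB.
  have mB : measurable B by apply: measurable_ge_norm; exact: measurable_funB.
  have PAB : fine (mu_ n (A `|` B)) <= 3 * dyad R k.
    rewrite -lee_fin fineK ?fin_num_measure//; last exact: measurableU.
    rewrite (_ : 3 * dyad R k = 2 * dyad R k + 2 * dyad R k.+1); last by rewrite dyadS; field.
    by apply: (le_trans (measureU2 (mu_ n) mA mB)); rewrite EFinD leeD.
  have := @Rintegral_dist_le _ _ _ (mu_ n) (D k) (cst 0) 1 (3 * dyad R k) (A `|` B).
  rewrite Rintegral_cst_probability subr0 => H.
  apply: (le_trans (ler_norm _)); apply: (le_trans (H _ _ _ _ _ _ _)) => //.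
  - by move=> x; rewrite normr0.
  - exact: measurableU.
  - by rewrite mulr_ge0// ltW// dyad_gt0.
  - move=> x /not_orP[/negP + /negP]; rewrite -!ltNge dyadS => xA xB.
    rewrite subr0 ger0_norm// /D ge_min; apply/orP; right.
    move: xA xB; rewrite !ltr_norml ler_norml => /andP[? ?] /andP[? ?].
    by apply/andP; split; lra.
  - lra.
have sD : (\int[mu]_x (\sum_(k <oo) (D k x)%:E) < +oo)%E.
  rewrite integral_nneseries//; last 2 first.
  - by move=> k; apply/measurable_EFinP.
  - by move=> k x _; rewrite lee_fin.
  apply: (@le_lt_trans _ _ (\sum_(k <oo) (9 / (2 ^ k.+1)%:R)%:E)%E).
    apply: lee_nneseries => [k _ _|k _]; first by apply: integral_ge0 => x _; rewrite lee_fin.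
    have := ID k; rewrite -lee_fin; apply: le_trans.
    rewrite /Rintegral fineK//; apply: integrable_fin_num => //.
    exact: bounded_integrable (mD k) (D1 k).
  by apply: (le_lt_trans (epsilon_trick0 _ _)); rewrite ?ltry.
have aeD : {ae mu, forall x, cvgn (F^~ x)}.
  have sD_ge0 x : (0 <= \sum_(k <oo) (D k x)%:E)%E.
    by apply: nneseries_ge0 => k _ _; rewrite lee_fin.
  have iD : mu.-integrable setT (fun x => \sum_(k <oo) (D k x)%:E)%E.
    apply/integrableP; split.
      apply: ge0_emeasurable_sum => [k x _ _|k _]; first by rewrite lee_fin.
      exact/measurable_EFinP.
    by under eq_integral do rewrite gee0_abs//.
  have := integrable_ae measurableT iD.
  apply: filterS => x /(_ I); rewrite ge0_fin_numE// => xD.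
  exact: cvgn_summable_min1.
have [f Ff] := ae_cvg_measurable mF aeD.
exists f; split => //; exists F; split => // e e0.
have e2 : 0 < e / 2 by rewrite divr_gt0.
apply: filterS (dyad_near0 e2) => k ke.
have {}ke : 2 * dyad R k <= e by lra.
apply: filterS (Fap k) => n Hn.
apply: (@le_trans _ _ (2 * dyad R k)%:E); last by rewrite lee_fin.
apply: le_trans Hn; apply: le_measure; rewrite ?inE.
- by apply: measurable_ge_norm; exact: measurable_funB.
- by apply: measurable_ge_norm; exact: measurable_funB.
- by move=> x /=; exact: le_trans.
Qed.

(** * Soft transforms *)

Lemma compact_continuous_bounded (R : realType) (T : topologicalType)
    (h : T -> R) (K : set T) : continuous h -> compact K ->
  exists2 M, 0 <= M & forall x, K x -> `|h x| <= M.
Proof.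
move=> ch /compact_near_coveringP cK.
have : \forall M \near +oo, K `<=` (fun x => `|h x| <= M).
  apply: (cK _ _ (fun M x => `|h x| <= M)) => x _.
  have /cvgrPdist_le/(_ _ ltr01) hx := ch x.
  exists ([set y | `|h x - h y| <= 1], [set M | `|h x| + 1 <= M]) => /=.
    by split => //; exact: nbhs_pinfty_ge.
  move=> [y M] /= [yx Mx]; apply: le_trans Mx.
  rewrite -[h y](subKr (h x)); apply: (le_trans (ler_normB _ _)).
  by rewrite lerD2l.
move=> H; have [M [M0 KM]] := filter_ex (filterI (nbhs_pinfty_ge (num_real (0 : R))) H).
by exists M.
Qed.

Section soft_transform.
Context (R : realType) (X Y : polishType R) (c : X * Y -> R).
Hypotheses (c_ge0 : forall z, 0 <= c z) (c_cont : continuous c).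
Context (Q : probability (borel Y) R) (g : Y -> R) (K : set Y).
Hypotheses (mg : measurable_fun setT (g : borel Y -> R)) (cK : compact K).

(* Optimality makes the first potential [- ln \int exp (g - c)]; integrating over
   a compact [K] only keeps the modulus of continuity independent of [g]. *)
Definition kernel_integral (x : X) : \bar R :=
  \int[Q]_(y in (K : set (borel Y))) (expR (g y - c (x, y)))%:E.

(** [fine] and [ln] return default values when the kernel integral is infinite or 0; the estimates
    below assume [ki_fin], which excludes both. *)
Definition soft_transform (x : X) : R := - ln (fine (kernel_integral x)).

Lemma compact_measurable_borel : measurable (K : set (borel Y)).
Proof.
apply: closed_measurable_borel; exact: compact_closed (@metric_hausdorff _ _) cK.
Qed.

Let mK := compact_measurable_borel.

Let mc : measurable_fun setT (c : borel X * borel Y -> R).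
Proof. exact: (@continuous_measurable_prod R X Y c). Qed.

Let mgc x D : measurable_fun D ((fun y => (expR (g y - c (x, y)))%:E) : borel Y -> _).
Proof.
apply/measurable_funTS/measurable_EFinP; apply: measurableT_comp => //.
apply: measurable_funB => //; exact: (measurableT_comp mc (measurable_pair1 (x : borel X))).
Qed.

Let meg D : measurable_fun D ((fun y => (expR (g y))%:E) : borel Y -> _).
Proof. by apply/measurable_funTS/measurable_EFinP; exact: measurableT_comp. Qed.

Lemma kernel_integral_le x :
  (kernel_integral x <= \int[Q]_(y in (K : set (borel Y))) (expR (g y))%:E)%E.
Proof.
apply: ge0_le_integral => // y _.
by rewrite lee_fin ler_expR gerBl.
Qed.

Lemma kernel_integral_shift x x' e :
  (forall y, K y -> `|c (x', y) - c (x, y)| <= e) ->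
  (kernel_integral x' <= (expR e)%:E * kernel_integral x)%E.
Proof.
move=> xx'; rewrite /kernel_integral -ge0_integralZl//.
apply: ge0_le_integral => //.
- by apply: measurable_funeM; exact: mgc.
- move=> y Ky; rewrite -EFinM lee_fin -expRD ler_expR.
  have := xx' y Ky; rewrite ler_norml => /andP[? ?]; lra.
Qed.

(** The integrand is bounded below on the part of [K] where [g] is bounded; tightness makes this
    part large for all [n], which keeps the kernel integrals away from 0. *)
Lemma kernel_integral_ge x (b C : R) :
  (forall y, K y -> c (x, y) <= C) ->
  ((expR (- b - C))%:E * Q (K `\` [set y | (b <= `|g y|)%R]) <= kernel_integral x)%E.
Proof.
move=> xC.
have mA : measurable ([set y | b <= `|g y|] : set (borel Y)) by exact: measurable_ge_norm.
have mKA := measurableD mK mA.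
rewrite -integral_cst//.
apply: (@le_trans _ _ (\int[Q]_(y in (K `\` [set y | (b <= `|g y|)%R] : set (borel Y))) (expR (g y - c (x, y)))%:E)%E).
  apply: ge0_le_integral => // [y _|y [Ky /negP]]; first by rewrite /cst lee_fin.
  rewrite -ltNge ltr_norml => /andP[? _]; rewrite /cst lee_fin ler_expR.
  have := xC y Ky; lra.
by apply: ge0_subset_integral => //; exact: subDsetl.
Qed.

Section estimate.
Context (P : probability (borel X) R) (f : X -> R).
Hypothesis mf : measurable_fun setT (f : borel X -> R).

Let J (A : set (borel X)) : \bar R := \int[P]_(x in A)
  \int[Q]_(y in (K : set (borel Y))) (expR (f x + g y - c (x, y)))%:E.

Let JE A : J A = (\int[P]_(x in A) ((expR (f x))%:E * kernel_integral x))%E.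
Proof.
apply: eq_integral => x _; rewrite -ge0_integralZl//.
by apply: eq_integral => y _; rewrite -EFinM -expRD addrA.
Qed.

Let mki : measurable_fun setT (kernel_integral : borel X -> \bar R).
Proof.
(* Writing the restriction to [K] as a factor puts the integral in the form of Tonelli's theorem,
   which gives measurability in [x]. *)
have -> : kernel_integral = (fun x : borel X =>
    \int[Q]_y ((expR (g y - c (x, y)))%:E * (\1_K y)%:E))%E.
  apply/funext => x; rewrite /kernel_integral integral_mkcond.
  apply: eq_integral => y _; rewrite patchE indicE.
  by case: ifP; rewrite ?mule1 ?mule0.
apply: (@measurable_fun_fubini_tonelli_F _ _ (borel X) (borel Y) R Q
  (fun z => (expR (g z.2 - c z))%:E * (\1_K z.2)%:E)%E); last first.
  by move=> z; rewrite mule_ge0// lee_fin.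
apply: emeasurable_funM.
  apply/measurable_EFinP; apply: measurableT_comp => //.
  by apply: measurable_funB => //; exact: (measurableT_comp mg measurable_snd).
apply/measurable_EFinP.
have m1 : measurable_fun setT (\1_K : borel Y -> R) by exact: measurable_indic.
exact: (measurableT_comp m1 measurable_snd).
Qed.

(* Markov's inequality on a set where [f] and [c] are bounded. *)
Lemma integral_expR_le (X1 : set X) (a C : R) : compact X1 ->
  (forall x y, X1 x -> K y -> c (x, y) <= C) ->
  (P (~` X1 : set (borel X)) <= 4^-1%:E)%E ->
  (P [set x | (a <= `|f x|)%R] <= 4^-1%:E)%E ->
  (forall A, measurable A -> J A <= P A)%E ->
  (\int[Q]_(y in (K : set (borel Y))) (expR (g y))%:E <= (2 * expR (a + C))%:E)%E.
Proof.
move=> cX1 cC PX1 Pa JP; set I := (\int[Q]_(y in _) _)%E.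
have mX1 : measurable (X1 : set (borel X)).
  apply: closed_measurable_borel; exact: compact_closed (@metric_hausdorff _ _) cX1.
pose B : set (borel X) := [set x | a <= `|f x|].
have mB : measurable B by exact: measurable_ge_norm.
pose A : set (borel X) := X1 `\` B.
have mA : measurable A by exact: measurableD.
have I0 : (0 <= I)%E by apply: integral_ge0 => y _; rewrite lee_fin.
(* At most [1 / 4] is lost outside [X1] and [1 / 4] where [f] is large; the remaining half is the
   source of the factor 2 in the bound. *)
have PA : (2^-1%:E <= P A)%E.
  by apply: le_trans (probability_setD_ge mX1 mB PX1 Pa); rewrite lee_fin; lra.
have kiI x : X1 x -> ((expR (- C))%:E * I <= kernel_integral x)%E.
  move=> X1x; rewrite /I -ge0_integralZl//.
  apply: ge0_le_integral => //.
  - by apply: measurable_funeM; exact: meg.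
  - move=> y Ky; rewrite -EFinM lee_fin -expRD ler_expR.
    by have := cC x y X1x Ky; lra.
have JA : ((expR (- a - C))%:E * I * P A <= J A)%E.
  rewrite -integral_cst// JE.
  apply: ge0_le_integral => //.
  - by move=> x _; rewrite /cst mule_ge0// lee_fin.
  - apply: emeasurable_funM; last exact: measurable_funTS mki.
    by apply/measurable_funTS/measurable_EFinP; exact: measurableT_comp.
  - move=> x [X1x /negP]; rewrite -ltNge ltr_norml => /andP[fx _].
    rewrite expRD EFinM -muleA; apply: lee_pmul => //.
    + by rewrite mule_ge0// lee_fin.
    + by rewrite lee_fin ler_expR ltW.
    + exact: kiI.
have : ((expR (- a - C) / 2)%:E * I <= 1)%E.
  rewrite EFinM -muleA (muleC _ I) muleA.
  apply: (@le_trans _ _ ((expR (- a - C))%:E * I * P A)%E).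
    by apply: lee_wpmul2l => //; rewrite mule_ge0// lee_fin.
  by apply: (le_trans JA); apply: (le_trans (JP _ mA)); exact: probability_le1.
have k0 : 0 < expR (- a - C) / 2 by rewrite divr_gt0// expR_gt0.
rewrite -lee_pdivlMl// => /le_trans; apply; rewrite mule1 lee_fin.
by rewrite invfM invrK -expRN opprB opprK mulrC (addrC C).
Qed.

Section normalized.
Hypothesis ki_fin : forall x, (0 < kernel_integral x < +oo)%E.

Let kiE x : kernel_integral x = (expR (- soft_transform x))%:E.
Proof.
have /andP[k0 koo] := ki_fin x.
have kf : kernel_integral x \is a fin_num by rewrite ge0_fin_numE// ltW.
by rewrite /soft_transform opprK lnK ?fineK// posrE fine_gt0// k0.
Qed.

Lemma soft_transform_dist x x' e :
  (forall y, K y -> `|c (x', y) - c (x, y)| <= e) ->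
  `|soft_transform x' - soft_transform x| <= e.
Proof.
move=> xx'.
have half z z' : (forall y, K y -> `|c (z', y) - c (z, y)| <= e) ->
    soft_transform z - soft_transform z' <= e.
  move=> /kernel_integral_shift; rewrite (kiE z) (kiE z') -EFinM lee_fin.
  move: (soft_transform z) (soft_transform z') => u v.
  by rewrite -expRD ler_expR; lra.
rewrite ler_norml; apply/andP; split; last first.
  by apply: half => y Ky; rewrite distrC; exact: xx'.
by rewrite lerNl opprB; exact: half.
Qed.

Lemma continuous_soft_transform : continuous soft_transform.
Proof.
move=> x; apply/cvgrPdist_le => e e0.
apply: filterS (continuous_tube x c_cont cK e0) => x' xx'.
by rewrite distrC; exact: soft_transform_dist.
Qed.

(* With [s] the soft transform, [J A = \int_A exp (f - s) dP]; the mass bounds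
   rule out [f - s >= e] and make [f - s <= - e] unlikely. *)
Lemma soft_transform_approx e : 0 < e ->
  (forall A, measurable A -> J A <= P A)%E ->
  (forall A, measurable A -> P A <= J A + Q (~` K))%E ->
  (P [set x | (e <= `|f x - soft_transform x|)%R] <=
   (1 - expR (- e))^-1%:E * Q (~` K : set (borel Y)))%E.
Proof.
move=> e0 JleP PleJ.
have ms : measurable_fun setT (soft_transform : borel X -> R).
  exact: continuous_measurable_borel continuous_soft_transform.
have mfs : measurable_fun setT (fun x : borel X => f x - soft_transform x).
  exact: measurable_funB.
have JE' A : J A = (\int[P]_(x in A) (expR (f x - soft_transform x))%:E)%E.
  rewrite JE; apply: eq_integral => x _.
  by rewrite kiE -EFinM -expRD.
pose A : set (borel X) := [set x | e <= f x - soft_transform x].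
pose B : set (borel X) := [set x | f x - soft_transform x <= - e].
have mA : measurable A by exact: measurable_ge_set.
have mB : measurable B.
  rewrite -[B]setTI (_ : B = (fun x => f x - soft_transform x) @^-1` `]-oo, (- e)]%classic).
    exact: mfs.
  by apply/seteqP; split=> x /=; rewrite in_itv/=.
have me D : measurable_fun D ((fun x => (expR (f x - soft_transform x))%:E) : borel X -> _).
  by apply/measurable_funTS/measurable_EFinP; exact: measurableT_comp.
have PA0 : fine (P A) = 0.
  have : ((expR e)%:E * P A <= P A)%E.
    apply: le_trans (JleP _ mA); rewrite JE' -integral_cst//.
    apply: ge0_le_integral => //.
    - by move=> x _; rewrite /cst lee_fin.
    - by move=> x Ax; rewrite /cst lee_fin ler_expR.
  rewrite -(@fineK _ (P A)) ?fin_num_measure// -EFinM lee_fin.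
  have : 1 < expR e by rewrite expR_gt1.
  have : 0 <= fine (P A) by rewrite fine_ge0.
  by move=> *; nra.
(* On [B] the coupling puts over [K] at most the fraction [exp (- e)] of the mass of [B]; the rest
   must sit over the complement of [K]. *)
have PB : (1 - expR (- e)) * fine (P B) <= fine (Q (~` K : set (borel Y))).
  have : (P B <= (expR (- e))%:E * P B + Q (~` K : set (borel Y)))%E.
    apply: (le_trans (PleJ _ mB)); rewrite leeD2r// JE' -integral_cst//.
    by apply: ge0_le_integral => // x Bx; rewrite /cst lee_fin ler_expR.
  rewrite -(@fineK _ (P B)) ?fin_num_measure//.
  rewrite -(@fineK _ (Q (~` K : set (borel Y)))) ?fin_num_measure//; last exact: measurableC.
  by rewrite -EFinM -EFinD lee_fin; lra.
have e1 : 0 < 1 - expR (- e) by rewrite subr_gt0 expR_lt1 oppr_lt0.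
rewrite (_ : [set x | _] = A `|` B); last first.
  apply/seteqP; split=> x /=; rewrite ler_normr lerNr.
    by move=> /orP[]; [left|right].
  by move=> [|] H; apply/orP; [left|right].
have PAB : (P (A `|` B) <= P A + P B)%E by exact: measureU2.
apply: (le_trans PAB); rewrite -(@fineK _ (P A)) ?fin_num_measure// PA0 add0e.
rewrite -(@fineK _ (P B)) ?fin_num_measure//.
rewrite -(@fineK _ (Q (~` K : set (borel Y)))) ?fin_num_measure//; last exact: measurableC.
by rewrite -EFinM lee_fin ler_pdivlMl.
Qed.

End normalized.
End estimate.
End soft_transform.

(** [J_le] and [J_ge] express the marginal constraints on rectangles. Written as iterated integrals,
    without a coupling, they can also be supplied with the two spaces exchanged. *)
Lemma side_approximation (R : realType) (X Y : polishType R) (c : X * Y -> R)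
    (c_ge0 : forall z, 0 <= c z) (c_cont : continuous c)
    (mu_ : nat -> probability (borel X) R) (mu : probability (borel X) R)
    (nu_ : nat -> probability (borel Y) R) (nu : probability (borel Y) R)
    (mu_cvg : weak_cvg mu_ mu) (nu_cvg : weak_cvg nu_ nu)
    (f_ : nat -> X -> R) (g_ : nat -> Y -> R)
    (mf : forall n, measurable_fun setT (f_ n : borel X -> R))
    (mg : forall n, measurable_fun setT (g_ n : borel Y -> R))
    (f_tight : tight_seq mu_ f_) (g_tight : tight_seq nu_ g_)
    (J_le : forall n (A : set (borel X)) (K : set (borel Y)),
      measurable A -> measurable K ->
      (\int[mu_ n]_(x in A) \int[nu_ n]_(y in K)
         (expR (f_ n x + g_ n y - c (x, y)))%:E <= mu_ n A)%E)
    (J_ge : forall n (A : set (borel X)) (K : set (borel Y)),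
      measurable A -> measurable K ->
      (mu_ n A <= \int[mu_ n]_(x in A) \int[nu_ n]_(y in K)
         (expR (f_ n x + g_ n y - c (x, y)))%:E + nu_ n (~` K))%E)
    (e d : R) : 0 < e -> 0 < d ->
  exists F : nat -> X -> R, [/\ equicontinuous_seq F,
    forall x, exists M, forall n, `|F n x| <= M &
    forall n, (mu_ n [set x | (e <= `|f_ n x - F n x|)%R] <= d%:E)%E].
Proof.
move=> e0 d0.
have q0 : 0 < 4^-1 :> R by rewrite invr_gt0.
have e1 : 0 < 1 - expR (- e) by rewrite subr_gt0 expR_lt1 oppr_lt0.
(* The bound [4^-1] leaves enough mass in [K] to keep the kernel integral positive; the other
   cancels the factor [(1 - exp (- e))^-1] of [soft_transform_approx]. *)
have k0 : 0 < Num.min 4^-1 ((1 - expR (- e)) * d) by rewrite lt_min q0 mulr_gt0.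
have [K [cK nuK _]] := weak_cvg_tight nu_cvg k0.
have [X1 [cX1 muX1 _]] := weak_cvg_tight mu_cvg q0.
have [a aP] := f_tight _ q0; have [b bP] := g_tight _ q0.
have mK : measurable (K : set (borel Y)) by exact: compact_measurable_borel.
have [C _ cC] := compact_continuous_bounded c_cont (compact_setX cX1 cK).
have cCle x y : X1 x -> K y -> c (x, y) <= C.
  by move=> Xx Ky; apply: le_trans (ler_norm _) (cC (x, y) _).
have Cx x : exists Cx, forall y, K y -> c (x, y) <= Cx.
  have [M _ cM] := compact_continuous_bounded c_cont (compact_setX (@compact_set1 X x) cK).
  by exists M => y Ky; apply: le_trans (ler_norm _) (cM (x, y) _).
have [D DP] := choice Cx.
have ki_le n x : (kernel_integral c (nu_ n) (g_ n) K x <= (2 * expR (a + C))%:E)%E.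
  apply: (le_trans (kernel_integral_le c_ge0 c_cont (nu_ n) (mg n) cK x)).
  apply: (integral_expR_le c_cont (mg n) cK (mf n) cX1 cCle (muX1 n) (aP n)).
  by move=> A mA; exact: J_le.
have ki_ge n x : ((expR (- b - D x) / 2)%:E <= kernel_integral c (nu_ n) (g_ n) K x)%E.
  apply: le_trans (kernel_integral_ge c_cont (nu_ n) (mg n) cK b (DP x)).
  rewrite EFinM; apply: lee_wpmul2l; first by rewrite lee_fin.
  have nuK4 : (nu_ n (~` K : set (borel Y)) <= 4^-1%:E)%E.
    by apply: (le_trans (nuK n)); rewrite lee_fin ge_min lexx.
  have mB : measurable ([set y | b <= `|g_ n y|] : set (borel Y)).
    exact: measurable_ge_norm.
  by apply: le_trans (probability_setD_ge mK mB nuK4 (bP n)); rewrite lee_fin; lra.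
have ki_fin n x : (0 < kernel_integral c (nu_ n) (g_ n) K x < +oo)%E.
  apply/andP; split; last by rewrite (le_lt_trans (ki_le n x))// ltry.
  by apply: lt_le_trans (ki_ge n x); rewrite lte_fin divr_gt0// expR_gt0.
exists (fun n => soft_transform c (nu_ n) (g_ n) K); split.
- move=> x r r0; apply: filterS (continuous_tube x c_cont cK r0) => x' xx' n.
  exact: (soft_transform_dist c_cont (mg n) cK (ki_fin n)).
- move=> x; exists (`|ln (2 * expR (a + C))| + `|ln (expR (- b - D x) / 2)|) => n.
  rewrite /soft_transform normrN; have /andP[] := ki_fin n x.
  move: (ki_le n x) (ki_ge n x).
  case: (kernel_integral _ _ _ _ _) => [k| |]//=; rewrite !lee_fin lte_fin => kM km k_gt0 _.
  have m0 : 0 < expR (- b - D x) / 2 by rewrite divr_gt0// expR_gt0.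
  have M0 : 0 < 2 * expR (a + C) by rewrite mulr_gt0// expR_gt0.
  have h1 : ln k <= ln (2 * expR (a + C)) by rewrite ler_ln ?posrE.
  have h2 : ln (expR (- b - D x) / 2) <= ln k by rewrite ler_ln ?posrE.
  have := ler_norm (ln (2 * expR (a + C))).
  have := ler_norm (- ln (expR (- b - D x) / 2)); rewrite normrN.
  have := normr_ge0 (ln (2 * expR (a + C))).
  have := normr_ge0 (ln (expR (- b - D x) / 2)).
  by rewrite (ler_norml (ln k)) => *; apply/andP; split; lra.
- move=> n.
  apply: (le_trans (soft_transform_approx c_cont (mg n) cK (mf n) (ki_fin n) e0 _ _)).
  + by move=> A mA; exact: J_le.
  + by move=> A mA; exact: J_ge.
  apply: (@le_trans _ _ ((1 - expR (- e))^-1%:E * ((1 - expR (- e)) * d)%:E)%E).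
    apply: lee_wpmul2l; first by rewrite lee_fin invr_ge0 ltW.
    by apply: (le_trans (nuK n)); rewrite lee_fin ge_min lexx orbT.
  by rewrite -EFinM lee_fin mulKf// gt_eqF.
Qed.

Lemma weak_cvg_subseq (R : realType) d (T : topMeasurableType d)
    (P_ : nat -> probability T R) (P : probability T R) (phi : nat -> nat) :
  increasing_seq phi -> weak_cvg P_ P -> weak_cvg (P_ \o phi) P.
Proof.
move=> phi_incr PP h ch bh.
exact: (cvg_comp _ _ (increasing_seq_cvg phi_incr) (PP h ch bh)).
Qed.

Lemma equicontinuous_subseq (R : realType) (X : topologicalType)
    (F : nat -> X -> R) (phi : nat -> nat) :
  equicontinuous_seq F -> equicontinuous_seq (F \o phi).
Proof. by move=> Feq x e e0; apply: filterS (Feq x e e0) => y Fy n; exact: Fy. Qed.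

(** One diagonal extraction over pairs of a level [k] and a dense point gives convergence at all
    dense points and all levels; equicontinuity extends it to every point. *)
Lemma equicontinuous_extraction (R : realType) (X : polishType R)
    (F : nat -> nat -> X -> R) :
  (forall k, equicontinuous_seq (F k)) ->
  (forall k x, exists M, forall n, `|F k n x| <= M) ->
  exists phi, increasing_seq phi /\ exists G : nat -> X -> R,
    forall k x, F k (phi l) x @[l --> \oo] --> G k x.
Proof.
move=> Feq Fb; have [u u_dense] := @polish_dense_seq R X.
have [|phi [phi_incr cv]] := @diagonal_extraction R (nat * nat)%type
    (fun p n => F p.1 n (u p.2)).
  by move=> p; exact: Fb.
exists phi; split => //; exists (fun k x => limn (fun l => F k (phi l) x)) => k x.
apply: (@equicontinuous_cvg_dense R X (F k \o phi) _ (range u)).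
- exact: equicontinuous_subseq.
- move=> y V /nbhs_ballP[e /= e0 yV]; have [i ui] := u_dense y e e0.
  exists (u i); first by exists i.
  by apply: yV; rewrite ballEmdist/= metric_sym.
- by move=> _ [i _ <-]; exact: (cv (k, i)).
Qed.

(** On the compact [K k], [F k n] is eventually within [dyad R k] of [G k]. Adding this error to
    that of [F k n], and the mass outside [K k] to the exceptional mass, gives the two factors 2 in
    [approx_cvg_exists]. *)
Lemma side_limit (R : realType) (X : polishType R)
    (mu_ : nat -> probability (borel X) R) (mu : probability (borel X) R)
    (mu_cvg : weak_cvg mu_ mu) (f_ : nat -> X -> R)
    (mf : forall n, measurable_fun setT (f_ n : borel X -> R))
    (K : nat -> set X) (F : nat -> nat -> X -> R) (G : nat -> X -> R) :
  (forall k, compact (K k)) ->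
  (forall k n, mu_ n (~` K k : set (borel X)) <= (dyad R k)%:E)%E ->
  (forall k, equicontinuous_seq (F k)) ->
  (forall k n, mu_ n [set x | (dyad R k <= `|f_ n x - F k n x|)%R] <= (dyad R k)%:E)%E ->
  (forall k x, F k n x @[n --> \oo] --> G k x) ->
  exists f : {mfun borel X >-> R},
    {ae mu, forall x, G k x @[k --> \oo] --> f x} /\ approx_cvg mu_ mu f_ f.
Proof.
move=> cK muK Feq Fap FG.
have cG k : continuous (G k) := equicontinuous_lim_continuous (Feq k) (FG k).
apply: approx_cvg_exists => //; first exact: continuous_measurable_borel.
move=> k.
have := equicontinuous_cvg_compact (Feq k) (cK k) (FG k) (dyad_gt0 R k).
apply: filterS => n FGn.
have mK : measurable (~` K k : set (borel X)).
  by apply: measurableC; exact: compact_measurable_borel.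
have mF : measurable_fun setT (F k n : borel X -> R).
  apply: continuous_measurable_borel; exact: equicontinuous_seq_continuous.
pose B : set (borel X) := [set x | dyad R k <= `|f_ n x - F k n x|].
have mB : measurable B by apply: measurable_ge_norm; exact: measurable_funB.
have mG : measurable_fun setT (G k : borel X -> R) by exact: continuous_measurable_borel.
apply: (@le_trans _ _ (mu_ n (~` K k `|` B))).
  apply: le_measure; rewrite ?inE.
  - by apply: measurable_ge_norm; exact: measurable_funB.
  - exact: measurableU.
  - move=> x /= fGx; apply: contrapT => /not_orP[/contrapT Kx /negP].
    rewrite -ltNge => fFx; have := FGn x Kx.
    have : `|f_ n x - G k x| <= `|f_ n x - F k n x| + `|F k n x - G k x|.
      by rewrite -[f_ n x - G k x](subrKA (F k n x)); exact: ler_normD.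
    lra.
have KB : (mu_ n (~` K k `|` B) <= mu_ n (~` K k : set (borel X)) + mu_ n B)%E.
  exact: measureU2.
apply: (le_trans KB); rewrite (_ : 2 * dyad R k = dyad R k + dyad R k) ?EFinD; last by lra.
by apply: leeD; [exact: muK|exact: Fap].
Qed.

(** * Densities and relative entropy *)

Local Open Scope charge_scope.

(** A real-valued version of the Radon-Nikodym derivative, nonnegative everywhere and described
    through the measures of sets, so that it transfers at once between couplings that agree on
    measurable sets. *)
Definition has_density d (T : measurableType d) (R : realType)
    (P rho : probability T R) (q : T -> R) : Prop :=
  [/\ measurable_fun setT q, forall x, 0 <= q x &
      forall A, measurable A -> P A = (\int[rho]_(x in A) (q x)%:E)%E].

Section density.
Context d (T : measurableType d) (R : realType) (P rho : probability T R).
Local Open Scope ereal_scope.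

Lemma density_dominates q : has_density P rho q -> P `<< rho.
Proof.
move=> [mq q0 Pq] A nA B mB BA; rewrite Pq//.
have rB : rho B = 0 by exact: nA.
rewrite (ae_eq_integral (cst 0)) ?integral0//.
- exact/measurable_funTS/measurable_EFinP.
- exact: ae_eq0.
Qed.

(** This form of the derivative carries the change of variables formula, while the derivative of a
    charge occurs in [relative_entropy] and [potentials]. Both are compared with [q]. *)
Let f := Radon_Nikodym_SigmaFinite.f P rho.

Lemma density_ae_eq q : has_density P rho q ->
  ae_eq rho setT f (EFin \o q).
Proof.
move=> Pq; have Prho := density_dominates Pq; have [mq q0 PqE] := Pq.
apply: integral_ae_eq => //.
- exact: Radon_Nikodym_SigmaFinite.f_integrable.
- exact/measurable_EFinP.
- by move=> A _ mA; rewrite -Radon_Nikodym_SigmaFinite.f_integral//; exact: PqE.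
Qed.

Lemma density_Radon_Nikodym q : has_density P rho q ->
  {ae rho, forall x, 'd (charge_of_finite_measure P) '/d rho x = (q x)%:E}.
Proof.
move=> Pq; have Prho := density_dominates Pq; have [mq q0 PqE] := Pq.
have : ae_eq rho setT ('d (charge_of_finite_measure P) '/d rho) (EFin \o q).
  apply: integral_ae_eq => //.
  - exact: Radon_Nikodym_integrable.
  - exact/measurable_EFinP.
  - by move=> A _ mA; rewrite -Radon_Nikodym_integral//=; exact: PqE.
by apply: filterS => x; exact.
Qed.

Lemma Radon_Nikodym_density (q : T -> R) : P `<< rho ->
  measurable_fun setT q -> (forall x, 0 <= q x)%R ->
  {ae rho, forall x, 'd (charge_of_finite_measure P) '/d rho x = (q x)%:E} ->
  has_density P rho q.
Proof.
move=> Prho mq q0 aeq; split => // A mA.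
rewrite -[LHS]/(charge_of_finite_measure P A) (Radon_Nikodym_integral (mu := rho))//.
apply: ae_eq_integral => //.
- apply: measurable_funTS; apply: measurable_int; exact: Radon_Nikodym_integrable.
- exact/measurable_funTS/measurable_EFinP.
- by apply: filterS aeq => x ->.
Qed.

Lemma dominates_density : P `<< rho -> exists q, has_density P rho q.
Proof.
move=> Prho; exists (fine \o f).
have ff x : f x \is a fin_num by exact: Radon_Nikodym_SigmaFinite.f_fin_num.
have fE : EFin \o (fine \o f) = f by apply/funext => x /=; rewrite fineK.
have mf := measurable_int _ (Radon_Nikodym_SigmaFinite.f_integrable Prho).
split.
- by apply/measurable_EFinP; rewrite fE.
- by move=> x; rewrite /= fine_ge0//; exact: Radon_Nikodym_SigmaFinite.f_ge0.
- move=> A mA; rewrite [LHS](Radon_Nikodym_SigmaFinite.f_integral Prho)//.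
  by apply: eq_integral => x _; rewrite -[RHS]/((EFin \o (fine \o f)) x) fE.
Qed.

Lemma density_ge0_integral q (h : T -> \bar R) D : has_density P rho q ->
  measurable D -> measurable_fun setT h -> (forall x, 0 <= h x) ->
  \int[P]_(x in D) h x = \int[rho]_(x in D) (h x * (q x)%:E).
Proof.
move=> Pq mD mh h0; have Prho := density_dominates Pq; have [mq q0 PqE] := Pq.
rewrite -(Radon_Nikodym_SigmaFinite.change_of_variables Prho)//; last exact: measurable_funTS.
have mf := measurable_int _ (Radon_Nikodym_SigmaFinite.f_integrable Prho).
apply: ge0_ae_eq_integral => //.
- by apply: emeasurable_funM; exact: measurable_funTS.
- apply: emeasurable_funM; first exact: measurable_funTS.
  exact/measurable_funTS/measurable_EFinP.
- by move=> x _; rewrite mule_ge0//; exact: Radon_Nikodym_SigmaFinite.f_ge0.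
- by move=> x _; rewrite mule_ge0// lee_fin.
- by apply: filterS (density_ae_eq Pq) => x fq Dx; congr (_ * _); exact: fq.
Qed.

Lemma density_integral q (h : T -> \bar R) : has_density P rho q ->
  measurable_fun setT h ->
  \int[P]_x h x = \int[rho]_x (h x * (q x)%:E).
Proof.
move=> Pq mh; have [mq q0 PqE] := Pq.
rewrite integralE [RHS]integralE; congr (_ - _).
- rewrite (density_ge0_integral Pq)//; last exact: measurable_funepos.
  apply: eq_integral => x _; rewrite !funeposE.
  by rewrite maxe_pMl ?lee_fin// mul0e.
- rewrite (density_ge0_integral Pq)//; last exact: measurable_funeneg.
  apply: eq_integral => x _; rewrite !funenegE.
  by rewrite -mulNe maxe_pMl ?lee_fin// mul0e.
Qed.

End density.

(** The negative part is dominated by [w], so an infinite positive part would make the integral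
    [+oo]. *)
Lemma integrable_neg_lt_pinfty d (T : measurableType d) (R : realType)
    (P : probability T R) (h w : T -> R) :
  measurable_fun setT h -> P.-integrable setT (EFin \o w) ->
  (forall x, Num.max (- h x) 0 <= w x) ->
  (\int[P]_x (h x)%:E < +oo)%E -> P.-integrable setT (EFin \o h).
Proof.
move=> mh iw hw hoo.
have mhE : measurable_fun setT (EFin \o h) by exact/measurable_EFinP.
have neg : (\int[P]_x ((EFin \o h)^\- x) < +oo)%E.
  apply: (@le_lt_trans _ _ (\int[P]_x (w x)%:E)%E); last exact: integrable_lty.
  apply: ge0_le_integral => //.
  - exact: measurable_funeneg.
  - exact: measurable_int iw.
  - by move=> x _; rewrite funenegE/= -EFin_max lee_fin.
apply/integrableP; split => //.
have -> : (fun x => `|(EFin \o h) x|)%E = ((EFin \o h)^\+ \+ (EFin \o h)^\-)%E.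
  by rewrite -fune_abse.
rewrite ge0_integralD//; [|exact: measurable_funepos|exact: measurable_funeneg].
rewrite lte_add_pinfty//.
rewrite ltNge leye_eq; apply/negP => /eqP pos.
move: hoo; rewrite integralE pos.
have : (0 <= \int[P]_x (EFin \o h)^\- x)%E by apply: integral_ge0.
by case: (\int[P]_x (EFin \o h)^\- x)%E neg.
Qed.

Section entropy.
Context d (T : measurableType d) (R : realType) (P rho : probability T R).
Context (q : T -> R) (Pq : has_density P rho q).
Local Open Scope charge_scope.
Local Open Scope ereal_scope.

Let mq : measurable_fun setT q. Proof. by case: Pq. Qed.
Let q0 x : (0 <= q x)%R. Proof. by case: Pq. Qed.

Let mZ : measurable [set x | q x = 0%R].
Proof.
rewrite -[X in measurable X]setTI -[X in _ `&` X]/(q @^-1` [set 0%R]).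
exact: mq.
Qed.

Lemma density_zero_null : P [set x | q x = 0%R] = 0.
Proof.
have [_ _ ->//] := Pq; rewrite (eq_integral (cst 0)) ?integral0// => x.
by rewrite inE => ->.
Qed.

Lemma density_ae_gt0 : {ae P, forall x, (0 < q x)%R}.
Proof.
exists [set x | q x = 0%R]; split => [||x /= /negP]; [exact: mZ|exact: density_zero_null|].
by rewrite lt_neqAle q0 andbT negbK => /eqP.
Qed.

Let mlnq : measurable_fun setT (fun x => ln (q x)).
Proof. exact: measurableT_comp. Qed.

(** Where the density vanishes, [lne] is [-oo] and [ln] is 0 by default; these points form a
    [P]-null set. *)
Lemma relative_entropyE : relative_entropy P rho = \int[P]_x (ln (q x))%:E.
Proof.
have Prho := density_dominates Pq; rewrite /relative_entropy asboolT//.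
apply: ae_eq_integral => //.
- pose r x := fine (('d (charge_of_finite_measure P) '/d rho) x).
  have rE x : ('d (charge_of_finite_measure P) '/d rho) x = (r x)%:E.
    by rewrite /r fineK//; exact: Radon_Nikodym_fin_num.
  have mr : measurable_fun setT r.
    apply/measurable_EFinP; rewrite (_ : EFin \o r = ('d (charge_of_finite_measure P) '/d rho)).
      by apply: measurable_int; exact: Radon_Nikodym_integrable.
    by apply/funext => x; rewrite rE.
  rewrite (_ : (fun x => _) = (fun x => if (r x <= 0)%R then -oo else (ln (r x))%:E)).
    apply: measurable_fun_ifT => //; first exact: measurable_fun_ler.
    by apply/measurable_EFinP; exact: measurableT_comp.
  by apply/funext => x; rewrite rE.
- exact/measurable_EFinP.
- have aeq : {ae P, forall x, ('d (charge_of_finite_measure P) '/d rho) x = (q x)%:E}.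
    have [N [mN rN subN]] := density_Radon_Nikodym Pq.
    exists N; split => //; apply/(measure0_null_setP _ mN); apply: Prho.
    exact/(measure0_null_setP _ mN).
  by apply: filterS2 aeq density_ae_gt0 => x qx qx0 _; rewrite qx lne_EFin.
Qed.

(* [exp u / q], with value 0 instead of a junk quotient where [q] vanishes. *)
Definition density_ratio (u : T -> R) (x : T) : R :=
  if q x == 0%R then 0%R else expR (u x - ln (q x)).

Lemma measurable_density_ratio u : measurable_fun setT u ->
  measurable_fun setT (density_ratio u).
Proof.
move=> mu; apply: measurable_fun_ifT => //.
  by apply: measurable_fun_eqr.
by apply: measurableT_comp => //; exact: measurable_funB.
Qed.

Lemma density_ratio_ge0 u x : (0 <= density_ratio u x)%R.
Proof. by rewrite /density_ratio; case: ifP => // _; exact: expR_ge0. Qed.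

Lemma integral_density_ratio u : measurable_fun setT u ->
  \int[P]_x (density_ratio u x)%:E =
  \int[rho]_(x in ~` [set x | q x = 0%R]) (expR (u x))%:E.
Proof.
move=> mu; have mr := measurable_density_ratio mu.
rewrite (density_ge0_integral Pq)//; last 2 first.
- exact/measurable_EFinP.
- by move=> x; rewrite lee_fin density_ratio_ge0.
rewrite [RHS]integral_mkcond; apply: eq_integral => x _; rewrite patchE /density_ratio.
have [qx|qx] := eqVneq (q x) 0%R.
  by rewrite mul0e memNset//= => /(_ qx).
rewrite mem_set; last by apply/eqP.
rewrite -EFinM expRD expRN lnK ?mulfVK//.
by rewrite posrE lt_neqAle eq_sym qx q0.
Qed.

(** Integration against [P] multiplies by [q] and cancels the denominator, leaving the
    [rho]-integral of [exp u] over the set where [q] does not vanish. *)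
Lemma integrable_density_ratio u : measurable_fun setT u ->
  \int[rho]_x (expR (u x))%:E <= 1 ->
  P.-integrable setT (EFin \o density_ratio u) /\ (\int[P]_x density_ratio u x <= 1)%R.
Proof.
move=> mu u1.
have r1 : \int[P]_x (density_ratio u x)%:E <= 1.
  rewrite integral_density_ratio//; apply: le_trans u1.
  apply: ge0_subset_integral => //; first exact: measurableC.
  exact/measurable_EFinP/measurableT_comp.
have ir : P.-integrable setT (EFin \o density_ratio u).
  apply/integrableP; split; first exact/measurable_EFinP/measurable_density_ratio.
  rewrite (eq_integral (fun x => (density_ratio u x)%:E)) => [|x _].
    by rewrite (le_lt_trans r1)// ltry.
  by rewrite /= ger0_norm ?density_ratio_ge0.
split => //; rewrite -lee_fin /Rintegral fineK//.
exact: integrable_fin_num.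
Qed.

Lemma ln_density_ge u x : q x != 0%R ->
  (1 - density_ratio u x <= ln (q x) - u x)%R.
Proof.
move=> qx; rewrite /density_ratio (negbTE qx).
by have := @expR_ge1Dx R (u x - ln (q x)); lra.
Qed.

(** The dominating function is [1 / q], whose [P]-integral is at most 1; so the negative part of
    [ln q] is always integrable and the entropy is never [-oo]. *)
Lemma ln_density_neg_le x : (Num.max (- ln (q x)) 0 <= density_ratio (cst 0) x)%R.
Proof.
rewrite ge_max density_ratio_ge0 andbT.
have [qx|qx] := eqVneq (q x) 0%R; first by rewrite qx ln0// oppr0 density_ratio_ge0.
have := ln_density_ge (cst 0%R) qx; rewrite /= /cst; lra.
Qed.

End entropy.

Lemma ae_eq_Rintegral d (T : measurableType d) (R : realType)
    (P : probability T R) (f g : T -> R) :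
  measurable_fun setT f -> measurable_fun setT g ->
  {ae P, forall x, f x = g x} -> \int[P]_x f x = \int[P]_x g x.
Proof.
move=> mf mg fg; rewrite /Rintegral; congr fine.
apply: ae_eq_integral => //; [exact/measurable_EFinP..|].
by apply: filterS fg => x -> .
Qed.

Lemma Rintegral_ge0_eq0 d (T : measurableType d) (R : realType)
    (P : probability T R) (f : T -> R) :
  P.-integrable setT (EFin \o f) -> (forall x, 0 <= f x) ->
  \int[P]_x f x <= 0 -> {ae P, forall x, f x = 0}.
Proof.
move=> intf f0 If.
have mf := measurable_int _ intf.
have I0 : (\int[P]_x (f x)%:E = 0)%E.
  rewrite -[LHS]fineK; last exact: integrable_fin_num.
  congr EFin; apply/le_anti/andP; split => //.
  by apply: Rintegral_ge0.
have : ae_eq P setT (EFin \o f) (cst 0%E).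
  apply/ae_eq_integral_abs => //; rewrite -[RHS]I0; apply: eq_integral => x _.
  by rewrite /= ger0_norm.
by apply: filterS => x /(_ I) [].
Qed.

Lemma probability_le_eq d (T : measurableType d) (R : realType)
    (P Q : probability T R) : (forall A, measurable A -> P A <= Q A)%E ->
  forall A, measurable A -> P A = Q A.
Proof.
move=> PQ A mA; apply/le_anti/andP; split; first exact: PQ.
have := PQ _ (measurableC mA); rewrite !probability_setC//.
rewrite -(@fineK _ (P A)) ?fin_num_measure// -(@fineK _ (Q A)) ?fin_num_measure//.
rewrite -!EFinB !lee_fin; lra.
Qed.

Section gibbs.
Context d (T : measurableType d) (R : realType) (rho : probability T R).
Context (c s : T -> R) (c_ge0 : forall x, 0 <= c x).
Hypotheses (mc : measurable_fun setT c) (ms : measurable_fun setT s).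
Context (P0 : probability T R).
Hypothesis P0_density : has_density P0 rho (fun x => expR (s x - c x)).
Context (P : probability T R).
Local Open Scope ereal_scope.

(** The cost is nonnegative and the entropy is not [-oo], so no cancellation of infinities can hide
    in a finite sum. *)
Lemma entropic_cost_integrable q : has_density P rho q ->
  \int[P]_x (c x)%:E + relative_entropy P rho < +oo ->
  [/\ P.-integrable setT (EFin \o c), P.-integrable setT (fun x => (ln (q x))%:E) &
   \int[P]_x (c x)%:E + relative_entropy P rho =
     (\int[P]_x c x + \int[P]_x ln (q x))%:E].
Proof.
move=> Pq; have [mq q0 _] := Pq; rewrite (relative_entropyE Pq) => fin.
have mlnq : measurable_fun setT (fun x => ln (q x)) by exact: measurableT_comp.
have [|iw _] := @integrable_density_ratio _ _ _ P rho q Pq (cst 0%R) (measurable_cst _).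
  rewrite (eq_integral (cst 1)) => [|x _]; last by rewrite /= expR0.
  by rewrite integral_cst// mul1e probability_le1.
have c0 : 0 <= \int[P]_x (c x)%:E by apply: integral_ge0 => x _; rewrite lee_fin.
have lnNy : \int[P]_x (ln (q x))%:E != -oo.
  apply/eqP => lE.
  have il : P.-integrable setT (fun x => (ln (q x))%:E).
    by apply: (integrable_neg_lt_pinfty mlnq iw (ln_density_neg_le q)); rewrite lE.
  by have := integrable_fin_num measurableT il; rewrite lE.
have coo : \int[P]_x (c x)%:E < +oo.
  rewrite ltNge leye_eq; apply/negP => /eqP cE; move: fin; rewrite cE.
  by case: (\int[P]_x (ln (q x))%:E) lnNy.
have lnoo : \int[P]_x (ln (q x))%:E < +oo.
  rewrite ltNge leye_eq; apply/negP => /eqP lE; move: fin; rewrite lE.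
  by case: (\int[P]_x (c x)%:E) c0.
have ic : P.-integrable setT (EFin \o c).
  apply/integrableP; split; first exact/measurable_EFinP.
  rewrite (eq_integral (fun x => (c x)%:E)) => [//|x _].
  by rewrite /= ger0_norm.
have il : P.-integrable setT (fun x => (ln (q x))%:E).
  exact: (integrable_neg_lt_pinfty mlnq iw (ln_density_neg_le q)).
split => //; rewrite EFinD /Rintegral !fineK//; exact: integrable_fin_num.
Qed.

(* Integrate [ln t >= 1 - 1 / t] at [t = q / exp (s - c)], [q] the density of [P];
   equality in this bound forces [q = exp (s - c)]. *)
Lemma gibbs_inequality : P.-integrable setT (EFin \o s) ->
  \int[P]_x (s x)%:E <= \int[P]_x (c x)%:E + relative_entropy P rho /\
  (\int[P]_x (c x)%:E + relative_entropy P rho <= \int[P]_x (s x)%:E ->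
   forall A, measurable A -> P A = P0 A).
Proof.
move=> is_.
have Is : \int[P]_x (s x)%:E \is a fin_num by exact: integrable_fin_num.
have [] := ltP (\int[P]_x (c x)%:E + relative_entropy P rho) +oo; last first.
  rewrite leye_eq => /eqP ->; split; first exact: leey.
  by rewrite leye_eq => /eqP Isoo; rewrite Isoo in Is.
move=> fin.
have Prho : P `<< rho.
  apply: contrapT => nPrho; move: fin; rewrite /relative_entropy asboolF//.
  have : 0 <= \int[P]_x (c x)%:E by apply: integral_ge0 => x _; rewrite lee_fin.
  by case: (\int[P]_x (c x)%:E).
have [q Pq] := dominates_density Prho; have [mq q0 PqE] := Pq.
have [ic il ->] := entropic_cost_integrable Pq fin.
have [_ _ P0E] := P0_density.
pose u x := (s x - c x)%R.
have mu : measurable_fun setT u by exact: measurable_funB.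
have [|iw w1] := @integrable_density_ratio _ _ _ P rho q Pq u mu.
  by rewrite -P0E// probability_le1.
pose w := density_ratio q u.
(* This is [ln t - 1 + 1 / t]. Since [w] has integral at most 1, the integral of [h] is at most
   total cost minus the integral of [s]. *)
pose h x := (c x + ln (q x) - s x - 1 + w x)%R.
have i1 : P.-integrable setT (EFin \o cst 1%R) by exact: (@bounded_integrable _ _ _ _ _ `|1|%R).
have icl : P.-integrable setT (EFin \o (fun x => c x + ln (q x))%R) by exact: integrable_realD.
have icls : P.-integrable setT (EFin \o (fun x => c x + ln (q x) - s x)%R) by exact: integrable_realB icl is_.
have icls1 : P.-integrable setT (EFin \o (fun x => c x + ln (q x) - s x - 1)%R) by exact: integrable_realB icls i1.
have ih : P.-integrable setT (EFin \o h) by exact: integrable_realD.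
have hE : (\int[P]_x h x = \int[P]_x c x + \int[P]_x ln (q x) - \int[P]_x s x - 1 + \int[P]_x w x)%R.
  rewrite RintegralD// RintegralB//; first rewrite RintegralB//; first rewrite RintegralD//.
  by rewrite Rintegral_cst_probability.
(* On the [P]-null zero set of [q] the logarithm and the ratio have default values, and the sign of
   [h] is unknown there. *)
pose h2 x := if q x == 0%R then 0%R else h x.
have mh : measurable_fun setT h by apply/measurable_EFinP; exact: measurable_int ih.
have mh2 : measurable_fun setT h2.
  by apply: measurable_fun_ifT => //; apply: measurable_fun_eqr.
have hh2 : {ae P, forall x, h x = h2 x}.
  apply: filterS (density_ae_gt0 Pq) => x qx; rewrite /h2 ifF//.
  by apply/negbTE; rewrite gt_eqF.
have h2_ge0 x : (0 <= h2 x)%R.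
  rewrite /h2; case: eqVneq => // qx; have := ln_density_ge u qx.
  rewrite /h /w /u; lra.
have Ih : (\int[P]_x h x = \int[P]_x h2 x)%R by exact: ae_eq_Rintegral.
have ih2 : P.-integrable setT (EFin \o h2).
  apply: le_integrable ih => //; first exact/measurable_EFinP.
  by move=> x _; rewrite /h2/=; case: eqP => // _; rewrite normr0 lee_fin.
have IsE : \int[P]_x (s x)%:E = (\int[P]_x s x)%:E by rewrite /Rintegral fineK.
rewrite IsE !lee_fin; split.
  have : (0 <= \int[P]_x h2 x)%R by apply: Rintegral_ge0.
  rewrite -Ih hE; lra.
move=> le; have := Rintegral_ge0_eq0 ih2 h2_ge0.
rewrite -Ih hE => H.
have {}H : {ae P, forall x, h2 x = 0%R} by apply: H; lra.
pose E := [set x | q x = expR (u x)].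
have mE : measurable E.
  rewrite (_ : E = (fun x => q x == expR (u x)) @^-1` [set true]).
    by rewrite -[X in measurable X]setTI; apply: measurable_fun_eqr => //; exact: measurableT_comp.
  by apply/seteqP; split=> x /= /eqP.
have PE : P (~` E) = 0.
  have aeE : {ae P, forall x, E x}.
    (* Equality in [1 + t <= exp t] occurs at [t = 0] only. *)
    apply: filterS2 H (density_ae_gt0 Pq) => x h2x qx.
    apply: contrapT => Ex; have ux0 : (u x - ln (q x))%R != 0%R.
      by apply/eqP => /subr0_eq ux; apply: Ex; rewrite /E/= ux lnK.
    have := expR_gt1Dx ux0; move: h2x.
    rewrite /h2 /h /w /density_ratio gt_eqF// /u; lra.
  by apply/negligibleP => //; exact: measurableC.
(* The densities are known to agree only [P]-almost everywhere, which a priori gives just [P <= P0];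
   equality of the total masses does the rest. *)
apply: probability_le_eq => A mA.
have mAE := measurableI _ _ mA mE.
apply: (@le_trans _ _ (P (A `&` E))).
  have PAE : P (A `&` E `|` ~` E) <= P (A `&` E) + P (~` E).
    by apply: measureU2 => //; exact: measurableC.
  rewrite PE adde0 in PAE; apply: le_trans PAE; apply: le_measure; rewrite ?inE//.
    by apply: measurableU => //; exact: measurableC.
  by move=> x Ax; have [Ex|Ex] := pselect (E x); [left|right].
apply: (@le_trans _ _ (P0 (A `&` E))).
  rewrite PqE// P0E//; apply: ge0_le_integral => //.
  - by move=> x _; rewrite lee_fin.
  - exact/measurable_funTS/measurable_EFinP.
  - by apply/measurable_funTS/measurable_EFinP; exact: measurableT_comp.
  - by move=> x [_ Ex]; rewrite Ex.
by apply: le_measure; rewrite ?inE//; exact: subIsetl.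
Qed.

End gibbs.

(** * Couplings and Gibbs densities *)

Section pushforward_integral.
Context d1 d2 (T1 : measurableType d1) (T2 : measurableType d2) (R : realType).
Context (P : probability T1 R) (Q : probability T2 R) (p : T1 -> T2).
Hypotheses (mp : measurable_fun setT p)
  (PQ : forall A, measurable A -> pushforward P p A = Q A).
Local Open Scope ereal_scope.
Implicit Types h : T2 -> \bar R.

Let ge0_pushforward_integral h : measurable_fun setT h -> (forall x, 0 <= h x) ->
  \int[P]_z h (p z) = \int[Q]_x h x.
Proof.
move=> mh h0; transitivity (\int[pushforward P p]_x h x).
  by rewrite ge0_integral_pushforward.
by apply: eq_measure_integral => A mA _; exact: PQ.
Qed.

Lemma pushforward_integral h : measurable_fun setT h ->
  \int[P]_z h (p z) = \int[Q]_x h x.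
Proof.
move=> mh; rewrite integralE [RHS]integralE.
rewrite -(ge0_pushforward_integral (measurable_funepos mh) (funepos_ge0 _)).
rewrite -(ge0_pushforward_integral (measurable_funeneg mh) (funeneg_ge0 _)).
by congr (_ - _); apply: eq_integral => z _; rewrite ?funeposE ?funenegE.
Qed.

Lemma pushforward_integrable h : measurable_fun setT h ->
  Q.-integrable setT h <-> P.-integrable setT (fun z => h (p z)).
Proof.
move=> mh; have mhp : measurable_fun setT (fun z => h (p z)) by exact: measurableT_comp mh mp.
have E : \int[P]_z `|h (p z)| = \int[Q]_x `|h x|.
  by apply: (ge0_pushforward_integral (h := fun x => `|h x|)) => //; exact: measurableT_comp.
by split=> /integrableP[_ hoo]; apply/integrableP; split => //; move: hoo; rewrite E.
Qed.

End pushforward_integral.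

Section couplings.
Context (R : realType) (X Y : polishType R).
Context (mu : probability (borel X) R) (nu : probability (borel Y) R).
Context (pi : probability (borel X * borel Y)%type R) (pic : coupling mu nu pi).
Local Open Scope ereal_scope.

Definition coupling_integral_fst := pushforward_integral measurable_fst pic.1.
Definition coupling_integral_snd := pushforward_integral measurable_snd pic.2.
Definition coupling_integrable_fst := pushforward_integrable measurable_fst pic.1.
Definition coupling_integrable_snd := pushforward_integrable measurable_snd pic.2.

End couplings.

Section potentials.
Context (R : realType) (X Y : polishType R) (c : X * Y -> R).
Hypotheses (c_ge0 : forall z, 0 <= c z) (c_cont : continuous c).
Context (mu : probability (borel X) R) (nu : probability (borel Y) R).
Implicit Types (pi : probability (borel X * borel Y)%type R)
  (f : {mfun borel X >-> R}) (g : {mfun borel Y >-> R}).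
Local Open Scope ereal_scope.

Let rho : probability (borel X * borel Y)%type R := mu \x nu.

Definition gibbs_density f g (z : borel X * borel Y) : R := expR (f z.1 + g z.2 - c z).

Let mc : measurable_fun setT (c : borel X * borel Y -> R).
Proof. exact: (@continuous_measurable_prod R X Y c). Qed.

Let mf1 f : measurable_fun setT (fun z : borel X * borel Y => f z.1).
Proof. exact: (measurableT_comp (measurable_funPT f) measurable_fst). Qed.

Let mg2 g : measurable_fun setT (fun z : borel X * borel Y => g z.2).
Proof. exact: (measurableT_comp (measurable_funPT g) measurable_snd). Qed.

Let ms f g : measurable_fun setT (fun z : borel X * borel Y => (f z.1 + g z.2)%R).
Proof. exact: measurable_funD. Qed.

Lemma measurable_gibbs_density f g : measurable_fun setT (gibbs_density f g).
Proof. by apply: measurableT_comp => //; exact: measurable_funB. Qed.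

Lemma potentialsP f g : potentials c mu nu f g <->
  exists pi, optimal_coupling c mu nu pi /\ has_density pi rho (gibbs_density f g).
Proof.
split=> [[pi [pi_opt pi_rho pi_ae]]|[pi [pi_opt pi_dens]]].
  exists pi; split => //; apply: Radon_Nikodym_density => //.
  - exact: measurable_gibbs_density.
  - by move=> z; exact: expR_ge0.
exists pi; split => //; first exact: density_dominates pi_dens.
exact: density_Radon_Nikodym pi_dens.
Qed.

Lemma coupling_sum_integrable pi f g : coupling mu nu pi ->
  mu.-integrable setT (EFin \o f) -> nu.-integrable setT (EFin \o g) ->
  pi.-integrable setT (EFin \o (fun z : borel X * borel Y => (f z.1 + g z.2)%R)) /\
  \int[pi]_z (f z.1 + g z.2)%:E = (\int[mu]_x f x + \int[nu]_y g y)%:E.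
Proof.
move=> pic intf intg.
have mf : measurable_fun setT (EFin \o f) by exact/measurable_EFinP.
have mg : measurable_fun setT (EFin \o g) by exact/measurable_EFinP.
have if1 : pi.-integrable setT (EFin \o (fun z : borel X * borel Y => f z.1)).
  exact: (iffLR (coupling_integrable_fst pic mf) intf).
have ig2 : pi.-integrable setT (EFin \o (fun z : borel X * borel Y => g z.2)).
  exact: (iffLR (coupling_integrable_snd pic mg) intg).
have is_ := integrable_realD if1 ig2; split => //.
rewrite -[LHS]fineK; last exact: integrable_fin_num is_.
rewrite -[fine _]/(Rintegral pi setT (fun z : borel X * borel Y => (f z.1 + g z.2)%R)).
rewrite RintegralD//; congr (_ + _)%:E.
  by rewrite /Rintegral (coupling_integral_fst pic mf).
by rewrite /Rintegral (coupling_integral_snd pic mg).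
Qed.

(** All couplings integrate [f z.1 + g z.2] to the same number, so the Gibbs inequality bounds every
    cost below by this number, and only the coupling with the given density can attain it. *)
Lemma gibbs_optimal pi f g : coupling mu nu pi ->
  has_density pi rho (gibbs_density f g) ->
  mu.-integrable setT (EFin \o f) -> nu.-integrable setT (EFin \o g) ->
  [/\ optimal_coupling c mu nu pi,
      eot_value c mu nu = (\int[mu]_x f x + \int[nu]_y g y)%:E &
      forall pi', optimal_coupling c mu nu pi' -> forall A, measurable A -> pi' A = pi A].
Proof.
move=> pic pid intf intg.
pose s := fun z : borel X * borel Y => (f z.1 + g z.2)%R.
have gibbs pi' := @gibbs_inequality _ _ _ rho c s c_ge0 mc (ms f g) pi pid pi'.
have [is_ sE] := coupling_sum_integrable pic intf intg.
have cost_pi : eot_cost c mu nu pi = (\int[mu]_x f x + \int[nu]_y g y)%:E.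
  have lnE (z : borel X * borel Y) : (ln (gibbs_density f g z) = s z - c z)%R by rewrite expRK.
  have [|iw _] := integrable_density_ratio pid (measurable_cst (0%R : R)).
    rewrite (eq_integral (cst 1)) => [|z _]; last by rewrite /= expR0.
    by rewrite integral_cst// mul1e probability_le1.
  have isn : pi.-integrable setT (EFin \o (fun z => `|s z|)%R).
    rewrite (_ : EFin \o _ = (fun z => `|(EFin \o s) z|)); last exact/funext.
    exact: integrable_abse.
  (* Integrability of the cost is a conclusion here: [c] is [s] minus the logarithm of the density,
     hence at most [|s|] plus the integrable bound on the negative part of that logarithm. *)
  have ic : pi.-integrable setT (EFin \o (c : borel X * borel Y -> R)).
    apply: le_integrable (integrable_realD isn iw) => //; first exact/measurable_EFinP.
    move=> z _; rewrite lee_fin/= ger0_norm// ger0_norm; last first.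
      by rewrite addr_ge0// density_ratio_ge0.
    have := ln_density_neg_le (gibbs_density f g) z; rewrite lnE ge_max => /andP[+ _].
    have := ler_norm (s z); lra.
  have isc := integrable_realB is_ ic.
  rewrite /eot_cost (relative_entropyE pid).
  under [X in _ + X]eq_integral do rewrite lnE.
  rewrite -[X in X + _]fineK; last exact: integrable_fin_num ic.
  rewrite -[X in _ + X]fineK; last exact: integrable_fin_num isc.
  rewrite -EFinD -[X in (X + _)%R]/(Rintegral pi setT (c : borel X * borel Y -> R)).
  rewrite -[X in (_ + X)%R]/(Rintegral pi setT (fun z : borel X * borel Y => s z - c z)%R).
  rewrite RintegralB// addrC subrK -sE /Rintegral fineK//.
  exact: integrable_fin_num is_.
have lower pi' : coupling mu nu pi' ->
    (\int[mu]_x f x + \int[nu]_y g y)%:E <= eot_cost c mu nu pi'.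
  move=> pic'; have [is' sE'] := coupling_sum_integrable pic' intf intg.
  by have [+ _] := gibbs pi' is'; rewrite sE'.
have valE : eot_value c mu nu = (\int[mu]_x f x + \int[nu]_y g y)%:E.
  apply/le_anti/andP; split.
    by rewrite -cost_pi; apply: ereal_inf_lbound; exists pi.
  by apply: le_ereal_inf_tmp => _ [pi' pic' <-]; exact: lower.
split => //; first by split => //; rewrite ?valE ?ltry.
move=> pi' [_ pic' costE]; have [is' sE'] := coupling_sum_integrable pic' intf intg.
have [_ +] := gibbs pi' is'; apply.
by rewrite -[leLHS]/(eot_cost c mu nu pi') costE valE sE'.
Qed.

(** The Gibbs inequality with zero cost, zero potentials and the reference measure itself as
    optimizer. *)
Lemma relative_entropy_ge0 d (T : measurableType d) (P Q : probability T R) :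
  0 <= relative_entropy P Q.
Proof.
have QQ : has_density Q Q (fun x => expR (cst 0%R x - cst 0%R x)).
  split => [|x|A mA]; [exact: (measurable_cst (expR (0 - 0))%R)|exact: expR_ge0|].
  rewrite (eq_integral (cst 1)) => [|x _]; last by rewrite /= subr0 expR0.
  by rewrite integral_cst// mul1e.
have i0 : P.-integrable setT (EFin \o cst 0%R).
  by apply: (@bounded_integrable _ _ _ _ (cst 0%R) 0%R) => // x; rewrite normr0.
have [+ _] := @gibbs_inequality _ _ _ Q (cst 0%R) (cst 0%R) (fun=> lexx _)
  (measurable_cst _) (measurable_cst _) Q QQ P i0.
by rewrite !integral0 add0e.
Qed.

(** Finite cost makes [f z.1 + g z.2], the sum of the cost and the logarithm of the density,
    integrable under [pi]. The summands are separated by [|a| <= |a + b| + max a 0 + max b 0]. *)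
Lemma potentials_integrable f g pi :
  optimal_coupling c mu nu pi -> has_density pi rho (gibbs_density f g) ->
  \int[mu]_x (Num.max (f x) 0)%:E < +oo ->
  \int[nu]_y (Num.max (g y) 0)%:E < +oo ->
  mu.-integrable setT (EFin \o f) /\ nu.-integrable setT (EFin \o g).
Proof.
move=> [val_fin pic pi_val] pid fp gp.
have fin : \int[pi]_z (c z)%:E + relative_entropy pi rho < +oo.
  by rewrite -/(eot_cost c mu nu pi) pi_val.
have [ic il _] := @entropic_cost_integrable _ _ _ rho c c_ge0 mc pi _ pid fin.
have is_ : pi.-integrable setT (EFin \o (fun z : borel X * borel Y => (f z.1 + g z.2)%R)).
  have := integrable_realD ic il; apply: eq_integrable => // z _ /=.
  by rewrite /gibbs_density expRK addrC subrK.
have maxint d (T : measurableType d) (P : probability T R) (h : T -> R) :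
    measurable_fun setT h -> \int[P]_x (Num.max (h x) 0)%:E < +oo ->
    P.-integrable setT (EFin \o (fun x => Num.max (h x) 0%R)).
  move=> mh hoo; apply/integrableP; split.
    by apply/measurable_EFinP; exact: measurable_maxr.
  rewrite (eq_integral (fun x => (Num.max (h x) 0)%:E)) => [//|x _].
  by rewrite /= ger0_norm// le_max lexx orbT.
have mf : measurable_fun setT f by exact: measurable_funPT.
have mg : measurable_fun setT g by exact: measurable_funPT.
have mfp : measurable_fun setT (EFin \o (fun x => Num.max (f x) 0%R)).
  by apply/measurable_EFinP; exact: measurable_maxr.
have mgp : measurable_fun setT (EFin \o (fun x => Num.max (g x) 0%R)).
  by apply/measurable_EFinP; exact: measurable_maxr.
have ifp := iffLR (coupling_integrable_fst pic mfp) (maxint _ _ _ _ mf fp).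
have igp := iffLR (coupling_integrable_snd pic mgp) (maxint _ _ _ _ mg gp).
have isn : pi.-integrable setT (EFin \o (fun z : borel X * borel Y => `|f z.1 + g z.2|)%R).
  exact: (integrable_abse (f := EFin \o (fun z : borel X * borel Y => (f z.1 + g z.2)%R))).
have ib := integrable_realD isn (integrable_realD ifp igp).
have mfE : measurable_fun setT (EFin \o f) by exact/measurable_EFinP.
have mgE : measurable_fun setT (EFin \o g) by exact/measurable_EFinP.
have bnd (a b : R) : (`|a| <= `|a + b| + (Num.max a 0 + Num.max b 0))%R.
  have : (a <= Num.max a 0)%R by rewrite le_max lexx.
  have : (b <= Num.max b 0)%R by rewrite le_max lexx.
  have : (0 <= Num.max a 0)%R by rewrite le_max lexx orbT.
  have : (0 <= Num.max b 0)%R by rewrite le_max lexx orbT.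
  have := ler_norm (- (a + b))%R; have := normr_ge0 (a + b)%R; rewrite normrN => *.
  rewrite ler_norml; apply/andP; split; lra.
have bnd' (a b : R) : (`|b| <= `|a + b| + (Num.max a 0 + Num.max b 0))%R.
  by rewrite (addrC a) (addrC (Num.max a 0)%R); exact: bnd.
split.
  apply/(coupling_integrable_fst pic mfE); apply: le_integrable ib => //.
    exact: (measurableT_comp mfE measurable_fst).
  move=> z _; rewrite lee_fin/=; apply: le_trans (bnd _ (g z.2)) _.
  exact: ler_norm.
apply/(coupling_integrable_snd pic mgE); apply: le_integrable ib => //.
  exact: (measurableT_comp mgE measurable_snd).
move=> z _; rewrite lee_fin/=; apply: le_trans (bnd' (f z.1) _) _.
exact: ler_norm.
Qed.

End potentials.

(** * Passage to the limit in Gibbs densities *)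

Section product_marginals.
Context d1 d2 (T1 : measurableType d1) (T2 : measurableType d2) (R : realType).
Context (P : probability T1 R) (Q : probability T2 R).
Local Open Scope ereal_scope.

Lemma product_probability_fst (A : set T1) : measurable A ->
  (P \x Q) (fst @^-1` A) = P A.
Proof.
move=> mA; have -> : fst @^-1` A = A `*` [set: T2].
  by apply/seteqP; split=> [x|x []].
by rewrite product_measure1E// [X in _ * X](probability_setT Q) mule1.
Qed.

Lemma product_probability_snd (B : set T2) : measurable B ->
  (P \x Q) (snd @^-1` B) = Q B.
Proof.
move=> mB; have -> : snd @^-1` B = [set: T1] `*` B.
  by apply/seteqP; split=> [x|x []].
by rewrite product_measure1E// [X in X * _](probability_setT P) mul1e.
Qed.

Lemma ae_product_fst (A : T1 -> Prop) :
  {ae P, forall x, A x} -> {ae P \x Q, forall z, A z.1}.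
Proof.
move=> [N [mN PN subN]]; exists (fst @^-1` N); split.
- by rewrite -[X in measurable X]setTI; exact: measurable_fst.
- by rewrite product_probability_fst.
- by move=> z /= Az; apply: subN.
Qed.

Lemma ae_product_snd (A : T2 -> Prop) :
  {ae Q, forall y, A y} -> {ae P \x Q, forall z, A z.2}.
Proof.
move=> [N [mN PN subN]]; exists (snd @^-1` N); split.
- by rewrite -[X in measurable X]setTI; exact: measurable_snd.
- by rewrite product_probability_snd.
- by move=> z /= Az; apply: subN.
Qed.

Lemma product_probability_setU (A : set T1) (B : set T2) : measurable A -> measurable B ->
  (P \x Q) (fst @^-1` A `|` snd @^-1` B) <= P A + Q B.
Proof.
move=> mA mB.
have mA1 : measurable ((fst : T1 * T2 -> T1) @^-1` A).
  by rewrite -[X in measurable X]setTI; exact: measurable_fst.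
have mB2 : measurable ((snd : T1 * T2 -> T2) @^-1` B).
  by rewrite -[X in measurable X]setTI; exact: measurable_snd.
rewrite -(product_probability_fst mA) -(product_probability_snd mB).
exact: measureU2.
Qed.

End product_marginals.

Section product_approx.
Context (R : realType) (X Y : polishType R) (c : X * Y -> R).
Hypothesis c_cont : continuous c.
Context (mu_ : nat -> probability (borel X) R) (mu : probability (borel X) R)
  (nu_ : nat -> probability (borel Y) R) (nu : probability (borel Y) R)
  (f_ : nat -> X -> R) (g_ : nat -> Y -> R) (f : X -> R) (g : Y -> R)
  (mf : forall n, measurable_fun setT (f_ n : borel X -> R))
  (mg : forall n, measurable_fun setT (g_ n : borel Y -> R)).

Let phi_ n (z : borel X * borel Y) : R := f_ n z.1 + g_ n z.2 - c z.

Let mphi n : measurable_fun setT (phi_ n).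
Proof. exact: measurable_sum_cost. Qed.

Lemma approx_cvg_product :
  approx_cvg mu_ mu f_ f -> approx_cvg nu_ nu g_ g ->
  approx_cvg (fun n => mu_ n \x nu_ n)%E (mu \x nu)%E
    phi_ (fun z => f z.1 + g z.2 - c z).
Proof.
move=> [F [cF Ff Fap]] [G [cG Gg Gap]].
have cFG k : continuous (fun z : X * Y => F k z.1 + G k z.2 - c z).
  move=> z; apply: cvgB; last exact: c_cont.
  apply: cvgD.
    by apply: (@continuous_comp _ _ _ fst (F k)); [exact: cvg_fst|exact: cF].
  by apply: (@continuous_comp _ _ _ snd (G k)); [exact: cvg_snd|exact: cG].
exists (fun k z => F k z.1 + G k z.2 - c z); split => //.
- apply: filterS2 (ae_product_fst nu Ff) (ae_product_snd mu Gg) => z Fz Gz.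
  by apply: cvgB; [exact: cvgD|exact: cvg_cst].
- move=> e e0; have e2 : 0 < e / 2 by rewrite divr_gt0.
  apply: filterS2 (Fap _ e2) (Gap _ e2) => k Fk Gk.
  apply: filterS2 Fk Gk => n Fn Gn.
  pose A : set (borel X) := [set x | e / 2 <= `|f_ n x - F k x|].
  pose B : set (borel Y) := [set y | e / 2 <= `|g_ n y - G k y|].
  have mA : measurable A.
    by apply: measurable_ge_norm; apply: measurable_funB => //; exact: continuous_measurable_borel.
  have mB : measurable B.
    by apply: measurable_ge_norm; apply: measurable_funB => //; exact: continuous_measurable_borel.
  apply: (@le_trans _ _ ((mu_ n \x nu_ n) (fst @^-1` A `|` snd @^-1` B))%E).
    apply: le_measure; rewrite ?inE.
    + apply: measurable_ge_norm; apply: measurable_funB => //.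
      exact: (@continuous_measurable_prod R X Y _ (cFG k)).
    + apply: measurableU; rewrite -[X in measurable X]setTI.
        exact: measurable_fst.
      exact: measurable_snd.
    + move=> z /= ez; apply: contrapT => /not_orP[/negP + /negP].
      rewrite -!ltNge => Az Bz; move: ez; rewrite leNgt => /negP; apply.
      rewrite (_ : _ - _ = (f_ n z.1 - F k z.1) + (g_ n z.2 - G k z.2)); last first.
        by rewrite /phi_; ring.
      by apply: (le_lt_trans (ler_normD _ _)); lra.
  apply: (le_trans (product_probability_setU (mu_ n) (nu_ n) mA mB)).
  by rewrite [e in (_ <= e%:E)%E]splitr EFinD; exact: leeD.
Qed.

(** The cost is bounded on compact rectangles only; the tightness of the marginals confines the
    product measures to such a rectangle. *)
Lemma tight_seq_product : weak_cvg mu_ mu -> weak_cvg nu_ nu ->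
  tight_seq mu_ f_ -> tight_seq nu_ g_ ->
  tight_seq (fun n => mu_ n \x nu_ n)%E phi_.
Proof.
move=> mu_cvg nu_cvg ft gt e e0; have e4 : 0 < e / 4 by rewrite divr_gt0.
have [K [cK muK _]] := weak_cvg_tight mu_cvg e4.
have [L [cL nuL _]] := weak_cvg_tight nu_cvg e4.
have [a aP] := ft _ e4; have [b bP] := gt _ e4.
have [C _ cC] := compact_continuous_bounded c_cont (compact_setX cK cL).
exists (a + b + C) => n.
pose A1 : set (borel X) := [set x | a <= `|f_ n x|].
pose B1 : set (borel Y) := [set y | b <= `|g_ n y|].
have mA1 : measurable A1 by exact: measurable_ge_norm.
have mB1 : measurable B1 by exact: measurable_ge_norm.
have mK : measurable (~` K : set (borel X)) by apply: measurableC; exact: compact_measurable_borel.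
have mL : measurable (~` L : set (borel Y)) by apply: measurableC; exact: compact_measurable_borel.
have mA := measurableU _ _ mA1 mK; have mB := measurableU _ _ mB1 mL.
apply: (@le_trans _ _ ((mu_ n \x nu_ n)
    (fst @^-1` (A1 `|` ~` K) `|` snd @^-1` (B1 `|` ~` L)))%E).
  apply: le_measure; rewrite ?inE.
  + exact: measurable_ge_norm.
  + apply: measurableU; rewrite -[X in measurable X]setTI.
      exact: measurable_fst.
    exact: measurable_snd.
  + move=> z /= ez; apply: contrapT => /not_orP[/not_orP[/negP + /contrapT Kz] /not_orP[/negP + /contrapT Lz]].
    rewrite -!ltNge => Az Bz; move: ez; rewrite leNgt => /negP; apply.
    have := cC z (conj Kz Lz); have := ler_normB (f_ n z.1 + g_ n z.2) (c z).
    have := ler_normD (f_ n z.1) (g_ n z.2); rewrite /phi_; lra.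
apply: (le_trans (product_probability_setU (mu_ n) (nu_ n) mA mB)).
have A_le : (mu_ n (A1 `|` ~` K) <= (e / 4 + e / 4)%:E)%E.
  have U := measureU2 (mu_ n) mA1 mK.
  by apply: (le_trans U); rewrite EFinD; exact: leeD (aP n) (muK n).
have B_le : (nu_ n (B1 `|` ~` L) <= (e / 4 + e / 4)%:E)%E.
  have U := measureU2 (nu_ n) mB1 mL.
  by apply: (le_trans U); rewrite EFinD; exact: leeD (bP n) (nuL n).
by apply: (le_trans (leeD A_le B_le)); rewrite -EFinD lee_fin; lra.
Qed.

End product_approx.

Section density_measure.
Context d (T : measurableType d) (R : realType) (rho : probability T R).
Context (q : T -> R) (mq : measurable_fun setT q) (q0 : forall x, 0 <= q x).
Hypothesis q1 : (\int[rho]_x (q x)%:E = 1)%E.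
Local Open Scope ereal_scope.

(** The proofs are arguments so that the measure and probability structures attached to this set
    function can depend on them. *)
Definition density_measure & (measurable_fun setT q) & (forall x, (0 <= q x)%R) &
    \int[rho]_x (q x)%:E = 1 := fun A : set T => \int[rho]_(x in A) (q x)%:E.

Let dens := density_measure mq q0 q1.

Let dens0 : dens set0 = 0. Proof. by rewrite /dens /density_measure integral_set0. Qed.

Let dens_ge0 A : 0 <= dens A.
Proof. by apply: integral_ge0 => x _; rewrite lee_fin. Qed.

Let dens_sigma_additive : semi_sigma_additive dens.
Proof.
move=> F mF tF mUF; rewrite /dens /density_measure ge0_integral_bigcup//.
- by apply: is_cvg_ereal_nneg_natsum_cond => n _ _; exact: dens_ge0.
- exact/measurable_funTS/measurable_EFinP.
- by move=> x _; rewrite lee_fin.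
Qed.

HB.instance Definition _ := isMeasure.Build _ _ _ dens dens0 dens_ge0 dens_sigma_additive.

HB.instance Definition _ := Measure_isProbability.Build _ _ _ dens q1.

Lemma exists_density : exists P : probability T R, has_density P rho q.
Proof. by exists dens. Qed.

End density_measure.

Lemma density_Rintegral d (T : measurableType d) (R : realType)
    (P rho : probability T R) (q h : T -> R) : has_density P rho q ->
  measurable_fun setT h -> \int[P]_x h x = \int[rho]_x (h x * q x).
Proof.
move=> Pq mh; rewrite /Rintegral (density_integral Pq)//.
exact/measurable_EFinP.
Qed.

Definition exp_min (R : realType) (N t : R) : R := Num.min (expR t) N.

Lemma exp_min_cont (R : realType) (N : R) : continuous (exp_min N).
Proof.
move=> t; apply: (@continuous_min R R (@expR R) (cst N) t); last exact: cvg_cst.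
exact: continuous_expR.
Qed.

Lemma exp_min_le (R : realType) (N t : R) : 0 <= N -> `|exp_min N t| <= N.
Proof.
by move=> N0; rewrite /exp_min ger0_norm ?le_min ?expR_ge0// ge_min lexx orbT.
Qed.

Section density_limit.
Context (R : realType) d (T : topMeasurableType d) (cm : @continuous_measurable R d T).
Context (rho_ : nat -> probability T R) (rho : probability T R)
  (rho_cvg : weak_cvg rho_ rho) (phi_ : nat -> T -> R) (phi : T -> R)
  (mphi_ : forall n, measurable_fun setT (phi_ n)) (mphi : measurable_fun setT phi)
  (phi_cvg : approx_cvg rho_ rho phi_ phi) (phi_tight : tight_seq rho_ phi_)
  (pi_ : nat -> probability T R)
  (pi_dens : forall n, has_density (pi_ n) (rho_ n) (fun z => expR (phi_ n z))).
Hypothesis pi_tail : forall e : R, 0 < e -> \forall N \near \oo, forall n,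
  (pi_ n [set z | (N%:R <= expR (phi_ n z))%R] <= e%:E)%E.

(* The density of the part of [pi_ n] retained when [exp (phi_ n)] is cut at [N]. *)
Let r (N : nat) (u : T -> R) z : R := Num.min 1 (N%:R * expR (- u z)).

Let r01 N u z : 0 <= r N u z <= 1.
Proof. by rewrite /r le_min ler01 mulr_ge0// ge_min lexx. Qed.

Let mr N u : measurable_fun setT u -> measurable_fun setT (r N u).
Proof.
move=> mu; apply: measurable_minr => //; apply: measurable_funM => //.
by apply: measurableT_comp => //; exact: measurableT_comp.
Qed.

Let exp_minE N u z : exp_min N%:R (u z) = r N u z * expR (u z).
Proof.
by rewrite /exp_min /r minr_pMl ?expR_ge0// mul1r -mulrA -expRD addNr expR0 mulr1.
Qed.

Let exp_min_Rintegral (P Q : probability T R) (u h : T -> R) N :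
  has_density P Q (fun z => expR (u z)) -> measurable_fun setT u ->
  measurable_fun setT h ->
  \int[Q]_z (h z * exp_min N%:R (u z)) = \int[P]_z (h z * r N u z).
Proof.
move=> Pu mu mh; rewrite (density_Rintegral Pu); last first.
  by apply: measurable_funM => //; exact: mr.
by apply: eq_Rintegral => z _; rewrite exp_minE mulrA.
Qed.

Let mtail n (N : nat) : measurable [set z | N%:R <= expR (phi_ n z)].
Proof. by apply: measurable_ge_set; exact: measurableT_comp. Qed.

(** The retained fraction [r] is 1 unless the density reaches [N], so truncation changes the
    integral only on the tail, whose [pi_ n]-mass is small uniformly in [n]. *)
Let truncation_error n N (h : T -> R) M : measurable_fun setT h ->
  (forall z, `|h z| <= M) ->
  `|\int[pi_ n]_z h z - \int[rho_ n]_z (h z * exp_min N%:R (phi_ n z))| <=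
  (M + M) * fine (pi_ n [set z | N%:R <= expR (phi_ n z)]).
Proof.
move=> mh hM; rewrite (exp_min_Rintegral N (pi_dens n))//.
have mA := mtail n N.
rewrite -[leRHS]add0r; apply: Rintegral_dist_le => //.
- by apply: measurable_funM => //; exact: mr.
- move=> z; rewrite normrM; apply: le_trans (hM z).
  by have /andP[? ?] := r01 N (phi_ n) z; rewrite ler_piMr// ger0_norm.
- move=> z /negP; rewrite -ltNge => Nz.
  rewrite (_ : r N (phi_ n) z = 1) ?mulr1 ?subrr ?normr0 ?lexx//.
  apply/min_idPl; rewrite expRN -ler_pdivrMr ?invr_gt0 ?expR_gt0// invrK mul1r.
  exact: ltW.
Qed.

Let trunc_cvg (h : T -> R) N : continuous h -> bounded_fun h ->
  \int[rho_ n]_z (h z * exp_min N%:R (phi_ n z)) @[n --> \oo] -->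
  \int[rho]_z (h z * exp_min N%:R (phi z)).
Proof.
move=> ch bh; apply: approx_cvg_Rintegral => //; first exact: exp_min_cont.
by apply: (@bounded_fun_le _ _ _ N%:R) => t; exact: exp_min_le.
Qed.

Let mass_lower e : 0 < e ->
  \forall N \near \oo, 1 - e <= \int[rho]_z exp_min N%:R (phi z).
Proof.
move=> e0; have e2 : 0 < e / 2 by rewrite divr_gt0.
apply: filterS (pi_tail e2) => N HN.
have c1 : continuous (cst 1 : T -> R) by move=> x; exact: cvg_cst.
have b1 : bounded_fun (cst 1 : T -> R).
  by apply: (@bounded_fun_le _ _ _ 1) => z; rewrite normr1.
have := @trunc_cvg (cst 1) N c1 b1.
under eq_fun do under eq_Rintegral do rewrite mul1r.
under [X in _ --> X]eq_Rintegral do rewrite mul1r.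
move=> /cvgr_to_ge; apply; apply: nearW => n.
have := @truncation_error n N (cst 1) 1 (measurable_cst _) _.
rewrite Rintegral_cst_probability.
under [X in _ - X]eq_Rintegral do rewrite mul1r.
move=> H; have {H} : `|1 - \int[rho_ n]_z exp_min N%:R (phi_ n z)| <= (1 + 1) * fine (pi_ n [set z | N%:R <= expR (phi_ n z)]).
  by apply: H => z; rewrite normr1.
have : fine (pi_ n [set z | N%:R <= expR (phi_ n z)]) <= e / 2.
  by rewrite -lee_fin fineK ?fin_num_measure//; exact: HN.
rewrite ler_norml => ? /andP[? ?]; lra.
Qed.

Let mass_upper N : \int[rho]_z exp_min N%:R (phi z) <= 1.
Proof.
have c1 : continuous (cst 1 : T -> R) by move=> x; exact: cvg_cst.
have b1 : bounded_fun (cst 1 : T -> R).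
  by apply: (@bounded_fun_le _ _ _ 1) => z; rewrite normr1.
have := @trunc_cvg (cst 1) N c1 b1.
under [X in _ --> X]eq_Rintegral do rewrite mul1r.
move=> /cvgr_to_le; apply; apply: nearW => n.
rewrite (@exp_min_Rintegral _ _ (phi_ n) (cst 1) N (pi_dens n) (mphi_ n) (measurable_cst _)).
apply: le_trans (ler_norm _) _; apply: bounded_Rintegral_le.
  by apply: measurable_funM => //; exact: mr.
by move=> z; rewrite mul1r ger0_norm; have /andP[] := r01 N (phi_ n) z.
Qed.

(** [mass_lower] and [mass_upper] confine the truncated masses of [exp phi] to between [1 - e] and
    1, so by monotone convergence no mass is lost and [exp phi] defines a probability. Weak
    convergence follows by truncating at a level that is good for all [n] and for the limit. *)
Lemma density_limit : exists pi : probability T R,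
  has_density pi rho (fun z => expR (phi z)) /\ weak_cvg pi_ pi.
Proof.
have me : measurable_fun setT (fun z => expR (phi z)) by exact: measurableT_comp.
have e1 : (\int[rho]_z (expR (phi z))%:E = 1)%E.
  have mem N : measurable_fun setT (fun z => exp_min N%:R (phi z)).
    apply: measurableT_comp => //; apply: continuous_measurable_fun; exact: exp_min_cont.
  have I1 : \int[rho]_z exp_min N%:R (phi z) @[N --> \oo] --> (1 : R).
    apply/cvgrPdist_le => e e0; apply: filterS (mass_lower e0) => N HN.
    by rewrite ler_norml; have := mass_upper N; move=> ?; apply/andP; split; lra.
  have I2 : (\int[rho]_z (exp_min N%:R (phi z))%:E @[N --> \oo] --> 1)%E.
    rewrite (_ : (fun N => _) = (fun N => (\int[rho]_z exp_min N%:R (phi z))%:E)).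
      by apply: cvg_EFin => //; exact: nearW.
    apply/funext => N; rewrite /Rintegral fineK//; apply: integrable_fin_num => //.
    by apply: (bounded_integrable rho (mem N)) => z; exact: exp_min_le.
  apply: (cvg_unique _ _ I2) => //.
  have limE z : limn (fun N => (exp_min N%:R (phi z))%:E) = (expR (phi z))%:E.
    apply/cvg_lim => //; apply: cvg_near_cst; near=> N; congr EFin.
    by apply/min_idPl; near: N; exact: nbhs_infty_ger.
  rewrite -(eq_integral _ _ (fun z _ => limE z)).
  apply: cvg_monotone_convergence => // [N|N z _|z _ N N' NN'].
  - exact/measurable_EFinP.
  - by rewrite lee_fin le_min expR_ge0/=.
  - by rewrite lee_fin le_min !ge_min lexx/= ler_nat NN' orbT.
have [pi pid] := exists_density me (fun z => expR_ge0 (phi z)) e1.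
exists pi; split => // h ch bh; have [M hM] := bounded_funE bh.
have M0 : 0 <= M := le_trans (normr_ge0 _) (hM point).
have mh := cm ch.
apply/cvgrPdist_lt => e e0.
have e3 : 0 < e / 3 / (M + M + 1) by rewrite !divr_gt0// ltr_wpDl// addr_ge0.
have e3' : 0 < e / 3 by rewrite divr_gt0.
have cvr : \int[pi]_z (h z * r N phi z) @[N --> \oo] --> \int[pi]_z h z.
  apply: (@bounded_cvg_Rintegral _ _ _ _ _ _ M) => //.
  - by move=> N; apply: measurable_funM => //; exact: mr.
  - move=> N z; rewrite normrM; apply: le_trans (hM z).
    by have /andP[? ?] := r01 N phi z; rewrite ler_piMr// ger0_norm.
  - apply: aeW => z; apply: cvg_near_cst; near=> N.
    rewrite (_ : r N phi z = 1) ?mulr1//; apply/min_idPl.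
    rewrite expRN -ler_pdivrMr ?invr_gt0 ?expR_gt0// invrK mul1r.
    near: N; exact: nbhs_infty_ger.
have /cvgrPdist_lt/(_ _ e3') near1 := cvr.
have [N [N1 N2]] := filter_ex (filterI near1 (pi_tail e3)).
have /cvgrPdist_lt/(_ _ e3') := @trunc_cvg h N ch bh.
apply: filterS => n.
have := truncation_error n N mh hM.
have : (M + M) * fine (pi_ n [set z | N%:R <= expR (phi_ n z)]) <= e / 3.
  have H : fine (pi_ n [set z | N%:R <= expR (phi_ n z)]) <= e / 3 / (M + M + 1).
    by rewrite -lee_fin fineK ?fin_num_measure//; exact: N2.
  rewrite ler_pdivlMr ?ltr_wpDl ?addr_ge0// in H.
  have : 0 <= fine (pi_ n [set z | N%:R <= expR (phi_ n z)]) by rewrite fine_ge0.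
  lra.
move: N1; rewrite -(exp_min_Rintegral N pid)// !ltr_norml ler_norml.
move=> /andP[? ?] ? /andP[? ?] /andP[? ?]; apply/andP; split; lra.
Unshelve. all: by end_near. Qed.

End density_limit.

Lemma markov_norm d (T : measurableType d) (R : realType) (P : probability T R)
    (h : T -> R) (a : R) : 0 < a -> P.-integrable setT (EFin \o h) ->
  (P [set x | (a <= `|h x|)%R] <= ((\int[P]_x `|h x|) / a)%:E)%E.
Proof.
move=> a0 ih; have mh : measurable_fun setT h by apply/measurable_EFinP; exact: measurable_int ih.
have mA := measurable_ge_norm a mh; set A := [set x | _] in mA *.
have in_ : P.-integrable setT (EFin \o (fun x => `|h x|)).
  exact: (integrable_abse (f := EFin \o h)).
rewrite -(@fineK _ (P A)) ?fin_num_measure// lee_fin ler_pdivlMr//.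
have i1 : P.-integrable setT (EFin \o (fun x => \1_A x : R)).
  apply: (@bounded_integrable _ _ _ _ _ 1); first exact: measurable_indic.
  by move=> x; rewrite indicE; case: (x \in A); rewrite ?normr1 ?normr0.
have -> : fine (P A) * a = \int[P]_x (a * \1_A x).
  by rewrite RintegralZl// mulrC /Rintegral integral_indic// setIT.
apply: le_Rintegral => //.
  rewrite (_ : EFin \o _ = (fun x => a%:E * (EFin \o (fun x => \1_A x : R)) x)%E)//.
  exact: integrableZl.
move=> x _; rewrite indicE; case: (boolP (x \in A)); rewrite ?mulr1 ?mulr0//.
by rewrite inE.
Qed.

Lemma tight_seq_of_Rintegral d (T : measurableType d) (R : realType)
    (P_ : nat -> probability T R) (f_ : nat -> T -> R) (B : R) :
  (forall n, (P_ n).-integrable setT (EFin \o f_ n)) ->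
  (forall n, \int[P_ n]_x `|f_ n x| <= B) -> tight_seq P_ f_.
Proof.
move=> intf fB e e0.
have B1 : 0 < `|B| + 1 by rewrite ltr_wpDl.
have a0 : 0 < (`|B| + 1) / e by rewrite divr_gt0.
exists ((`|B| + 1) / e) => n.
apply: (le_trans (markov_norm a0 (intf n))); rewrite lee_fin.
rewrite ler_pdivrMr// mulrC divfK ?gt_eqF//.
by apply: (le_trans (fB n)); apply: (le_trans (ler_norm _)); rewrite lerDl.
Qed.

Section approx_fatou.
Context (R : realType) d (T : topMeasurableType d) (cm : @continuous_measurable R d T).
Context (P_ : nat -> probability T R) (P : probability T R)
  (P_cvg : weak_cvg P_ P) (f_ : nat -> T -> R) (f : T -> R)
  (mf_ : forall n, measurable_fun setT (f_ n)) (mf : measurable_fun setT f)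
  (f_cvg : approx_cvg P_ P f_ f) (f_tight : tight_seq P_ f_).
Context (h : T -> R) (k : R -> R) (ch : continuous h) (ck : continuous k)
  (h0 : forall x, 0 <= h x) (k0 : forall t, 0 <= k t).

(** Capping both factors at [N] makes them bounded test functions, for which the integrals converge;
    monotone convergence in [N] then removes the caps. *)
Lemma approx_cvg_fatou (B : R) :
  (\forall n \near \oo, (\int[P_ n]_x (h x * k (f_ n x))%:E <= B%:E)%E) ->
  (\int[P]_x (h x * k (f x))%:E <= B%:E)%E.
Proof.
move=> HB.
pose hN (N : nat) x := Num.min (h x) N%:R; pose kN (N : nat) t := Num.min (k t) N%:R.
have chN N : continuous (hN N).
  by move=> x; apply: (@continuous_min R T h (cst N%:R) x); [exact: ch|exact: cvg_cst].
have ckN N : continuous (kN N).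
  by move=> x; apply: (@continuous_min R R k (cst N%:R) x); [exact: ck|exact: cvg_cst].
have hN0 N x : 0 <= hN N x by rewrite le_min h0/=.
have kN0 N t : 0 <= kN N t by rewrite le_min k0/=.
have hNN N x : `|hN N x| <= N%:R by rewrite ger0_norm// ge_min lexx orbT.
have kNN N t : `|kN N t| <= N%:R by rewrite ger0_norm// ge_min lexx orbT.
have mh := cm ch; have mk : measurable_fun setT k by exact: continuous_measurable_fun.
have mhN N : measurable_fun setT (hN N) by exact: cm.
have mkN N : measurable_fun setT (kN N) by exact: continuous_measurable_fun.
have mhk N g : measurable_fun setT g -> measurable_fun setT (fun x => hN N x * kN N (g x)).
  by move=> mg; apply: measurable_funM => //; exact: measurableT_comp.
have hkb N g x : `|hN N x * kN N (g x)| <= N%:R * N%:R by rewrite normrM ler_pM.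
have trunc N : (\int[P]_x (hN N x * kN N (f x))%:E <= B%:E)%E.
  have iN := bounded_integrable P (mhk N f mf) (hkb N f).
  rewrite -[leLHS]fineK; last exact: integrable_fin_num iN.
  rewrite lee_fin -[leLHS]/(Rintegral P setT (fun x => hN N x * kN N (f x))).
  have := approx_cvg_Rintegral cm P_cvg mf_ mf f_cvg f_tight (chN N)
    (bounded_fun_le (hNN N)) (ckN N) (bounded_fun_le (kNN N)).
  move=> /cvgr_to_le; apply; apply: filterS HB => n HBn.
  have iNn := bounded_integrable (P_ n) (mhk N _ (mf_ n)) (hkb N _).
  rewrite -lee_fin /Rintegral fineK; last exact: integrable_fin_num iNn.
  apply: le_trans HBn; apply: ge0_le_integral => //.
  - by move=> x _; rewrite lee_fin mulr_ge0.
  - by apply/measurable_EFinP; exact: mhk.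
  - apply/measurable_EFinP; apply: measurable_funM => //.
    exact: measurableT_comp.
  - by move=> x _; rewrite lee_fin ler_pM// ge_min lexx.
have limE x : limn (fun N => (hN N x * kN N (f x))%:E) = (h x * k (f x))%:E.
  apply/cvg_lim => //; apply: cvg_near_cst; near=> N; congr (_ * _)%:E.
    by apply/min_idPl; near: N; exact: nbhs_infty_ger.
  by apply/min_idPl; near: N; exact: nbhs_infty_ger.
rewrite -(eq_integral _ _ (fun x _ => limE x)).
have cvm : (\int[P]_x (hN N x * kN N (f x))%:E @[N --> \oo] -->
    \int[P]_x limn (fun N => (hN N x * kN N (f x))%:E))%E.
  apply: cvg_monotone_convergence => // [N|N x _|x _ N N' NN'].
  - by apply/measurable_EFinP; exact: mhk.
  - by rewrite lee_fin mulr_ge0.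
  - by rewrite lee_fin ler_pM// le_min !ge_min lexx/= ler_nat NN' orbT.
by apply: (cvge_to_le cvm); exact: nearW.
Unshelve. all: by end_near. Qed.

End approx_fatou.

Lemma approx_cvg_integrable (R : realType) d (T : topMeasurableType d)
    (cm : @continuous_measurable R d T)
    (P_ : nat -> probability T R) (P : probability T R)
    (f_ : nat -> T -> R) (f : T -> R) (B : R) :
  weak_cvg P_ P -> (forall n, (P_ n).-integrable setT (EFin \o f_ n)) ->
  (forall n, \int[P_ n]_x `|f_ n x| <= B) ->
  measurable_fun setT f -> approx_cvg P_ P f_ f ->
  P.-integrable setT (EFin \o f).
Proof.
move=> P_cvg intf fB mf f_cvg.
have mf_ n : measurable_fun setT (f_ n) by apply/measurable_EFinP; exact: measurable_int (intf n).
apply/integrableP; split; first exact/measurable_EFinP.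
apply: (@le_lt_trans _ _ B%:E); last exact: ltry.
have c1 : continuous (cst 1 : T -> R) by move=> x; exact: cvg_cst.
have cn : continuous (fun t : R => `|t|) by move=> t; exact: norm_continuous.
rewrite (eq_integral (fun x => (cst 1 x * `|f x|)%:E)) => [|x _]; last by rewrite mul1r.
apply: (approx_cvg_fatou cm P_cvg mf_ mf f_cvg (tight_seq_of_Rintegral intf fB) c1 cn) => //.
apply: nearW => n; rewrite (eq_integral (fun x => `|f_ n x|%:E)) => [|x _]; last by rewrite mul1r.
have := fB n; rewrite -lee_fin; apply: le_trans.
rewrite /Rintegral fineK//; apply: integrable_fin_num => //.
exact: (integrable_abse (intf n)).
Qed.

(** Composition with [p] carries bounded continuous functions on [Z] to such functions on [T], and
    their integrals determine a Borel probability. *)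
Lemma weak_cvg_marginal (R : realType) d (T : topMeasurableType d) (Z : polishType R)
    (p : T -> borel Z) (P_ : nat -> probability T R) (P : probability T R)
    (Q_ : nat -> probability (borel Z) R) (Q : probability (borel Z) R) :
  measurable_fun setT p -> continuous p -> weak_cvg P_ P -> weak_cvg Q_ Q ->
  (forall n A, measurable A -> pushforward (P_ n) p A = Q_ n A) ->
  forall A, measurable A -> pushforward P p A = Q A.
Proof.
move=> mp cp P_cvg Q_cvg PQ.
pose p' : {mfun T >-> borel Z} := HB.pack p (isMeasurableFun.Build _ _ _ _ _ mp).
apply: (probability_borel_unique (P := distribution P p')) => h ch h01.
have mh : measurable_fun setT (h : borel Z -> R) by exact: continuous_measurable_borel.
have bh x : `|h x| <= 1 by have /andP[? ?] := h01 x; rewrite ger0_norm.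
have chp : continuous (fun z => h (p z)).
  by move=> z; apply: (@continuous_comp _ _ _ p h); [exact: cp|exact: ch].
have -> : \int[distribution P p']_x h x = \int[P]_z h (p z).
  congr fine; symmetry.
  apply: (pushforward_integral mp (Q := distribution P p') (fun _ _ => erefl)
    (h := fun x => (h x)%:E)).
  exact/measurable_EFinP.
apply: (cvg_unique _ (P_cvg _ chp (bounded_fun_le (fun z => bh (p z))))) => //.
rewrite (_ : (fun n => \int[P_ n]_z h (p z)) = fun n => \int[Q_ n]_x h x).
  exact: (Q_cvg h ch (bounded_fun_le bh)).
apply/funext => n; congr fine.
by apply: (pushforward_integral mp (PQ n) (h := fun x => (h x)%:E)); exact/measurable_EFinP.
Qed.

Section eot_data.
Context (R : realType) (X Y : polishType R) (c : X * Y -> R).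

(** Optimality is replaced by marginals, density and L^1 bounds: conditions that are inherited by
    subsequences and usable in the limit. *)
Definition eot_data
    (mu_ : nat -> probability (borel X) R) (nu_ : nat -> probability (borel Y) R)
    (f_ : nat -> {mfun borel X >-> R}) (g_ : nat -> {mfun borel Y >-> R})
    (pi_ : nat -> probability (borel X * borel Y)%type R) (B : R) : Prop :=
  forall n,
  [/\ coupling (mu_ n) (nu_ n) (pi_ n) /\
      has_density (pi_ n) (mu_ n \x nu_ n)%E (gibbs_density c (f_ n) (g_ n)),
      (mu_ n).-integrable setT (EFin \o f_ n),
      (nu_ n).-integrable setT (EFin \o g_ n),
      \int[mu_ n]_x `|f_ n x| <= B & \int[nu_ n]_y `|g_ n y| <= B].

Lemma eot_data_subseq mu_ nu_ f_ g_ pi_ B (phi : nat -> nat) :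
  eot_data mu_ nu_ f_ g_ pi_ B ->
  eot_data (mu_ \o phi) (nu_ \o phi) (f_ \o phi) (g_ \o phi) (pi_ \o phi) B.
Proof. by move=> data n; exact: data. Qed.

End eot_data.

Section limit_potentials.
Context (R : realType) (X Y : polishType R) (c : X * Y -> R).
Hypotheses (c_ge0 : forall z, 0 <= c z) (c_cont : continuous c).
Context (mu_ : nat -> probability (borel X) R) (mu : probability (borel X) R)
  (nu_ : nat -> probability (borel Y) R) (nu : probability (borel Y) R)
  (mu_cvg : weak_cvg mu_ mu) (nu_cvg : weak_cvg nu_ nu)
  (f_ : nat -> {mfun borel X >-> R}) (g_ : nat -> {mfun borel Y >-> R})
  (f : {mfun borel X >-> R}) (g : {mfun borel Y >-> R})
  (pi_ : nat -> probability (borel X * borel Y)%type R) (B : R)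
  (data : eot_data c mu_ nu_ f_ g_ pi_ B)
  (f_cvg : approx_cvg mu_ mu (fun n => f_ n) f)
  (g_cvg : approx_cvg nu_ nu (fun n => g_ n) g).

Let intf n : (mu_ n).-integrable setT (EFin \o f_ n). Proof. by have [] := data n. Qed.
Let intg n : (nu_ n).-integrable setT (EFin \o g_ n). Proof. by have [] := data n. Qed.
Let fB n : \int[mu_ n]_x `|f_ n x| <= B. Proof. by have [] := data n. Qed.
Let gB n : \int[nu_ n]_y `|g_ n y| <= B. Proof. by have [] := data n. Qed.
Let pi_coupling n : coupling (mu_ n) (nu_ n) (pi_ n). Proof. by have [[]] := data n. Qed.
Let pi_dens n : has_density (pi_ n) (mu_ n \x nu_ n)%E (gibbs_density c (f_ n) (g_ n)).
Proof. by have [[]] := data n. Qed.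

Let B0 : 0 <= B.
Proof. by apply: le_trans (fB 0%N); apply: Rintegral_ge0. Qed.

(** As [c] is nonnegative, a density of at least [exp a] forces [f_ n z.1 + g_ n z.2] to be at least
    [a]. Markov's inequality under [pi_ n], whose marginals are [mu_ n] and [nu_ n], bounds the mass
    of this event by [(B + B) / a]. *)
Let pi_tail e : 0 < e -> \forall N \near \oo, forall n,
  (pi_ n [set z | (N%:R <= gibbs_density c (f_ n) (g_ n) z)%R] <= e%:E)%E.
Proof.
move=> e0; pose a := (B + B + 1) / e.
have a0 : 0 < a by rewrite divr_gt0// ltr_wpDl// addr_ge0.
have : \forall N \near \oo, expR a <= N%:R :> R by exact: nbhs_infty_ger.
apply: filterS => N aN n.
have [is_ sE] := coupling_sum_integrable (pi_coupling n) (intf n) (intg n).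
have mfE : measurable_fun setT (EFin \o f_ n) by exact/measurable_EFinP.
have mgE : measurable_fun setT (EFin \o g_ n) by exact/measurable_EFinP.
have is1 := iffLR (coupling_integrable_fst (pi_coupling n) mfE) (intf n).
have is2 := iffLR (coupling_integrable_snd (pi_coupling n) mgE) (intg n).
have is1n : (pi_ n).-integrable setT (EFin \o (fun z : borel X * borel Y => `|f_ n z.1|)).
  exact: (integrable_abse is1).
have is2n : (pi_ n).-integrable setT (EFin \o (fun z : borel X * borel Y => `|g_ n z.2|)).
  exact: (integrable_abse is2).
apply: (@le_trans _ _ (pi_ n [set z | a <= `|f_ n z.1 + g_ n z.2|])).
  apply: le_measure; rewrite ?inE.
  - by apply: measurable_ge_set; case: (pi_dens n).
  - apply: measurable_ge_norm; apply/measurable_EFinP; exact: measurable_int is_.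
  - move=> z /= Nz; have : expR a <= gibbs_density c (f_ n) (g_ n) z by exact: le_trans Nz.
    rewrite ler_expR => az; apply: le_trans (ler_norm _); apply: (le_trans az).
    by rewrite gerBl.
apply: (le_trans (markov_norm a0 is_)); rewrite lee_fin ler_pdivrMr// /a mulrC divfK ?gt_eqF//.
apply: (@le_trans _ _ (\int[pi_ n]_z (`|f_ n z.1| + `|g_ n z.2|))).
  apply: le_Rintegral => //.
  - exact: (integrable_abse is_).
  - exact: integrable_realD is1n is2n.
  - by move=> z _; exact: ler_normD.
rewrite RintegralD//; apply: (@le_trans _ _ (B + B)); last by rewrite lerDl.
apply: lerD.
  rewrite /Rintegral (coupling_integral_fst (pi_coupling n) (h := fun x => `|f_ n x|%:E)).
    exact: fB.
  by apply/measurable_EFinP; exact: measurableT_comp.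
rewrite /Rintegral (coupling_integral_snd (pi_coupling n) (h := fun x => `|g_ n x|%:E)).
  exact: gB.
by apply/measurable_EFinP; exact: measurableT_comp.
Qed.

Lemma limit_potentials_integrable :
  mu.-integrable setT (EFin \o f) /\ nu.-integrable setT (EFin \o g).
Proof.
split; first exact: (approx_cvg_integrable (@borel_continuous_measurable R X) mu_cvg intf fB _ f_cvg).
exact: (approx_cvg_integrable (@borel_continuous_measurable R Y) nu_cvg intg gB _ g_cvg).
Qed.

Let phi_ n (z : borel X * borel Y) : R := f_ n z.1 + g_ n z.2 - c z.
Let phi (z : borel X * borel Y) : R := f z.1 + g z.2 - c z.

Let mphi (f' : {mfun borel X >-> R}) (g' : {mfun borel Y >-> R}) :
  measurable_fun setT (fun z : borel X * borel Y => f' z.1 + g' z.2 - c z).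
Proof. exact: measurable_sum_cost. Qed.

Lemma limit_potentials_phi :
  approx_cvg (fun n => mu_ n \x nu_ n)%E (mu \x nu)%E phi_ phi /\
  tight_seq (fun n => mu_ n \x nu_ n)%E phi_.
Proof.
split.
  exact: (approx_cvg_product c_cont (fun n => measurable_funPT (f_ n)) (fun n => measurable_funPT (g_ n)) f_cvg g_cvg).
exact: (tight_seq_product c_cont (fun n => measurable_funPT (f_ n))
  (fun n => measurable_funPT (g_ n)) mu_cvg nu_cvg
  (tight_seq_of_Rintegral intf fB) (tight_seq_of_Rintegral intg gB)).
Qed.

Lemma limit_potentials : exists pi : probability (borel X * borel Y)%type R,
  [/\ coupling mu nu pi, has_density pi (mu \x nu)%E (gibbs_density c f g) &
      weak_cvg pi_ pi].
Proof.
have [phi_cvg phi_tight] := limit_potentials_phi.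
have rho_cvg := product_weak_cvg mu_cvg nu_cvg.
have [pi [pid pi_cvg]] := density_limit (@prod_continuous_measurable R X Y) rho_cvg (fun n => mphi (f_ n) (g_ n))
  (mphi f g) phi_cvg phi_tight pi_dens pi_tail.
exists pi; split => //; split.
- exact: (weak_cvg_marginal measurable_fst (fun z => cvg_fst) pi_cvg mu_cvg
    (fun n => (pi_coupling n).1)).
- exact: (weak_cvg_marginal measurable_snd (fun z => cvg_snd) pi_cvg nu_cvg
    (fun n => (pi_coupling n).2)).
Qed.

End limit_potentials.

(** * Uniqueness of potentials *)

Lemma ae_exists d (T : measurableType d) (R : realType) (P : probability T R)
    (A : T -> Prop) : {ae P, forall x, A x} -> exists x, A x.
Proof.
move=> [N [mN PN subN]]; apply: contrapT => nA.
have NT : N = setT.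
  by apply/seteqP; split=> // x _; apply: subN => /= Ax; apply: nA; exists x.
have := probability_setT P; rewrite -NT => P1.
by have := oner_neq0 R; rewrite -(eqe (1 : R) 0) -P1 PN eqxx.
Qed.

Lemma ae_product_section d1 d2 (T1 : measurableType d1) (T2 : measurableType d2)
    (R : realType) (P : probability T1 R) (Q : probability T2 R) (A : T1 * T2 -> Prop) :
  {ae (P \x Q)%E, forall z, A z} -> {ae P, forall x, {ae Q, forall y, A (x, y)}}.
Proof.
move=> [N [mN PN subN]].
have mx : measurable_fun setT (Q \o xsection N) by exact: measurable_fun_xsection.
have I0 : (\int[P]_x `|(Q \o xsection N) x| = 0)%E.
  rewrite -[RHS]PN; apply: eq_integral => x _.
  by rewrite gee0_abs.
have /ae_eq_integral_abs : (\int[P]_x `|(Q \o xsection N) x| = 0)%E by [].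
move=> /(_ measurableT mx); apply: filterS => x /(_ I) /= Qx.
exists (xsection N x); split => //; first exact: measurable_xsection.
by move=> y /= nA; apply/xsectionP; apply: subN.
Qed.

Lemma ae_product_fst_inv d1 d2 (T1 : measurableType d1) (T2 : measurableType d2)
    (R : realType) (P : probability T1 R) (Q : probability T2 R) (A : set T1) :
  measurable A -> {ae (P \x Q)%E, forall z, A z.1} -> {ae P, forall x, A x}.
Proof.
move=> mA H; have mC : measurable (~` A) by exact: measurableC.
have mC1 : measurable ((fst : T1 * T2 -> T1) @^-1` (~` A)).
  by rewrite -[X in measurable X]setTI; exact: measurable_fst.
exists (~` A); split => //.
by rewrite -(product_probability_fst P Q mC); apply/negligibleP.
Qed.

Section uniqueness.
Context (R : realType) (X Y : polishType R) (c : X * Y -> R).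
Context (mu : probability (borel X) R) (nu : probability (borel Y) R).
Implicit Types (f : {mfun borel X >-> R}) (g : {mfun borel Y >-> R}).

(** Almost everywhere, a function of [x] equals a function of [y]. Freezing one typical point [x0]
    makes the second constant, and then the first. *)
Lemma potentials_unique (pi : probability (borel X * borel Y)%type R) f1 f2 g1 g2 :
  has_density pi (mu \x nu)%E (gibbs_density c f1 g1) ->
  has_density pi (mu \x nu)%E (gibbs_density c f2 g2) ->
  exists a, {ae mu, forall x, f1 x = f2 x + a} /\ {ae nu, forall y, g1 y = g2 y - a}.
Proof.
move=> d1 d2.
have E : {ae (mu \x nu)%E, forall z, f1 z.1 - f2 z.1 = g2 z.2 - g1 z.2}.
  apply: filterS2 (density_Radon_Nikodym d1) (density_Radon_Nikodym d2) => z -> [].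
  by move=> /expR_inj; lra.
have [x0 Ex0] := ae_exists (ae_product_section E).
exists (f1 x0 - f2 x0); split; last first.
  by apply: filterS Ex0 => y /=; lra.
have : {ae (mu \x nu)%E, forall z, f1 z.1 - f2 z.1 = f1 x0 - f2 x0}.
  by apply: filterS2 E (ae_product_snd mu Ex0) => z /= -> ->.
move=> H; have : {ae mu, forall x, f1 x - f2 x = f1 x0 - f2 x0}.
  apply: (ae_product_fst_inv (A := [set x | f1 x - f2 x = f1 x0 - f2 x0])) H.
  have m12 : measurable_fun setT (fun x => f1 x - f2 x) by exact: measurable_funB.
  rewrite -[X in measurable X]setTI.
  rewrite (_ : [set x | _] = (fun x => f1 x - f2 x) @^-1` [set (f1 x0 - f2 x0)]).
    exact: m12.
  by apply/seteqP; split=> x.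
by apply: filterS => x; lra.
Qed.

(** The arctangent is strictly increasing, so a positive shift increases its integral strictly; its
    boundedness makes these integrals finite for arbitrary measurable functions. *)
Lemma atan_normalization d (T : measurableType d) (P : probability T R)
    (u v : T -> R) (a : R) : measurable_fun setT u -> measurable_fun setT v ->
  {ae P, forall x, u x = v x + a} ->
  \int[P]_x atan (u x) = \int[P]_x atan (v x) -> a = 0.
Proof.
suff wl (u' v' : T -> R) b : measurable_fun setT u' -> measurable_fun setT v' ->
    {ae P, forall x, u' x = v' x + b} ->
    \int[P]_x atan (u' x) = \int[P]_x atan (v' x) -> b <= 0.
  move=> mu' mv' uv Iuv; apply/le_anti/andP; split; first exact: (wl u v).
  rewrite -oppr_le0; apply: (wl v u) => //.
  by apply: filterS uv => x ->; rewrite addrK.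
move=> mu' mv' uv Iuv; rewrite leNgt; apply/negP => b0.
have matan : measurable_fun setT (@atan R).
  by apply: continuous_measurable_fun => t; exact: continuous_atan.
have ba (t : R) : `|atan t| <= pi / 2.
  by rewrite ler_norml !ltW ?atan_gtNpi2 ?atan_ltpi2.
have mau : measurable_fun setT (fun x => atan (u' x)) by exact: measurableT_comp.
have mav : measurable_fun setT (fun x => atan (v' x)) by exact: measurableT_comp.
have mavb : measurable_fun setT (fun x => atan (v' x + b)).
  by apply: measurableT_comp => //; exact: measurable_funD.
have iav := bounded_integrable P mav (fun x => ba _).
have iavb := bounded_integrable P mavb (fun x => ba _).
have Ib : \int[P]_x (atan (v' x + b) - atan (v' x)) <= 0.
  rewrite RintegralB// -Iuv subr_le0 le_eqVlt (ae_eq_Rintegral mavb mau) ?eqxx//.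
  by apply: filterS uv => x ->.
have H := Rintegral_ge0_eq0 (integrable_realB iavb iav) _ Ib.
have [|x /eqP] := ae_exists (H _).
  by move=> x; rewrite subr_ge0 ltW// lt_atan// ltrDl.
by rewrite gt_eqF// subr_gt0 lt_atan// ltrDl.
Qed.

End uniqueness.

(** * Subsequential limits of potentials *)

(** Both orders of integration are recorded, one for each of the two potentials. *)
Lemma product_rect_integral d1 d2 (T1 : measurableType d1) (T2 : measurableType d2)
    (R : realType) (P : probability T1 R) (Q : probability T2 R) (q : T1 * T2 -> R)
    (A : set T1) (B : set T2) : measurable A -> measurable B ->
  measurable_fun setT q -> (forall z, 0 <= q z) ->
  (\int[(P \x Q)%E]_(z in A `*` B) (q z)%:E =
     \int[P]_(x in A) \int[Q]_(y in B) (q (x, y))%:E)%E /\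
  (\int[(P \x Q)%E]_(z in A `*` B) (q z)%:E =
     \int[Q]_(y in B) \int[P]_(x in A) (q (x, y))%:E)%E.
Proof.
move=> mA mB mq q0.
have mAB : measurable (A `*` B) by exact: measurableX.
pose h := (fun z => (q z)%:E) \_ (A `*` B).
have mh : measurable_fun setT h.
  by apply/(measurable_restrictT _ mAB); apply/measurable_funTS/measurable_EFinP.
have h0 z : (0 <= h z)%E by rewrite /h patchE; case: ifP => // _; rewrite lee_fin.
split; rewrite integral_mkcond -/h.
  rewrite (fubini_tonelli1 h mh h0) [RHS]integral_mkcond; apply: eq_integral => x _.
  rewrite /fubini_F patchE; case: ifPn => [|/negP] xA.
    rewrite [RHS]integral_mkcond; apply: eq_integral => y _.
    by rewrite /h !patchE in_setX xA.
  rewrite integral0_eq// => y _; rewrite /h patchE in_setX.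
  by case: (x \in A) xA.
rewrite (fubini_tonelli2 h mh h0) [RHS]integral_mkcond; apply: eq_integral => y _.
rewrite /fubini_G patchE; case: ifPn => [|/negP] yB.
  rewrite [RHS]integral_mkcond; apply: eq_integral => x _.
  by rewrite /h !patchE in_setX yB andbT.
rewrite integral0_eq// => x _; rewrite /h patchE in_setX.
by case: (y \in B) yB; rewrite ?andbF.
Qed.

Section pushforward_setI.
Context d d1 d2 (T : measurableType d) (T1 : measurableType d1) (T2 : measurableType d2)
  (R : realType) (P : probability T R) (P1 : probability T1 R) (P2 : probability T2 R)
  (p : T -> T1) (q : T -> T2).
Hypotheses (mp : measurable_fun setT p) (mq : measurable_fun setT q)
  (p1 : forall A, measurable A -> pushforward P p A = P1 A)
  (q2 : forall B, measurable B -> pushforward P q B = P2 B).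

Let mpre d' (T' : measurableType d') (r : T -> T') A :
  measurable_fun setT r -> measurable A -> measurable (r @^-1` A).
Proof. by move=> mr mA; rewrite -[X in measurable X]setTI; exact: mr. Qed.

(** [p] and [q] are arbitrary maps so that the two projections can be used in either order. *)
Lemma pushforward_setI_le A B : measurable A -> measurable B ->
  (P (p @^-1` A `&` q @^-1` B) <= P1 A)%E.
Proof.
move=> mA mB; rewrite -p1// /pushforward; apply: le_measure; rewrite ?inE.
- by apply: measurableI; exact: mpre.
- exact: mpre.
- by move=> z [].
Qed.

Lemma pushforward_setI_ge A B : measurable A -> measurable B ->
  (P1 A <= P (p @^-1` A `&` q @^-1` B) + P2 (~` B))%E.
Proof.
move=> mA mB; have mC := measurableC mB; rewrite -p1// -q2// /pushforward.
have mI : measurable (p @^-1` A `&` q @^-1` B) by apply: measurableI; exact: mpre.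
have mN : measurable (q @^-1` (~` B)) by exact: mpre.
apply: le_trans (measureU2 P mI mN); apply: le_measure; rewrite ?inE.
- exact: mpre.
- exact: measurableU.
- by move=> z Az; have [Bz|Bz] := pselect (B (q z)); [left|right].
Qed.

End pushforward_setI.

Section approximation.
Context (R : realType) (X Y : polishType R) (c : X * Y -> R).
Hypotheses (c_ge0 : forall z, 0 <= c z) (c_cont : continuous c).

Context (mu_ : nat -> probability (borel X) R) (mu : probability (borel X) R)
  (nu_ : nat -> probability (borel Y) R) (nu : probability (borel Y) R)
  (mu_cvg : weak_cvg mu_ mu) (nu_cvg : weak_cvg nu_ nu)
  (f_ : nat -> {mfun borel X >-> R}) (g_ : nat -> {mfun borel Y >-> R})
  (pi_ : nat -> probability (borel X * borel Y)%type R) (B : R)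
  (data : eot_data c mu_ nu_ f_ g_ pi_ B).

Let pi_rect n A K : measurable A -> measurable K ->
  pi_ n (A `*` K) = (\int[mu_ n]_(x in A) \int[nu_ n]_(y in K)
         (expR (f_ n x + g_ n y - c (x, y)))%:E)%E /\
  pi_ n (A `*` K) = (\int[nu_ n]_(y in K) \int[mu_ n]_(x in A)
         (expR (f_ n x + g_ n y - c (x, y)))%:E)%E.
Proof.
move=> mA mK; have [[_ [mq q0 qE]] _ _ _ _] := data n.
rewrite qE; last exact: measurableX.
have [E1 E2] := product_rect_integral (mu_ n) (nu_ n) mA mK mq q0.
by split; [rewrite E1|rewrite E2].
Qed.

Let pi1 n A : measurable A -> pushforward (pi_ n) fst A = mu_ n A.
Proof. by have [[[+ _] _] _ _ _ _] := data n; apply. Qed.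

Let pi2 n A : measurable A -> pushforward (pi_ n) snd A = nu_ n A.
Proof. by have [[[_ +] _] _ _ _ _] := data n; apply. Qed.

Let f_tight : tight_seq mu_ (fun n => f_ n).
Proof. by apply: (@tight_seq_of_Rintegral _ _ _ _ _ B) => n; have [] := data n. Qed.

Let g_tight : tight_seq nu_ (fun n => g_ n).
Proof. by apply: (@tight_seq_of_Rintegral _ _ _ _ _ B) => n; have [] := data n. Qed.

Lemma approximation_fst (e d : R) : 0 < e -> 0 < d ->
  exists F : nat -> X -> R, [/\ equicontinuous_seq F,
    forall x, exists M, forall n, `|F n x| <= M &
    forall n, (mu_ n [set x | (e <= `|f_ n x - F n x|)%R] <= d%:E)%E].
Proof.
apply: (side_approximation c_ge0 c_cont mu_cvg nu_cvg (fun n => measurable_funPT (f_ n))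
  (fun n => measurable_funPT (g_ n)) f_tight g_tight) => n A K mA mK.
  by rewrite -(pi_rect n mA mK).1; exact: (pushforward_setI_le measurable_fst measurable_snd (pi1 n)).
rewrite -(pi_rect n mA mK).1.
exact: (pushforward_setI_ge measurable_fst measurable_snd (pi1 n) (pi2 n)).
Qed.

Lemma approximation_snd (e d : R) : 0 < e -> 0 < d ->
  exists G : nat -> Y -> R, [/\ equicontinuous_seq G,
    forall y, exists M, forall n, `|G n y| <= M &
    forall n, (nu_ n [set y | (e <= `|g_ n y - G n y|)%R] <= d%:E)%E].
Proof.
(* Exchanging the coordinates reduces the second potential to the first; the cost stays continuous
   and nonnegative. *)
pose c' (z : Y * X) := c (z.2, z.1).
have c'_cont : continuous c'.
  move=> z; apply: (@continuous_comp _ _ _ (fun z => (z.2, z.1)) c); last exact: c_cont.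
  by apply: cvg_pair; [exact: cvg_snd|exact: cvg_fst].
apply: (@side_approximation R Y X c' (fun z => c_ge0 _) c'_cont nu_ nu mu_ mu nu_cvg mu_cvg
  (fun n => g_ n) (fun n => f_ n) (fun n => measurable_funPT (g_ n))
  (fun n => measurable_funPT (f_ n)) g_tight f_tight) => n K A mK mA.
  under eq_integral do under eq_integral do rewrite [X in expR (X - _)]addrC.
  rewrite -(pi_rect n mA mK).2 [_ `*` _]setIC.
  exact: (pushforward_setI_le measurable_snd measurable_fst (pi2 n)).
under eq_integral do under eq_integral do rewrite [X in expR (X - _)]addrC.
rewrite -(pi_rect n mA mK).2 [_ `*` _]setIC.
exact: (pushforward_setI_ge measurable_snd measurable_fst (pi2 n) (pi1 n)).
Qed.

End approximation.

(** The mass and approximation bounds hold for every [n], because (c) takes a supremum over all [n];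
    only the limits run along [phi]. *)
Record subsequential_limit (R : realType) (X : polishType R)
    (mu_ : nat -> probability (borel X) R) (mu : probability (borel X) R)
    (f_ : nat -> {mfun borel X >-> R}) (eps : nat -> R) (phi : nat -> nat)
    (K : nat -> set X) (F : nat -> nat -> X -> R) (G : nat -> X -> R)
    (f : {mfun borel X >-> R}) : Prop := {
  subl_compact : forall k, compact (K k) ;
  subl_tight : forall k n, (mu_ n (~` K k : set (borel X)) <= (dyad R k)%:E)%E ;
  subl_tight_lim : forall k, (mu (~` K k : set (borel X)) <= (dyad R k)%:E)%E ;
  subl_equicontinuous : forall k, equicontinuous_seq (F k) ;
  subl_approx : forall k n,
    (mu_ n [set x | (eps k <= `|f_ n x - F k n x|)%R] <= (dyad R k)%:E)%E ;
  subl_cvg : forall k x, F k (phi l) x @[l --> \oo] --> G k x ;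
  subl_ae : {ae mu, forall x, G k x @[k --> \oo] --> f x} ;
  subl_approx_cvg : approx_cvg (mu_ \o phi) mu (fun l => f_ (phi l)) f }.

Lemma le_measure_ge_norm (R : realType) d (T : measurableType d) (P : probability T R)
    (h : T -> R) (a b : R) : measurable_fun setT h -> a <= b ->
  (P [set x | (b <= `|h x|)%R] <= P [set x | (a <= `|h x|)%R])%E.
Proof.
move=> mh ab; apply: le_measure; rewrite ?inE; [exact: measurable_ge_norm..|].
by move=> x /=; exact: le_trans.
Qed.

Section subsequential_limits.
Context (R : realType) (X : polishType R).
Context (mu_ : nat -> probability (borel X) R) (mu : probability (borel X) R)
  (mu_cvg : weak_cvg mu_ mu) (f_ : nat -> {mfun borel X >-> R}).
Hypothesis approximation : forall e d : R, 0 < e -> 0 < d ->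
  exists F : nat -> X -> R, [/\ equicontinuous_seq F,
    forall x, exists M, forall n, `|F n x| <= M &
    forall n, (mu_ n [set x | (e <= `|f_ n x - F n x|)%R] <= d%:E)%E].

(* Convergence along [psi1 \o psi2] for every [psi2] lets the second marginal
   refine the subsequence chosen for the first one. *)
Lemma subsequential_limit_exists (eps : nat -> R) (psi : nat -> nat) :
  increasing_seq psi -> (forall k, 0 < eps k) ->
  exists psi1, increasing_seq psi1 /\ exists K F G f,
    forall psi2, increasing_seq psi2 ->
      subsequential_limit mu_ mu f_ eps (psi \o psi1 \o psi2) K F G f.
Proof.
move=> psi_incr eps0.
(* Accuracy [eps k] is what (c) demands; accuracy [dyad R k] makes the increments in [k] summable,
   whatever the rate of [eps]. *)
have d0 k : 0 < Num.min (eps k) (dyad R k) by rewrite lt_min eps0 dyad_gt0.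
have [F FP] := choice (fun k => approximation (d0 k) (dyad_gt0 R k)).
have [K KP] := choice (fun k => weak_cvg_tight mu_cvg (dyad_gt0 R k)).
have Feq k : equicontinuous_seq (F k) by have [] := FP k.
have mF k n : measurable_fun setT (F k n : borel X -> R).
  by apply: continuous_measurable_borel; exact: equicontinuous_seq_continuous (Feq k) n.
have [||psi1 [psi1_incr [G FG]]] := @equicontinuous_extraction R X (fun k => F k \o psi).
- by move=> k; exact: equicontinuous_subseq.
- by move=> k x; have [_ /(_ x)[M HM] _] := FP k; exists M => n; exact: HM.
exists psi1; split => //.
have psi01_incr := increasing_seq_comp psi_incr psi1_incr.
have mfF k n : measurable_fun setT (fun x => f_ n x - F k n x) by exact: measurable_funB.
have Fdyad k n : (mu_ n [set x | (dyad R k <= `|f_ n x - F k n x|)%R] <= (dyad R k)%:E)%E.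
  have [_ _ /(_ n)] := FP k; apply: le_trans.
  by apply: (le_measure_ge_norm _ (mfF k n)); rewrite ge_min lexx orbT.
have lim (psi2 : nat -> nat) : increasing_seq psi2 -> exists f : {mfun borel X >-> R},
    {ae mu, forall x, G k x @[k --> \oo] --> f x} /\
    approx_cvg (mu_ \o (psi \o psi1 \o psi2)) mu (fun l => f_ ((psi \o psi1 \o psi2) l)) f.
  move=> psi2_incr; have psi_i := increasing_seq_comp psi01_incr psi2_incr.
  apply: (@side_limit _ _ _ _ (weak_cvg_subseq psi_i mu_cvg)
    (fun l => f_ ((psi \o psi1 \o psi2) l)) _ K (fun k => F k \o (psi \o psi1 \o psi2)) G) => //.
  - by move=> k; have [] := KP k.
  - by move=> k n; have [_ H _] := KP k; exact: H.
  - by move=> k; exact: equicontinuous_subseq.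
  - by move=> k n; exact: Fdyad.
  - by move=> k x; exact: (cvg_comp _ _ (increasing_seq_cvg psi2_incr) (FG k x)).
have [f [Gf _]] := lim id (fun _ _ => erefl).
exists K, F, G, f => psi2 psi2_incr; split => //.
- by move=> k; have [] := KP k.
- by move=> k n; have [_ H _] := KP k; exact: H.
- by move=> k; have [] := KP k.
- move=> k n; have [_ _ /(_ n)] := FP k; apply: le_trans.
  by apply: (le_measure_ge_norm _ (mfF k n)); rewrite ge_min lexx.
- by move=> k x; exact: (cvg_comp _ _ (increasing_seq_cvg psi2_incr) (FG k x)).
(* The refined subsequence produces a limit [f'] of its own, but both [f] and [f'] are almost
   everywhere limits of the same functions [G k]. *)
- have [f' [Gf' [H [cH Hf' Hap]]]] := lim psi2 psi2_incr.
  have ff' : {ae mu, forall x, f' x = f x}.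
    apply: (negligibleS _ (negligibleU Gf Gf')) => x /= nff'.
    apply: contrapT => /not_orP[/contrapT Gfx /contrapT Gf'x]; apply: nff'.
    exact: (cvg_unique _ Gf'x Gfx).
  exists H; split => //; apply: (negligibleS _ (negligibleU ff' Hf')) => x /= nHf.
  apply: contrapT => /not_orP[/contrapT ffx /contrapT Hfx]; apply: nHf.
  by rewrite -ffx.
Qed.

End subsequential_limits.

(** * Convergence of the optimal values *)

(* Fatou's lemma for the nonnegative part of [C - f_ n]. *)
Lemma uniformly_integrable_limit_le (R : realType) d (T : topMeasurableType d)
    (cm : @continuous_measurable R d T)
    (P_ : nat -> probability T R) (P : probability T R)
    (f_ : nat -> T -> R) (f : T -> R) (B p : R) :
  weak_cvg P_ P -> (forall n, (P_ n).-integrable setT (EFin \o f_ n)) ->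
  (forall n, \int[P_ n]_x `|f_ n x| <= B) ->
  P.-integrable setT (EFin \o f) -> approx_cvg P_ P f_ f ->
  (forall e, 0 < e -> exists2 C, 0 <= C & forall n,
     (\int[P_ n]_(x in [set x | (C < f_ n x)%R]) (f_ n x)%:E <= e%:E)%E) ->
  \int[P_ n]_x f_ n x @[n --> \oo] --> p -> p <= \int[P]_x f x.
Proof.
move=> P_cvg intf fB intF f_cvg ui fp.
have mf_ n : measurable_fun setT (f_ n) by apply/measurable_EFinP; exact: measurable_int (intf n).
have mf : measurable_fun setT f by apply/measurable_EFinP; exact: measurable_int intF.
apply/ler_addgt0Pl => e e0; have e2 : 0 < e / 2 by rewrite divr_gt0.
have [C C0 uiC] := ui _ e2.
pose k t : R := Num.max (C - t) 0.
have ck : continuous k.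
  move=> t; apply: (@continuous_max R R (fun t => C - t) (cst 0) t); last exact: cvg_cst.
  by apply: cvgB; [exact: cvg_cst|exact: cvg_id].
have k0 t : 0 <= k t by rewrite le_max lexx orbT.
have c1 : continuous (cst 1 : T -> R) by move=> x; exact: cvg_cst.
have mk : measurable_fun setT k by exact: continuous_measurable_fun.
have iC (Q : probability T R) : Q.-integrable setT (EFin \o cst C).
  exact: (@bounded_integrable _ _ _ _ _ `|C|).
have cE (Q : probability T R) : \int[Q]_x cst C x = C by exact: Rintegral_cst_probability.
have ik (Q : probability T R) (u : T -> R) : Q.-integrable setT (EFin \o u) ->
    Q.-integrable setT (EFin \o (fun x => k (u x))).
  move=> iu; have mu : measurable_fun setT u by apply/measurable_EFinP; exact: measurable_int iu.
  apply: le_integrable (integrable_realB (iC Q) iu) => //.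
    by apply/measurable_EFinP; exact: measurableT_comp.
  move=> x _; rewrite lee_fin/= ger0_norm//.
  by rewrite /k ge_max normr_ge0 andbT ler_norm.
have kE (Q : probability T R) (u : T -> R) : Q.-integrable setT (EFin \o u) ->
    (\int[Q]_x (cst 1 x * k (u x))%:E = (\int[Q]_x k (u x))%:E)%E.
  move=> iu; rewrite /Rintegral fineK; last exact: integrable_fin_num (ik _ _ iu).
  by apply: eq_integral => x _; rewrite mul1r.
have : (\int[P]_x (cst 1 x * k (f x))%:E <= (C - p + e)%:E)%E.
  apply: (approx_cvg_fatou cm P_cvg mf_ mf f_cvg (tight_seq_of_Rintegral intf fB) c1 ck) => //.
  have /cvgrPdist_le/(_ _ e2) := fp; apply: filterS => n.
  rewrite (kE _ _ (intf n)) lee_fin ler_norml => /andP[_ pn].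
  pose t x : R := f_ n x * \1_[set x | C < f_ n x] x.
  have mA : measurable [set x | C < f_ n x].
    rewrite -[X in measurable X]setTI.
    have -> : [set x | C < f_ n x] = f_ n @^-1` `]C, +oo[%classic.
      by apply/seteqP; split=> x /=; rewrite in_itv/= andbT.
    exact: mf_.
  have it : (P_ n).-integrable setT (EFin \o t).
    apply: le_integrable (intf n) => //.
      apply/measurable_EFinP; apply: measurable_funM => //; exact: measurable_indic.
    move=> x _; rewrite lee_fin/= /t indicE; case: (_ \in _); rewrite ?mulr1//.
    by rewrite mulr0 normr0.
  have tE : \int[P_ n]_x t x <= e / 2.
    have := uiC n; rewrite -lee_fin; apply: le_trans.
    rewrite /Rintegral fineK; last exact: integrable_fin_num it.
    rewrite [leRHS]integral_mkcond le_eqVlt; apply/orP; left; apply/eqP.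
    apply: eq_integral => x _; rewrite patchE /t indicE.
    by case: ifP => _; rewrite ?mulr1 ?mulr0.
  (* Where [f_ n] exceeds [C], the left integrand is 0 and the right one is [C], so the sign of [C]
     matters. *)
  have : \int[P_ n]_x k (f_ n x) <= \int[P_ n]_x (cst C x - f_ n x + t x).
    apply: le_Rintegral => //; first exact: ik.
      by apply: integrable_realD => //; exact: integrable_realB.
    move=> x _; rewrite /t indicE ge_max.
    have [Cf|fC] := ltP C (f_ n x).
      by rewrite mem_set// mulr1 /=; apply/andP; split; lra.
    rewrite memNset/= ?mulr0; last by rewrite ltNge fC.
    by rewrite addr0 lexx/= subr_ge0.
  have -> : \int[P_ n]_x (cst C x - f_ n x + t x) =
      C - \int[P_ n]_x f_ n x + \int[P_ n]_x t x.
    rewrite RintegralD//; last exact: integrable_realB.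
    by rewrite (RintegralB _ (iC _) (intf n))// (cE (P_ n)).
  lra.
rewrite (kE _ _ intF) lee_fin.
have : \int[P]_x (cst C x - f x) <= \int[P]_x k (f x).
  apply: le_Rintegral => //; [exact: integrable_realB|exact: ik|].
  by move=> x _; rewrite le_max lexx.
rewrite (RintegralB _ (iC _) intF)// (cE P); lra.
Qed.

Lemma approx_cvg_subseq (R : realType) d (T : topMeasurableType d)
    (P_ : nat -> probability T R) (P : probability T R)
    (f_ : nat -> T -> R) (f : T -> R) (phi : nat -> nat) :
  increasing_seq phi -> approx_cvg P_ P f_ f ->
  approx_cvg (P_ \o phi) P (f_ \o phi) f.
Proof.
move=> phi_incr [F [cF Ff FP]]; exists F; split => // e e0.
apply: filterS (FP e e0) => k; exact: (increasing_seq_cvg phi_incr).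
Qed.

Section limit_values.
Context (R : realType) (X Y : polishType R) (c : X * Y -> R).
Hypotheses (c_ge0 : forall z, 0 <= c z) (c_cont : continuous c).
Context (mu_ : nat -> probability (borel X) R) (mu : probability (borel X) R)
  (nu_ : nat -> probability (borel Y) R) (nu : probability (borel Y) R)
  (mu_cvg : weak_cvg mu_ mu) (nu_cvg : weak_cvg nu_ nu)
  (f_ : nat -> {mfun borel X >-> R}) (g_ : nat -> {mfun borel Y >-> R})
  (f : {mfun borel X >-> R}) (g : {mfun borel Y >-> R})
  (pi_ : nat -> probability (borel X * borel Y)%type R)
  (pi : probability (borel X * borel Y)%type R) (B : R)
  (data : eot_data c mu_ nu_ f_ g_ pi_ B)
  (f_cvg : approx_cvg mu_ mu (fun n => f_ n) f)
  (g_cvg : approx_cvg nu_ nu (fun n => g_ n) g)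
  (pic : coupling mu nu pi)
  (pid : has_density pi (mu \x nu)%E (gibbs_density c f g))
  (intf : mu.-integrable setT (EFin \o f)) (intg : nu.-integrable setT (EFin \o g)).

Let mc : measurable_fun setT (c : borel X * borel Y -> R).
Proof. exact: (@continuous_measurable_prod R X Y c). Qed.

(** Transport cost [a] and entropy [b] are written against the product measure in the form
    [h * k phi] that [approx_cvg_fatou] accepts: [k] is [exp] for the cost and [t * exp t + 1] for
    the entropy, the added 1 making it nonnegative. *)
Lemma gibbs_cost_split (mu' : probability (borel X) R) (nu' : probability (borel Y) R)
    (f' : {mfun borel X >-> R}) (g' : {mfun borel Y >-> R})
    (pi' : probability (borel X * borel Y)%type R) :
  coupling mu' nu' pi' -> has_density pi' (mu' \x nu')%E (gibbs_density c f' g') ->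
  mu'.-integrable setT (EFin \o f') -> nu'.-integrable setT (EFin \o g') ->
  exists a b, [/\ 0 <= a, 0 <= b,
    a + b = \int[mu']_x f' x + \int[nu']_y g' y,
    (\int[(mu' \x nu')%E]_z (c z * expR (f' z.1 + g' z.2 - c z))%:E = a%:E)%E &
    (\int[(mu' \x nu')%E]_z (cst 1 z * ((f' z.1 + g' z.2 - c z) *
       expR (f' z.1 + g' z.2 - c z) + 1))%:E = (b + 1)%:E)%E].
Proof.
move=> pic' pid' intf' intg'.
have [[val_fin _ costE] valE _] := gibbs_optimal c_ge0 c_cont pic' pid' intf' intg'.
have fin : (\int[pi']_z (c z)%:E + relative_entropy pi' (mu' \x nu') < +oo)%E.
  by rewrite -[X in (X < _)%E]/(eot_cost c mu' nu' pi') costE.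
have [ic il cost_split] := @entropic_cost_integrable _ _ _ (mu' \x nu')%E c c_ge0 mc pi' _ pid' fin.
have lnE z : ln (gibbs_density c f' g' z) = f' z.1 + g' z.2 - c z by rewrite expRK.
have [mq _ _] := pid'.
have mphi : measurable_fun setT (fun z : borel X * borel Y => f' z.1 + g' z.2 - c z).
  exact: measurable_sum_cost.
exists (\int[pi']_z c z), (\int[pi']_z ln (gibbs_density c f' g' z)); split.
- by apply: Rintegral_ge0.
- rewrite -lee_fin /Rintegral fineK; last exact: integrable_fin_num il.
  by rewrite -(relative_entropyE pid') relative_entropy_ge0.
- by apply: EFin_inj; rewrite -cost_split -valE -costE.
- rewrite /Rintegral fineK; last exact: integrable_fin_num ic.
  by rewrite (density_integral pid')//; exact/measurable_EFinP.
- have E1 : (\int[(mu' \x nu')%E]_z ((f' z.1 + g' z.2 - c z) *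
       expR (f' z.1 + g' z.2 - c z))%:E = (\int[pi']_z ln (gibbs_density c f' g' z))%:E)%E.
    rewrite /Rintegral fineK; last exact: integrable_fin_num il.
    rewrite (density_integral pid'); last exact: measurable_int il.
    by apply: eq_integral => z _; rewrite lnE.
  have ie : (mu' \x nu')%E.-integrable setT (EFin \o (fun z : borel X * borel Y =>
      (f' z.1 + g' z.2 - c z) * expR (f' z.1 + g' z.2 - c z))).
    apply/integrableP; split; first by apply/measurable_EFinP; exact: measurable_funM.
    have /integrableP[ml] := il; rewrite (density_integral pid'); last exact: measurableT_comp.
    apply: le_lt_trans; rewrite le_eqVlt; apply/orP; left; apply/eqP.
    by apply: eq_integral => z _ /=; rewrite normrM lnE [`|expR _|]ger0_norm// expR_ge0.
  under eq_integral do rewrite mul1r EFinD.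
  have i1 : (mu' \x nu')%E.-integrable setT (EFin \o (cst 1 : borel X * borel Y -> R)).
    exact: (@bounded_integrable _ _ _ _ _ `|1|).
  rewrite (integralD_EFin _ ie i1)//.
  rewrite E1 EFinD; congr (_ + _)%E.
  by rewrite (integral_cst _ measurableT 1)%E mul1e; exact: probability_setT.
Qed.

Hypothesis f_ui : forall e, 0 < e -> exists2 C, 0 <= C & forall n,
  (\int[mu_ n]_(x in [set x | (C < f_ n x)%R]) (f_ n x)%:E <= e%:E)%E.
Hypothesis g_ui : forall e, 0 < e -> exists2 C, 0 <= C & forall n,
  (\int[nu_ n]_(y in [set y | (C < g_ n y)%R]) (g_ n y)%:E <= e%:E)%E.

(* Fatou applied to transport cost and entropy bounds the limit of the values from
   below, and uniform integrability bounds each potential from above, so all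
   the inequalities are equalities. *)
Lemma potentials_integral_subseq : exists chi, [/\ increasing_seq chi,
  \int[mu_ (chi n)]_x f_ (chi n) x @[n --> \oo] --> \int[mu]_x f x &
  \int[nu_ (chi n)]_y g_ (chi n) y @[n --> \oo] --> \int[nu]_y g y].
Proof.
have split_ n : exists ab : R * R, [/\ 0 <= ab.1, 0 <= ab.2,
    ab.1 + ab.2 = \int[mu_ n]_x f_ n x + \int[nu_ n]_y g_ n y,
    (\int[(mu_ n \x nu_ n)%E]_z (c z * expR (f_ n z.1 + g_ n z.2 - c z))%:E = ab.1%:E)%E &
    (\int[(mu_ n \x nu_ n)%E]_z (cst 1 z * ((f_ n z.1 + g_ n z.2 - c z) *
       expR (f_ n z.1 + g_ n z.2 - c z) + 1))%:E = (ab.2 + 1)%:E)%E].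
  have [[pcn pdn] ifn ign _ _] := data n.
  by have [a [b H]] := gibbs_cost_split pcn pdn ifn ign; exists (a, b).
have [ab abP] := choice split_.
have fle n : `|\int[mu_ n]_x f_ n x| <= B.
  have [_ ifn _ fB _] := data n; apply: le_trans fB; exact: le_normr_Rintegral.
have gle n : `|\int[nu_ n]_y g_ n y| <= B.
  have [_ _ ign _ gB] := data n; apply: le_trans gB; exact: le_normr_Rintegral.
(* Costs, entropies and the two means are made to converge along one subsequence. Cost and entropy
   are bounded because they are nonnegative and their sum is that of the two means. *)
pose u i n := nth 0 [:: (ab n).1; (ab n).2; \int[mu_ n]_x f_ n x; \int[nu_ n]_y g_ n y] i.
have [|chi [chi_incr chi_cvg]] := @diagonal_extraction_nat R u.
  move=> i; exists (B + B) => n.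
  have [a0 b0 abE _ _] := abP n.
  have := fle n; have := gle n; rewrite !ler_norml => /andP[? ?] /andP[? ?].
  rewrite /u; case: i => [|[|[|[|i]]]] /=; apply/andP; split; rewrite ?nth_nil; lra.
have a_cvg := chi_cvg 0%N; have b_cvg := chi_cvg 1%N.
have p_cvg := chi_cvg 2%N; have q_cvg := chi_cvg 3%N.
rewrite /u/= in a_cvg b_cvg p_cvg q_cvg.
have [a [b [a0 b0 abE aI bI]]] := gibbs_cost_split pic pid intf intg.
have mu_cvg' := weak_cvg_subseq chi_incr mu_cvg.
have nu_cvg' := weak_cvg_subseq chi_incr nu_cvg.
have f_cvg' := approx_cvg_subseq chi_incr f_cvg.
have g_cvg' := approx_cvg_subseq chi_incr g_cvg.
have intf' n : (mu_ (chi n)).-integrable setT (EFin \o f_ (chi n)) by have [] := data (chi n).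
have intg' n : (nu_ (chi n)).-integrable setT (EFin \o g_ (chi n)) by have [] := data (chi n).
have fB' n : \int[mu_ (chi n)]_x `|f_ (chi n) x| <= B by have [] := data (chi n).
have gB' n : \int[nu_ (chi n)]_y `|g_ (chi n) y| <= B by have [] := data (chi n).
have [phi_cvg phi_tight] := limit_potentials_phi c_cont mu_cvg' nu_cvg'
  (eot_data_subseq chi data) f_cvg' g_cvg'.
have rho_cvg := product_weak_cvg mu_cvg' nu_cvg'.
have mphi (f' : {mfun borel X >-> R}) (g' : {mfun borel Y >-> R}) :
    measurable_fun setT (fun z : borel X * borel Y => f' z.1 + g' z.2 - c z).
  exact: measurable_sum_cost.
have a_le : a <= limn (fun n => (ab (chi n)).1).
  apply/ler_addgt0Pr => e e0; rewrite -lee_fin -aI.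
  apply: (approx_cvg_fatou (@prod_continuous_measurable R X Y) rho_cvg (fun n => mphi _ _) (mphi _ _) phi_cvg phi_tight
    c_cont (@continuous_expR R) c_ge0 (@expR_ge0 R)).
  have /cvgrPdist_le/(_ _ e0) := a_cvg; apply: filterS => n.
  have [_ _ _ -> _] := abP (chi n).
  by rewrite lee_fin ler_norml => /andP[? ?]; lra.
have b_le : b <= limn (fun n => (ab (chi n)).2).
  apply/ler_addgt0Pr => e e0; rewrite -(lerD2r 1) -lee_fin -bI.
  have c1 : continuous (cst 1 : borel X * borel Y -> R) by move=> z; exact: cvg_cst.
  have ck : continuous (fun t : R => t * expR t + 1).
    move=> t; apply: cvgD; last exact: cvg_cst.
    by apply: cvgM; [exact: cvg_id|exact: continuous_expR].
  have k0 (t : R) : 0 <= t * expR t + 1.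
    have := expR_ge1Dx (- t); rewrite expRN => H.
    have e_gt0 := expR_gt0 t.
    have : (1 - t) * expR t <= 1 by rewrite -ler_pdivlMr// div1r.
    rewrite mulrBl mul1r; lra.
  apply: (approx_cvg_fatou (@prod_continuous_measurable R X Y) rho_cvg (fun n => mphi _ _) (mphi _ _) phi_cvg phi_tight
    c1 ck (fun=> ler01) k0).
  have /cvgrPdist_le/(_ _ e0) := b_cvg; apply: filterS => n.
  have [_ _ _ _ ->] := abP (chi n).
  by rewrite lee_fin ler_norml => /andP[? ?]; lra.
have p_le := uniformly_integrable_limit_le (@borel_continuous_measurable R X) mu_cvg' intf' fB' intf f_cvg'
  (fun e e0 => let: ex_intro2 C C0 H := f_ui e0 in ex_intro2 _ _ C C0 (fun n => H (chi n))) p_cvg.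
have q_le := uniformly_integrable_limit_le (@borel_continuous_measurable R Y) nu_cvg' intg' gB' intg g_cvg'
  (fun e e0 => let: ex_intro2 C C0 H := g_ui e0 in ex_intro2 _ _ C C0 (fun n => H (chi n))) q_cvg.
have abpq : limn (fun n => (ab (chi n)).1) + limn (fun n => (ab (chi n)).2) =
    limn (fun n => \int[mu_ (chi n)]_x f_ (chi n) x) +
    limn (fun n => \int[nu_ (chi n)]_y g_ (chi n) y).
  rewrite -!limD//; congr (limn _); apply/funext => n.
  by have [_ _ E _ _] := abP (chi n).
exists chi; split => //.
  by rewrite (_ : \int[mu]_x f x = limn (fun n => \int[mu_ (chi n)]_x f_ (chi n) x))//; lra.
by rewrite (_ : \int[nu]_y g y = limn (fun n => \int[nu_ (chi n)]_y g_ (chi n) y))//; lra.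
Qed.

End limit_values.

(** * Convergence of the whole sequence *)

(** If infinitely many terms avoided a neighbourhood of [l], choosing such indices one after the
    other would give a subsequence none of whose subsequences converges to [l]. *)
Lemma cvg_subsequence_principle (T : topologicalType) (u : nat -> T) (l : T) :
  (forall psi, increasing_seq psi ->
     exists2 phi, increasing_seq phi & u (psi (phi n)) @[n --> \oo] --> l) ->
  u n @[n --> \oo] --> l.
Proof.
move=> sub V lV; apply: contrapT => nV.
have step m : exists n, (m < n)%N /\ ~ V (u n).
  apply: contrapT => no; apply: nV; exists m.+1 => // n /= mn.
  by apply: contrapT => nVn; apply: no; exists n.
have [s sP] := choice step.
have [|phi _ cv] := sub (fun n => iter n.+1 s 0%N).
  by apply/increasing_seqP => n /=; have [] := sP (s (iter n s 0%N)).
have [N _ NV] := cv _ lV.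
by have [_] := sP (iter (phi N) s 0%N); apply; exact: (NV N (leqnn N)).
Qed.

Lemma ereal_sup_cvg0 (R : realType) (u : nat -> nat -> \bar R) :
  (forall k n, (0 <= u k n <= (2 * dyad R k)%:E)%E) ->
  (ereal_sup [set u k n | n in [set: nat]] @[k --> \oo] --> 0)%E.
Proof.
move=> ub; apply: (@squeeze_cvge _ _ _ _ (cst 0%E) _ (fun k => (2 * dyad R k)%:E)).
- apply: nearW => k; apply/andP; split.
    by apply: ereal_sup_ge; exists (u k 0%N); [exists 0%N|have /andP[] := ub k 0%N].
  by apply: ge_ereal_sup => _ [n _ <-]; have /andP[] := ub k n.
- exact: cvg_cst.
- apply: cvg_EFin; first exact: nearW.
  apply/cvgrPdist_lt => e e0; have e2 : 0 < e / 2 by rewrite divr_gt0.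
  apply: filterS (dyad_near0 e2) => k ke.
  by rewrite sub0r normrN /= ger0_norm ?mulr_ge0 ?(ltW (dyad_gt0 _ _))//; lra.
Qed.

Lemma ae_cvg_in_probability (R : realType) d (T : measurableType d)
    (P : probability T R) (h_ : nat -> T -> R) (h : T -> R) :
  (forall k, measurable_fun setT (h_ k)) -> measurable_fun setT h ->
  {ae P, forall x, h_ k x @[k --> \oo] --> h x} -> cvg_in_probability P h_ h.
Proof.
move=> mh_ mh cvh e e0.
have mA k : measurable [set x | e <= `|h_ k x - h x|].
  by apply: measurable_ge_norm; exact: measurable_funB.
have E k : P [set x | e <= `|h_ k x - h x|] =
    (\int[P]_x (\1_[set x | e <= `|h_ k x - h x|] x))%:E.
  rewrite /Rintegral integral_indic// setIT fineK//; exact: fin_num_measure.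
rewrite (_ : (fun k => P _) = EFin \o
    (fun k => \int[P]_x (\1_[set x | e <= `|h_ k x - h x|] x))); last exact/funext.
apply: cvg_EFin; first exact: nearW.
rewrite -[X in _ --> X](Rintegral_cst_probability P).
apply: (@bounded_cvg_Rintegral _ _ _ _ _ _ 1).
- by move=> k; exact: measurable_indic.
- exact: measurable_cst.
- by move=> k x; rewrite indicE; case: (_ \in _); rewrite ?normr1 ?normr0.
- apply: filterS cvh => x cx; apply: cvg_near_cst.
  move/cvgrPdist_lt : cx => /(_ _ e0); apply: filterS => k hk.
  by rewrite indicE memNset//= => /le_lt_trans/(_ _); rewrite distrC => /(_ _ hk); rewrite ltxx.
Qed.

(** Equicontinuity yields uniform convergence on compact sets only. Multiplication by the indicator
    of [K k] makes it uniform on the whole space, at the price of the mass [dyad R k] under every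
    [mu_ n] and under [mu], which vanishes as [k] grows. *)
Lemma truncated_approximation (R : realType) (X : polishType R)
    (mu_ : nat -> probability (borel X) R) (mu : probability (borel X) R)
    (f_ : nat -> {mfun borel X >-> R}) (eps : nat -> R) (phi : nat -> nat)
    (K : nat -> set X) (F : nat -> nat -> X -> R) (G : nat -> X -> R)
    (f : {mfun borel X >-> R}) :
  subsequential_limit mu_ mu f_ eps phi K F G f ->
  exists (F_ : nat -> nat -> {mfun borel X >-> R}) (F' : nat -> {mfun borel X >-> R}),
  [/\ (ereal_sup [set mu_ n [set x | (eps k <= `|f_ n x - F_ n k x|)%R]
                  | n in [set: nat]] @[k --> \oo] --> 0)%E,
      forall k, {uniform, (F_ (phi l) k : X -> R) @[l --> \oo] --> (F' k : X -> R)} &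
      cvg_in_probability mu F' f].
Proof.
case=> cK tK tK' Feq Fapprox FG Gf _.
have mK k : measurable (K k : set (borel X)) by exact: compact_measurable_borel.
have mF k n : measurable_fun setT (F k n : borel X -> R).
  by apply: continuous_measurable_borel; exact: equicontinuous_seq_continuous (Feq k) n.
have mG k : measurable_fun setT (G k : borel X -> R).
  apply: continuous_measurable_borel.
  exact: (equicontinuous_lim_continuous (equicontinuous_subseq phi (Feq k)) (FG k)).
have mtr (h : borel X -> R) k : measurable_fun setT h ->
    measurable_fun setT (fun x : borel X => h x * \1_(K k : set (borel X)) x).
  by move=> mh; apply: measurable_funM => //; exact: measurable_indic.
pose F_ n k : {mfun borel X >-> R} :=
  HB.pack (fun x : borel X => F k n x * \1_(K k : set (borel X)) x)
    (isMeasurableFun.Build _ _ _ _ _ (mtr _ k (mF k n))).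
pose F' k : {mfun borel X >-> R} :=
  HB.pack (fun x : borel X => G k x * \1_(K k : set (borel X)) x)
    (isMeasurableFun.Build _ _ _ _ _ (mtr _ k (mG k))).
have trunc (P : probability (borel X) R) (H h : borel X -> R) (e : R) k :
    measurable_fun setT H -> measurable_fun setT h ->
    (P (~` K k : set (borel X)) <= (dyad R k)%:E)%E ->
    (P [set x | (e <= `|H x * \1_(K k : set (borel X)) x - h x|)%R] <=
     P [set x | (e <= `|H x - h x|)%R] + (dyad R k)%:E)%E.
  move=> mH mh PK; apply: le_trans (leeD2l _ PK).
  have mA : measurable [set x | e <= `|H x - h x|].
    by apply: measurable_ge_norm; exact: measurable_funB.
  have mC := measurableC (mK k).
  apply: le_trans (measureU2 P mA mC); apply: le_measure; rewrite ?inE.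
  - by apply: measurable_ge_norm; exact: (measurable_funB (mtr H k mH) mh).
  - exact: measurableU.
  - move=> x /= ex; have [Kx|Kx] := pselect (K k x); [left|by right].
    by move: ex; rewrite indicE mem_set// mulr1.
exists F_, F'; split.
- apply: ereal_sup_cvg0 => k n; rewrite measure_ge0 /=.
  have := trunc (mu_ n) _ _ (eps k) k (mF k n) (measurable_funPT (f_ n)) (tK k n).
  under eq_set do rewrite distrC.
  move=> /le_trans; apply; rewrite mulr_natl mulr2n EFinD leeD2r//.
  by under eq_set do rewrite distrC; exact: Fapprox.
- move=> k V /uniform_nbhs[E [entE EV]].
  move: entE; rewrite -entourage_ballE => -[e /= e0 eE].
  have e2 : 0 < e / 2 by rewrite divr_gt0.
  have := equicontinuous_cvg_compact (equicontinuous_subseq phi (Feq k)) (cK k) (FG k) e2.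
  apply: filterS => l Fl; apply: EV => x _; apply: eE => /=.
  rewrite /ball/= indicE; case: (boolP (x \in K k)) => [|_]; last first.
    by rewrite !mulr0 subrr normr0.
  rewrite inE => Kx; rewrite !mulr1 distrC; apply: (le_lt_trans (Fl x Kx)).
  by rewrite ltr_pdivrMr// ltr_pMr// ltr1n.
- move=> e e0.
  apply: (@squeeze_cvge _ _ _ _ (cst 0%E) _ (fun k =>
    mu [set x | (e <= `|G k x - f x|)%R] + (dyad R k)%:E)%E).
  + apply: nearW => k; rewrite measure_ge0/=.
    exact: (trunc mu _ _ e k (mG k) (measurable_funPT f) (tK' k)).
  + exact: cvg_cst.
  + rewrite -[X in _ --> X]adde0; apply: cvgeD => //.
      exact: (ae_cvg_in_probability mG (measurable_funPT f) Gf).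
    apply: cvg_EFin; first exact: nearW.
    apply/cvgrPdist_lt => d d0; apply: filterS (dyad_near0 d0) => k kd.
    by rewrite sub0r normrN /= ger0_norm// ltW// dyad_gt0.
Qed.

Lemma ereal_sup_integral_bound (R : realType) d (T : measurableType d)
    (P_ : nat -> probability T R) (h_ : nat -> T -> R) :
  (ereal_sup [set \int[P_ n]_x (Num.max (h_ n x) 0)%:E | n in [set: nat]] < +oo)%E ->
  exists2 A, 0 <= A & forall n, (\int[P_ n]_x (Num.max (h_ n x) 0)%:E <= A%:E)%E.
Proof.
set S := ereal_sup _ => Soo.
have le n : (\int[P_ n]_x (Num.max (h_ n x) 0)%:E <= S)%E.
  by apply: ereal_sup_ubound; exists n.
have S0 : (0 <= S)%E.
  by apply: le_trans (le 0%N); apply: integral_ge0 => x _; rewrite lee_fin le_max lexx orbT.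
have Sfin : S \is a fin_num by rewrite ge0_fin_numE.
by exists (fine S) => [|n]; rewrite ?fine_ge0// fineK.
Qed.

(** From [|h| = 2 * max h 0 - h]: given the bound on the positive part, a lower bound on the mean of
    [h] becomes a bound in L^1. *)
Lemma Rintegral_norm_le_pos_part (R : realType) d (T : measurableType d)
    (P : probability T R) (h : T -> R) (A : R) : P.-integrable setT (EFin \o h) ->
  (\int[P]_x (Num.max (h x) 0)%:E <= A%:E)%E ->
  \int[P]_x h x <= A /\ \int[P]_x `|h x| <= A + A - \int[P]_x h x.
Proof.
move=> ih hA; have mh : measurable_fun setT h by apply/measurable_EFinP; exact: measurable_int ih.
have im : P.-integrable setT (EFin \o (fun x => Num.max (h x) 0)).
  apply: le_integrable ih => //.
    by apply/measurable_EFinP; exact: measurable_maxr.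
  move=> x _; rewrite lee_fin/= ger0_norm ?le_max ?lexx ?orbT//.
  by rewrite ge_max ler_norm normr_ge0.
have {}hA : \int[P]_x Num.max (h x) 0 <= A.
  by rewrite -lee_fin /Rintegral fineK//; exact: integrable_fin_num im.
split.
  by apply: le_trans hA; apply: le_Rintegral => // x _; rewrite le_max lexx.
have E : \int[P]_x `|h x| =
    \int[P]_x Num.max (h x) 0 + \int[P]_x Num.max (h x) 0 - \int[P]_x h x.
  rewrite -RintegralD// -RintegralB//; last exact: integrable_realD.
  congr (fine _); apply: eq_integral => x _; congr _%:E.
  by have [h0|h0] := ltP (h x) 0; [rewrite ltr0_norm//|rewrite ger0_norm//]; lra.
by rewrite E lerD2r lerD.
Qed.

Lemma uniform_integrability_cutoff (R : realType) d (T : measurableType d)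
    (P_ : nat -> probability T R) (h_ : nat -> T -> R) :
  (ereal_sup [set \int[P_ n]_(x in [set x | (C < h_ n x)%R]) (h_ n x)%:E
     | n in [set: nat]] @[C --> +oo%R] --> 0)%E ->
  forall e, 0 < e -> exists2 C, 0 <= C & forall n,
    (\int[P_ n]_(x in [set x | (C < h_ n x)%R]) (h_ n x)%:E <= e%:E)%E.
Proof.
move=> cv e e0.
have : \forall C \near +oo, (ereal_sup [set \int[P_ n]_(x in [set x | (C < h_ n x)%R])
    (h_ n x)%:E | n in [set: nat]] < e%:E)%E.
  have := cv [set y | (y < e%:E)%E]; apply; apply: open_nbhs_nbhs; split.
    exact: open_ereal_lt_ereal.
  by rewrite /= lte_fin.
move=> H; have [C [C0 Ce]] := filter_ex (filterI (nbhs_pinfty_ge (num_real (0 : R))) H).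
exists C => // n; apply: le_trans (ltW Ce).
by apply: ereal_sup_ubound; exists n.
Qed.

Section eot_sequences.
Context (R : realType) (X Y : polishType R) (c : X * Y -> R).
Hypotheses (c_ge0 : forall z, 0 <= c z) (c_cont : continuous c).
Context (mu_ : nat -> probability (borel X) R) (nu_ : nat -> probability (borel Y) R)
  (pi_ : nat -> probability (borel X * borel Y)%type R)
  (f_ : nat -> {mfun borel X >-> R}) (g_ : nat -> {mfun borel Y >-> R}).

Lemma eot_data_exists :
  (forall n, optimal_coupling c (mu_ n) (nu_ n) (pi_ n)) ->
  (forall n, potentials c (mu_ n) (nu_ n) (f_ n) (g_ n)) ->
  (ereal_sup [set \int[mu_ n]_x (Num.max (f_ n x) 0)%:E | n in [set: nat]] < +oo)%E ->
  (ereal_sup [set \int[nu_ n]_y (Num.max (g_ n y) 0)%:E | n in [set: nat]] < +oo)%E ->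
  exists B, eot_data c mu_ nu_ f_ g_ pi_ B.
Proof.
move=> pi_opt fg_pot /ereal_sup_integral_bound[A1 A10 fA1] /ereal_sup_integral_bound[A2 A20 gA2].
(* The value is nonnegative, so minus the mean of one potential is at most the mean of the other:
   the norm of [f_ n] is at most [2 * A1 + A2], and that of [g_ n] at most [2 * A2 + A1]. *)
exists (A1 + A1 + (A2 + A2)) => n.
have [pi' [pi'_opt pi'd]] := iffLR (potentialsP c_cont _ _ _ _) (fg_pot n).
have [intf intg] : (mu_ n).-integrable setT (EFin \o f_ n) /\ (nu_ n).-integrable setT (EFin \o g_ n).
  apply: (potentials_integrable c_ge0 c_cont pi'_opt pi'd).
    exact: le_lt_trans (fA1 n) (ltry _).
  exact: le_lt_trans (gA2 n) (ltry _).
have [val_fin pic' costE] := pi'_opt.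
have [_ valE uniq] := gibbs_optimal c_ge0 c_cont pic' pi'd intf intg.
(* The coupling [pi'] that comes with the potentials need not be the given [pi_ n] as a term, but
   uniqueness makes the two agree on measurable sets. *)
have pid : has_density (pi_ n) (mu_ n \x nu_ n)%E (gibbs_density c (f_ n) (g_ n)).
  have [mq q0 qE] := pi'd; split => // A mA.
  by rewrite (uniq _ (pi_opt n))// qE.
have val0 : 0 <= \int[mu_ n]_x f_ n x + \int[nu_ n]_y g_ n y.
  rewrite -lee_fin -valE -costE; apply: adde_ge0; last exact: relative_entropy_ge0.
  by apply: integral_ge0 => z _; rewrite lee_fin.
have [f1 f2] := Rintegral_norm_le_pos_part intf (fA1 n).
have [g1 g2] := Rintegral_norm_le_pos_part intg (gA2 n).
have [_ pic _] := pi_opt n.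
split => //.
- by apply: (le_trans f2); lra.
- by apply: (le_trans g2); lra.
Qed.

Context (B : R) (data : eot_data c mu_ nu_ f_ g_ pi_ B).
Context (mu : probability (borel X) R) (nu : probability (borel Y) R)
  (mu_cvg : weak_cvg mu_ mu) (nu_cvg : weak_cvg nu_ nu).

Lemma subsequential_limits_exist (eps : nat -> R) (psi : nat -> nat) :
  (forall k, 0 < eps k) -> increasing_seq psi ->
  exists2 chi, increasing_seq chi &
  exists K F G f, subsequential_limit mu_ mu f_ eps (psi \o chi) K F G f /\
  exists K' F' G' g, subsequential_limit nu_ nu g_ eps (psi \o chi) K' F' G' g /\
  exists pi, [/\ coupling mu nu pi, has_density pi (mu \x nu)%E (gibbs_density c f g),
    weak_cvg (pi_ \o (psi \o chi)) pi,
    mu.-integrable setT (EFin \o f) & nu.-integrable setT (EFin \o g)].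
Proof.
move=> eps0 psi_incr.
have [psi1 [psi1_incr [K [F [G [f HX]]]]]] := subsequential_limit_exists mu_cvg
  (approximation_fst c_ge0 c_cont mu_cvg nu_cvg data) psi_incr eps0.
have psi01_incr := increasing_seq_comp psi_incr psi1_incr.
have [psi2 [psi2_incr [K' [F' [G' [g HY]]]]]] := subsequential_limit_exists nu_cvg
  (approximation_snd c_ge0 c_cont mu_cvg nu_cvg data) psi01_incr eps0.
(* The subsequence for the second marginal is extracted last and refines that of the first, so here
   the identity suffices. *)
have {}HX := HX _ psi2_incr; have {}HY := HY id (fun _ _ => erefl).
have chi_incr := increasing_seq_comp psi1_incr psi2_incr.
exists (psi1 \o psi2) => //; exists K, F, G, f; split => //.
exists K', F', G', g; split => //.
have i := increasing_seq_comp psi_incr chi_incr.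
have mu_cvg' := weak_cvg_subseq i mu_cvg; have nu_cvg' := weak_cvg_subseq i nu_cvg.
have f_cvg := subl_approx_cvg HX; have g_cvg := subl_approx_cvg HY.
have data' := eot_data_subseq (psi \o (psi1 \o psi2)) data.
have [pi [pic pid pi_cvg]] := limit_potentials c_ge0 c_cont mu_cvg' nu_cvg' data' f_cvg g_cvg.
have [intf intg] := limit_potentials_integrable mu_cvg' nu_cvg' data' f_cvg g_cvg.
by exists pi; split.
Qed.

End eot_sequences.

Lemma continuous_bounded_atan (R : realType) :
  continuous (@atan R) /\ bounded_fun (@atan R).
Proof.
split; first by move=> t; exact: continuous_atan.
apply: (@bounded_fun_le _ _ _ (pi / 2)) => t.
by rewrite ler_norml !ltW ?atan_gtNpi2 ?atan_ltpi2.
Qed.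

Lemma approx_cvg_distribution (R : realType) (X : polishType R)
    (P_ : nat -> probability (borel X) R) (P : probability (borel X) R)
    (f_ : nat -> {mfun borel X >-> R}) (f : {mfun borel X >-> R}) (B : R) (k : R -> R) :
  weak_cvg P_ P -> (forall n, (P_ n).-integrable setT (EFin \o f_ n)) ->
  (forall n, \int[P_ n]_x `|f_ n x| <= B) ->
  approx_cvg P_ P (fun n => f_ n) f -> continuous k -> bounded_fun k ->
  \int[P_ n]_x k (f_ n x) @[n --> \oo] --> \int[P]_x k (f x).
Proof.
move=> P_cvg intf fB f_cvg ck bk.
have c1 : continuous (cst 1 : borel X -> R) by move=> x; exact: cvg_cst.
have b1 : bounded_fun (cst 1 : borel X -> R).
  by apply: (@bounded_fun_le _ _ _ 1) => x; rewrite normr1.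
have := approx_cvg_Rintegral (@borel_continuous_measurable R X) P_cvg (fun n => measurable_funPT (f_ n)) (measurable_funPT f)
  f_cvg (tight_seq_of_Rintegral intf fB) c1 b1 ck bk.
rewrite (_ : \int[P]_x _ = \int[P]_x k (f x)); last first.
  by congr fine; apply: eq_integral => x _; rewrite mul1r.
rewrite (_ : (fun n => \int[P_ n]_x _) = fun n => \int[P_ n]_x k (f_ n x))//.
by apply/funext => n; congr fine; apply: eq_integral => x _; rewrite mul1r.
Qed.

Lemma Rintegral_distribution (R : realType) d (T : measurableType d)
    (P : probability T R) (f : {mfun T >-> R}) (k : R -> R) :
  continuous k -> \int[distribution P f]_t k t = \int[P]_x k (f x).
Proof.
move=> ck; have mk : measurable_fun setT k by exact: continuous_measurable_fun.
congr fine; symmetry.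
apply: (pushforward_integral (measurable_funPT f) (Q := distribution P f)
  (fun _ _ => erefl) (h := fun t => (k t)%:E)).
exact/measurable_EFinP.
Qed.

Lemma bounded_real_cvg_subsequence (R : realType) (u : nat -> R) (M : R) :
  (forall n, `|u n| <= M) ->
  exists phi, increasing_seq phi /\ exists l : R, u (phi n) @[n --> \oo] --> l.
Proof.
move=> uM; have [|phi [phi_incr cv]] := @diagonal_extraction_nat R (fun=> u).
  by move=> _; exists M.
by exists phi; split => //; exists (limn (u \o phi)); exact: (cv 0%N).
Qed.

Lemma approx_cvg_ae (R : realType) d (T : topMeasurableType d)
    (P_ : nat -> probability T R) (P : probability T R)
    (f_ : nat -> T -> R) (f f' : T -> R) :
  {ae P, forall x, f x = f' x} -> approx_cvg P_ P f_ f' -> approx_cvg P_ P f_ f.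
Proof.
move=> ff' [F [cF Ff FP]]; exists F; split => //.
apply: (negligibleS _ (negligibleU ff' Ff)) => x /= nFf.
apply: contrapT => /not_orP[/contrapT ffx /contrapT Fx]; apply: nFf.
by rewrite ffx.
Qed.

Section eot_limits.
Context (R : realType) (X Y : polishType R) (c : X * Y -> R).
Hypotheses (c_ge0 : forall z, 0 <= c z) (c_cont : continuous c).
Context (mu : probability (borel X) R) (nu : probability (borel Y) R).

Lemma normalized_potentials_unique (pi : probability (borel X * borel Y)%type R)
    (f f' : {mfun borel X >-> R}) (g g' : {mfun borel Y >-> R}) :
  coupling mu nu pi -> has_density pi (mu \x nu)%E (gibbs_density c f g) ->
  mu.-integrable setT (EFin \o f) -> nu.-integrable setT (EFin \o g) ->
  potentials c mu nu f' g' ->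
  \int[mu]_x atan (f' x) = \int[mu]_x atan (f x) ->
  {ae mu, forall x, f' x = f x} /\ {ae nu, forall y, g' y = g y}.
Proof.
move=> pic pid intf intg /(iffLR (potentialsP c_cont _ _ _ _))[pi' [pi'_opt pi'd]] atanE.
have [_ _ uniq] := gibbs_optimal c_ge0 c_cont pic pid intf intg.
have pi'd2 : has_density pi' (mu \x nu)%E (gibbs_density c f g).
  by have [mq q0 qE] := pid; split => // A mA; rewrite (uniq _ pi'_opt)// qE.
have [a [ff gg]] := potentials_unique pi'd pi'd2.
have a0 := atan_normalization (measurable_funPT f') (measurable_funPT f) ff atanE.
by split; [apply: filterS ff => x|apply: filterS gg => y]; rewrite a0 ?addr0 ?subr0.
Qed.

Context (mu_ : nat -> probability (borel X) R) (nu_ : nat -> probability (borel Y) R)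
  (pi_ : nat -> probability (borel X * borel Y)%type R)
  (f_ : nat -> {mfun borel X >-> R}) (g_ : nat -> {mfun borel Y >-> R})
  (B : R) (data : eot_data c mu_ nu_ f_ g_ pi_ B)
  (mu_cvg : weak_cvg mu_ mu) (nu_cvg : weak_cvg nu_ nu).

Lemma subsequential_potentials (psi : nat -> nat) : increasing_seq psi ->
  exists2 chi : nat -> nat, increasing_seq chi &
  exists (f : {mfun borel X >-> R}) (g : {mfun borel Y >-> R}) pi, [/\ approx_cvg (mu_ \o (psi \o chi)) mu (fun n => f_ (psi (chi n))) f,
    approx_cvg (nu_ \o (psi \o chi)) nu (fun n => g_ (psi (chi n))) g &
    [/\ coupling mu nu pi, has_density pi (mu \x nu)%E (gibbs_density c f g),
    weak_cvg (pi_ \o (psi \o chi)) pi,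
    mu.-integrable setT (EFin \o f) & nu.-integrable setT (EFin \o g)]].
Proof.
move=> psi_incr.
have [chi chi_incr [K [F [G [f [HX [K' [F' [G' [g [HY [pi H]]]]]]]]]]]] :=
  subsequential_limits_exist c_ge0 c_cont data mu_cvg nu_cvg (dyad_gt0 R) psi_incr.
by exists chi => //; exists f, g, pi; split => //; [case: HX|case: HY].
Qed.

Lemma optimal_coupling_weak_cvg pi : optimal_coupling c mu nu pi -> weak_cvg pi_ pi.
Proof.
move=> pi_opt h ch bh; apply: cvg_subsequence_principle => psi psi_incr.
have [chi chi_incr [f [g [pi' [_ _ [pic pid pi_cvg intf intg]]]]]] :=
  subsequential_potentials psi_incr.
exists chi => //; have [_ _ uniq] := gibbs_optimal c_ge0 c_cont pic pid intf intg.
rewrite (_ : \int[pi]_z h z = \int[pi']_z h z); first exact: pi_cvg.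
by congr fine; apply: eq_measure_integral => A mA _; exact: uniq.
Qed.

Lemma eot_value_lt_pinfty : (eot_value c mu nu < +oo)%E /\
  exists pi, optimal_coupling c mu nu pi.
Proof.
have [chi _ [f [g [pi [_ _ [pic pid _ intf intg]]]]]] :=
  @subsequential_potentials id (fun _ _ => erefl).
have [opt _ _] := gibbs_optimal c_ge0 c_cont pic pid intf intg.
by split; [have [] := opt|exists pi].
Qed.

Lemma subsequence_atan_cvg (phi : nat -> nat) (f : {mfun borel X >-> R}) (alpha : R) :
  increasing_seq phi -> \int[mu_ n]_x atan (f_ n x) @[n --> \oo] --> alpha ->
  approx_cvg (mu_ \o phi) mu (fun n => f_ (phi n)) f -> \int[mu]_x atan (f x) = alpha.
Proof.
move=> phi_incr alpha_cvg f_cvg; have [ca ba] := continuous_bounded_atan R.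
have := approx_cvg_distribution (weak_cvg_subseq phi_incr mu_cvg) _ _ f_cvg ca ba.
move=> /(_ B) H; apply: (cvg_unique _ (H _ _)) => //.
- by move=> n; have [] := data (phi n).
- by move=> n; have [] := data (phi n).
- exact: (cvg_comp _ _ (increasing_seq_cvg phi_incr) alpha_cvg).
Qed.

Section normalized.
Context (alpha : R) (f : {mfun borel X >-> R}) (g : {mfun borel Y >-> R}).
Hypotheses (alpha_cvg : \int[mu_ n]_x atan (f_ n x) @[n --> \oo] --> alpha)
  (fg_pot : potentials c mu nu f g) (f_alpha : \int[mu]_x atan (f x) = alpha).

(** The potentials extracted along a subsequence have arctangent mean [alpha], hence agree almost
    everywhere with the prescribed [f] and [g] and can be replaced by them. *)
Lemma normalized_subsequence (psi : nat -> nat) : increasing_seq psi ->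
  exists2 chi : nat -> nat, increasing_seq chi &
  exists pi, [/\ approx_cvg (mu_ \o (psi \o chi)) mu (fun n => f_ (psi (chi n))) f,
    approx_cvg (nu_ \o (psi \o chi)) nu (fun n => g_ (psi (chi n))) g &
    [/\ coupling mu nu pi, has_density pi (mu \x nu)%E (gibbs_density c f g),
    mu.-integrable setT (EFin \o f) & nu.-integrable setT (EFin \o g)]].
Proof.
move=> psi_incr.
have [chi chi_incr [f' [g' [pi [f_cvg g_cvg [pic pid _ intf intg]]]]]] :=
  subsequential_potentials psi_incr.
have psi_chi := increasing_seq_comp psi_incr chi_incr.
exists chi => //; exists pi.
have f'_alpha := subsequence_atan_cvg psi_chi alpha_cvg f_cvg.
have [|ff gg] := normalized_potentials_unique pic pid intf intg fg_pot.
  by rewrite f_alpha f'_alpha.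
have {}f_cvg := approx_cvg_ae ff f_cvg; have {}g_cvg := approx_cvg_ae gg g_cvg.
split => //; split => //.
(* The coupling [pi] was built from the extracted potentials; the density given by [f] and [g]
   belongs to the optimal coupling [pi'], which is the same measure. *)
- have [_ _ uniq] := gibbs_optimal c_ge0 c_cont pic pid intf intg.
  have [pi' [pi'_opt [mq q0 qE]]] := iffLR (potentialsP c_cont _ _ _ _) fg_pot.
  by split => // A mA; rewrite -(uniq _ pi'_opt)// qE.
- apply: (approx_cvg_integrable (B := B) _ (weak_cvg_subseq psi_chi mu_cvg) _ _ _ f_cvg) => //.
  + exact: borel_continuous_measurable.
  + by move=> n; have [] := data (psi (chi n)).
  + by move=> n; have [] := data (psi (chi n)).
- apply: (approx_cvg_integrable (B := B) _ (weak_cvg_subseq psi_chi nu_cvg) _ _ _ g_cvg) => //.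
  + exact: borel_continuous_measurable.
  + by move=> n; have [] := data (psi (chi n)).
  + by move=> n; have [] := data (psi (chi n)).
Qed.

Lemma distribution_weak_cvg :
  weak_cvg (fun n => distribution (mu_ n) (f_ n)) (distribution mu f) /\
  weak_cvg (fun n => distribution (nu_ n) (g_ n)) (distribution nu g).
Proof.
split=> h ch bh; rewrite Rintegral_distribution//;
  under eq_cvg do rewrite Rintegral_distribution//;
  apply: cvg_subsequence_principle => psi psi_incr;
  have [chi chi_incr [pi [f_cvg g_cvg _]]] := normalized_subsequence psi_incr;
  have psi_chi := increasing_seq_comp psi_incr chi_incr; exists chi => //.
- by apply: (approx_cvg_distribution (B := B) (weak_cvg_subseq psi_chi mu_cvg) _ _ f_cvg ch bh)
    => n; have [] := data (psi (chi n)).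
- by apply: (approx_cvg_distribution (B := B) (weak_cvg_subseq psi_chi nu_cvg) _ _ g_cvg ch bh)
    => n; have [] := data (psi (chi n)).
Qed.

End normalized.

Section uniformly_integrable.
Hypothesis f_ui : forall e, 0 < e -> exists2 C, 0 <= C & forall n,
  (\int[mu_ n]_(x in [set x | (C < f_ n x)%R]) (f_ n x)%:E <= e%:E)%E.
Hypothesis g_ui : forall e, 0 < e -> exists2 C, 0 <= C & forall n,
  (\int[nu_ n]_(y in [set y | (C < g_ n y)%R]) (g_ n y)%:E <= e%:E)%E.

Let integral_subseq (psi chi : nat -> nat) (f : {mfun borel X >-> R})
    (g : {mfun borel Y >-> R}) pi : increasing_seq psi -> increasing_seq chi ->
  approx_cvg (mu_ \o (psi \o chi)) mu (fun n => f_ (psi (chi n))) f ->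
  approx_cvg (nu_ \o (psi \o chi)) nu (fun n => g_ (psi (chi n))) g ->
  coupling mu nu pi -> has_density pi (mu \x nu)%E (gibbs_density c f g) ->
  mu.-integrable setT (EFin \o f) -> nu.-integrable setT (EFin \o g) ->
  exists2 chi', increasing_seq chi' &
  \int[mu_ (psi (chi' n))]_x f_ (psi (chi' n)) x @[n --> \oo] --> \int[mu]_x f x /\
  \int[nu_ (psi (chi' n))]_y g_ (psi (chi' n)) y @[n --> \oo] --> \int[nu]_y g y.
Proof.
move=> psi_incr chi_incr f_cvg g_cvg pic pid intf intg.
have psi_chi := increasing_seq_comp psi_incr chi_incr.
have [||chi' [chi'_incr H1 H2]] := potentials_integral_subseq c_ge0 c_cont
  (weak_cvg_subseq psi_chi mu_cvg) (weak_cvg_subseq psi_chi nu_cvg)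
  (eot_data_subseq (psi \o chi) data) f_cvg g_cvg pic pid intf intg.
- by move=> e e0; have [C C0 H] := f_ui e0; exists C => // n; exact: H.
- by move=> e e0; have [C C0 H] := g_ui e0; exists C => // n; exact: H.
by exists (chi \o chi') => //; exact: increasing_seq_comp.
Qed.

(** Values are sums of mean potentials by [gibbs_optimal]. The limit potentials may change with the
    subsequence, but the sum of their means is always the value for [mu] and [nu]. *)
Lemma eot_value_cvg : eot_value c (mu_ n) (nu_ n) @[n --> \oo] --> eot_value c mu nu.
Proof.
apply: cvg_subsequence_principle => psi psi_incr.
have [chi chi_incr [f [g [pi [f_cvg g_cvg [pic pid _ intf intg]]]]]] :=
  subsequential_potentials psi_incr.
have [chi' chi'_incr [H1 H2]] :=
  integral_subseq psi_incr chi_incr f_cvg g_cvg pic pid intf intg.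
exists chi' => //; have [_ -> _] := gibbs_optimal c_ge0 c_cont pic pid intf intg.
have valE n : eot_value c (mu_ (psi (chi' n))) (nu_ (psi (chi' n))) =
    (\int[mu_ (psi (chi' n))]_x f_ (psi (chi' n)) x +
     \int[nu_ (psi (chi' n))]_y g_ (psi (chi' n)) y)%:E.
  have [[pic' pid'] intf' intg' _ _] := data (psi (chi' n)).
  by have [_ -> _] := gibbs_optimal c_ge0 c_cont pic' pid' intf' intg'.
under eq_cvg do rewrite valE.
by apply: cvg_EFin; [exact: nearW|exact: cvgD].
Qed.

Lemma potentials_integral_cvg (alpha : R) (f : {mfun borel X >-> R})
    (g : {mfun borel Y >-> R}) :
  \int[mu_ n]_x atan (f_ n x) @[n --> \oo] --> alpha ->
  potentials c mu nu f g -> \int[mu]_x atan (f x) = alpha ->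
  (\int[mu_ n]_x (f_ n x)%:E @[n --> \oo] --> \int[mu]_x (f x)%:E)%E /\
  (\int[nu_ n]_y (g_ n y)%:E @[n --> \oo] --> \int[nu]_y (g y)%:E)%E.
Proof.
move=> alpha_cvg fg_pot f_alpha.
have fE d (T : measurableType d) (P : probability T R) (h : T -> R) :
    P.-integrable setT (EFin \o h) -> (\int[P]_x (h x)%:E)%E = (\int[P]_x h x)%:E.
  by move=> ih; rewrite /Rintegral fineK//; exact: integrable_fin_num ih.
split; apply: cvg_subsequence_principle => psi psi_incr;
  have [chi chi_incr [pi [f_cvg g_cvg [pic pid intf intg]]]] :=
    normalized_subsequence alpha_cvg fg_pot f_alpha psi_incr;
  have [chi' chi'_incr [H1 H2]] :=
    integral_subseq psi_incr chi_incr f_cvg g_cvg pic pid intf intg;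
  exists chi' => //; rewrite fE//.
- under eq_cvg => n do [rewrite fE; last by have [] := data (psi (chi' n))].
  by apply: cvg_EFin => //; exact: nearW.
- under eq_cvg => n do [rewrite fE; last by have [] := data (psi (chi' n))].
  by apply: cvg_EFin => //; exact: nearW.
Qed.

End uniformly_integrable.
End eot_limits.

Theorem theorem2p1 (R : realType) (X Y : polishType R)
    (c : X * Y -> R) (c_ge0 : forall z, 0 <= c z) (c_cont : continuous c)
    (mu_ : nat -> probability (borel X) R) (nu_ : nat -> probability (borel Y) R)
    (value_fin : forall n, (eot_value c (mu_ n) (nu_ n) < +oo)%E)
    (pi_ : nat -> probability (borel X * borel Y)%type R)
    (pi_opt : forall n, optimal_coupling c (mu_ n) (nu_ n) (pi_ n))
    (f_ : nat -> {mfun borel X >-> R}) (g_ : nat -> {mfun borel Y >-> R})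
    (fg_pot : forall n, potentials c (mu_ n) (nu_ n) (f_ n) (g_ n))
    (f_bound : (ereal_sup
       [set \int[mu_ n]_x ((Num.max (f_ n x) 0)%:E) | n in [set: nat]] < +oo)%E)
    (g_bound : (ereal_sup
       [set \int[nu_ n]_y ((Num.max (g_ n y) 0)%:E) | n in [set: nat]] < +oo)%E)
    (mu : probability (borel X) R) (nu : probability (borel Y) R)
    (mu_cvg : weak_cvg mu_ mu) (nu_cvg : weak_cvg nu_ nu) :
  let alpha_ n := \int[mu_ n]_x atan (f_ n x) in
  [/\
   (* (i) *)
   [/\ (eot_value c mu nu < +oo)%E,
       (exists pi, optimal_coupling c mu nu pi) &
       forall pi, optimal_coupling c mu nu pi -> weak_cvg pi_ pi],
   (* (ii) *)
   (exists phi : nat -> nat, increasing_seq phi /\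
     exists alpha : R, alpha_ (phi m) @[m --> \oo] --> alpha) /\
   (forall (alpha : R) (eps : nat -> R),
      alpha_ n @[n --> \oo] --> alpha ->
      (forall k, 0 < eps k < 1) -> nonincreasing_seq eps ->
      eps k @[k --> \oo] --> (0 : R) ->
      exists (F_ : nat -> nat -> {mfun borel X >-> R})
             (G_ : nat -> nat -> {mfun borel Y >-> R})
             (F : nat -> {mfun borel X >-> R}) (G : nat -> {mfun borel Y >-> R})
             (f : {mfun borel X >-> R}) (g : {mfun borel Y >-> R})
             (n_ : nat -> nat),
      increasing_seq n_ /\
      [/\
       (* (a) *)
       [/\ potentials c mu nu f g,
           mu.-integrable [set: borel X] (EFin \o f),
           nu.-integrable [set: borel Y] (EFin \o g) &
           \int[mu]_x atan (f x) = alpha],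
       (* (b) *)
       weak_cvg (fun n => distribution (mu_ n) (f_ n)) (distribution mu f) /\
       weak_cvg (fun n => distribution (nu_ n) (g_ n)) (distribution nu g),
       (* (c), with F_ n k for F_n^k *)
       (ereal_sup [set mu_ n [set x | (eps k <= `|f_ n x - F_ n k x|)%R]
                  | n in [set: nat]] @[k --> \oo] --> 0)%E /\
       (ereal_sup [set nu_ n [set y | (eps k <= `|g_ n y - G_ n k y|)%R]
                  | n in [set: nat]] @[k --> \oo] --> 0)%E,
       (* (d) *)
       forall k, {uniform, (F_ (n_ l) k : X -> R) @[l --> \oo] --> (F k : X -> R)} /\
                 {uniform, (G_ (n_ l) k : Y -> R) @[l --> \oo] --> (G k : Y -> R)} &
       (* (e) *)
       cvg_in_probability mu F f /\ cvg_in_probability nu G g]) &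
   (* (iii) *)
   (ereal_sup [set \int[mu_ n]_(x in [set x | (C < f_ n x)%R]) (f_ n x)%:E
              | n in [set: nat]] @[C --> +oo%R] --> 0)%E ->
   (ereal_sup [set \int[nu_ n]_(y in [set y | (C < g_ n y)%R]) (g_ n y)%:E
              | n in [set: nat]] @[C --> +oo%R] --> 0)%E ->
   (eot_value c (mu_ n) (nu_ n) @[n --> \oo] --> eot_value c mu nu) /\
   (forall (alpha : R) (f : {mfun borel X >-> R}) (g : {mfun borel Y >-> R}),
      alpha_ n @[n --> \oo] --> alpha ->
      potentials c mu nu f g -> \int[mu]_x atan (f x) = alpha ->
      (\int[mu_ n]_x (f_ n x)%:E @[n --> \oo] --> \int[mu]_x (f x)%:E)%E /\
      (\int[nu_ n]_y (g_ n y)%:E @[n --> \oo] --> \int[nu]_y (g y)%:E)%E)].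
Proof.
move=> alpha_.
have [B data] := eot_data_exists c_ge0 c_cont pi_opt fg_pot f_bound g_bound.
split.
- have [val_fin opt] := eot_value_lt_pinfty c_ge0 c_cont data mu_cvg nu_cvg.
  split => // pi; exact: (optimal_coupling_weak_cvg c_ge0 c_cont data mu_cvg nu_cvg).
- split.
    have [ca ba] := continuous_bounded_atan R; have [M aM] := bounded_funE ba.
    have ma : measurable_fun setT (@atan R) by exact: continuous_measurable_fun.
    apply: (@bounded_real_cvg_subsequence R alpha_ M) => n.
    by apply: bounded_Rintegral_le => //; exact: measurableT_comp.
  move=> alpha eps alpha_cvg eps01 _ _.
  have [|n_ n_incr [K [F [G [f [HX [K' [F' [G' [g [HY [pi [pic pid _ intf intg]]]]]]]]]]]]] :=
    @subsequential_limits_exist _ _ _ _ c_ge0 c_cont _ _ _ _ _ _ data _ _ mu_cvg nu_cvg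
    eps id _ (fun _ _ => erefl).
    by move=> k; have /andP[] := eps01 k.
  have [F_ [F'_ [F1 F2 F3]]] := truncated_approximation HX.
  have [G_ [G'_ [G1 G2 G3]]] := truncated_approximation HY.
  have [opt _ _] := gibbs_optimal c_ge0 c_cont pic pid intf intg.
  have fg : potentials c mu nu f g by apply/(potentialsP c_cont); exists pi.
  (* The means of the arctangent converge along the whole sequence, so the pair extracted along [n_]
     already has the right additive constant. *)
  have f_alpha := subsequence_atan_cvg data mu_cvg n_incr alpha_cvg (subl_approx_cvg HX).
  exists F_, G_, F'_, G'_, f, g, n_; split => //; split => //.
  exact: (distribution_weak_cvg c_ge0 c_cont data mu_cvg nu_cvg alpha_cvg fg f_alpha).
- move=> /uniform_integrability_cutoff f_ui /uniform_integrability_cutoff g_ui; split.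
    exact: (eot_value_cvg c_ge0 c_cont data mu_cvg nu_cvg f_ui g_ui).
  move=> alpha f g alpha_cvg fg f_alpha.
  exact: (potentials_integral_cvg c_ge0 c_cont data mu_cvg nu_cvg f_ui g_ui alpha_cvg fg f_alpha).
Qed.
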